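(* Let $\alpha_i : (F_0,A_0) \to (F_i,A_i)$, $i=1,2$, be morphisms of relative graphs, and let $(E,A)$ be the pushout relative graph. Let $A_{12} = (A_1\cup A_2)\cap F_0^0$, and let $I_0 = J(E,A;F_0,A_0)$ and $I_{12} = J(E,A;F_0,A_{12})$, ideals in $\mathcal{T}C^*(E,A)$. The following statements are equivalent: (a) The commuting square of canonical surjections $\mathcal{T}C^*(E,A)\to \mathcal{T}C^*(F_1,A_1)$, $\mathcal{T}C^*(E,A)\to \mathcal{T}C^*(F_2,A_2)$, $\mathcal{T}C^*(F_1,A_1)\to \mathcal{T}C^*(F_0,A_0)$, $\mathcal{T}C^*(F_2,A_2)\to \mathcal{T}C^*(F_0,A_0)$ is a pullback diagram of $C^*$-algebras. (b) The pair $(\alpha_1,\alpha_2)$ is admissible, i.e. $A_0 \subseteq A_1\cup A_2$. (c) $A_0 = A_{12}$. (d) $I_0 = I_{12}$. (e) $A_0\cap \mathrm{sing}(F_1)\subseteq A_2$, $A_0\cap \mathrm{sing}(F_2)\subseteq A_1$, and $A_0\cap \mathrm{reg}(E)\subseteq A_1\cup A_2$.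
   Context: Graphs. A directed graph is $E=(E^0,E^1,r,s)$ with vertex set $E^0$, edge set $E^1$, and range and source maps $r,s:E^1\to E^0$. A finite path is $e_1\cdots e_n$ with $s(e_i)=r(e_{i+1})$; its range is $r(e_1)$ and its source is $s(e_n)$; vertices are paths of length $0$. For $v\in E^0$ and $V,W\subseteq E^0$, $vE^1=\{e\in E^1: r(e)=v\}$ and $VE^1W=\{e\in E^1: r(e)\in V,\ s(e)\in W\}$. A vertex $v$ is regular if $vE^1$ is finite and nonempty, and singular otherwise; $\mathrm{reg}(E)$ and $\mathrm{sing}(E)$ are the sets of regular and singular vertices. A set $H\subseteq E^0$ is hereditary if $e\in E^1$ and $r(e)\in H$ imply $s(e)\in H$. Relative Toeplitz graph algebras. For $A\subseteq \mathrm{reg}(E)$, $\mathcal{T}C^*(E,A)$ is the universal $C^*$-algebra generated by mutually orthogonal projections $\{p_v:v\in E^0\}$ and partial isometries $\{s_e:e\in E^1\}$ satisfying: $s_e^*s_e=p_{s(e)}$; $s_e^*s_f=0$ for $e\ne f$; $p_{r(e)}s_e=s_e$; and $p_v=\sum_{e\in vE^1}s_es_e^*$ for all $v\in A$. Relative graphs. A relative graph is a pair $(F,B)$ with $F$ a directed graph and $B\subseteq \mathrm{reg}(F)$. A morphism $(F,B)\to(E,A)$ of relative graphs is an injective homomorphism of directed graphs $F\hookrightarrow E$, taken to be an inclusion, such that (1) $H_{F,E}:=E^0\setminus F^0$ is hereditary in $E$; (2) $F^1=F^0E^1F^0$; (3) $A\cap F^0\subseteq B$. For a morphism $(F,B)\to(E,A)$,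 $J(E,A;F,B)$ denotes the closed two-sided ideal of $\mathcal{T}C^*(E,A)$ generated by $\{p_v: v\in H_{F,E}\}\cup\{p_v-\sum_{e\in vF^1}s_es_e^*: v\in B\setminus A\}$. The canonical surjection $\mathcal{T}C^*(E,A)\to\mathcal{T}C^*(F,B)$ sends $p_v\mapsto p_v$ for $v\in F^0$, $p_v\mapsto 0$ for $v\in H_{F,E}$, $s_e\mapsto s_e$ for $e\in F^1$, $s_e\mapsto 0$ for $e\notin F^1$; its kernel is $J(E,A;F,B)$. Pushout. Given morphisms $\alpha_i:(F_0,A_0)\to(F_i,A_i)$, $i=1,2$, the pushout relative graph $(E,A)$ is given by $E=F_1\sqcup_{F_0}F_2$ (the disjoint union of $F_1$ and $F_2$ with the two copies of $F_0$ identified, so that $F_1$ and $F_2$ are regarded as subgraphs of $E$ with $F_1\cup F_2=E$ and $F_1\cap F_2=F_0$) and $A=(A_1\setminus F_0^0)\cup(A_2\setminus F_0^0)\cup(A_1\cap A_2)$. The inclusions $(F_i,A_i)\to(E,A)$ are morphisms of relative graphs for $i=0,1,2$, and so is $(F_0,A_{12})\to(E,A)$. *)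

(* Defs.v *)
(* The field of complex numbers is R[i], for R : realType. *)
From HB Require Import structures.
From mathcomp Require Import all_boot all_order all_algebra.
From mathcomp Require Import complex.
From mathcomp Require Import all_classical all_reals all_analysis.

Set Implicit Arguments.
Unset Strict Implicit.
Unset Printing Implicit Defensive.

Import Order.TTheory GRing.Theory Num.Theory numFieldNormedType.Exports.

Local Open Scope classical_set_scope.
Local Open Scope ring_scope.

(** * C*-algebras *)

(* C*-algebras are not assumed to be unital (and may be zero), so the product
   is a new operation rather than MathComp's unital ring product. The norm of
   a [completeNormedModType R[i]] takes its values in the nonnegative reals of
   R[i], whose order is: x <= y iff y - x is real and nonnegative. *)
HB.mixin Record isCStarAlgebra (R : realType) A
    & CompleteNormedModule R[i] A := {
  cmul : A -> A -> A ;
  star : A -> A ;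
  cmulA : forall x y z, cmul x (cmul y z) = cmul (cmul x y) z ;
  cmulDl : forall x y z, cmul (x + y) z = cmul x z + cmul y z ;
  cmulDr : forall x y z, cmul x (y + z) = cmul x y + cmul x z ;
  cmulZl : forall (c : R[i]) x y, cmul (c *: x) y = c *: cmul x y ;
  cmulZr : forall (c : R[i]) x y, cmul x (c *: y) = c *: cmul x y ;
  starK : forall x, star (star x) = x ;
  starD : forall x y, star (x + y) = star x + star y ;
  starZ : forall (c : R[i]) x, star (c *: x) = Num.conj c *: star x ;
  starM : forall x y, star (cmul x y) = cmul (star y) (star x) ;
  cnormM : forall x y, `|cmul x y| <= `|x| * `|y| ;
  cnorm_star : forall x, `|cmul (star x) x| = `|x| ^+ 2
}.

#[short(type="cstarAlgType")]
HB.structure Definition CStarAlgebra (R : realType) :=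
  { A of CompleteNormedModule R[i] A & isCStarAlgebra R A }.

Notation "x ** y" := (cmul x y) (at level 40, left associativity) : ring_scope.

(* Boundedness is automatic for *-homomorphisms of C*-algebras, and, as usual,
   it is not part of the definition. *)
Record star_hom (R : realType) (A B : cstarAlgType R) (f : A -> B) : Prop := {
  star_homD : forall x y, f (x + y) = f x + f y ;
  star_homZ : forall (c : R[i]) x, f (c *: x) = c *: f x ;
  star_homM : forall x y, f (x ** y) = f x ** f y ;
  star_hom_star : forall x, f (star x) = star (f x)
}.

Record cstar_subalgebra (R : realType) (A : cstarAlgType R) (S : set A) : Prop
  := {
  csub0 : S 0 ;
  csubD : forall x y, S x -> S y -> S (x + y) ;
  csubZ : forall (c : R[i]) x, S x -> S (c *: x) ;
  csubM : forall x y, S x -> S y -> S (x ** y) ;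
  csub_star : forall x, S x -> S (star x) ;
  csub_closed : closed S
}.

Definition generates (R : realType) (A : cstarAlgType R) (X : set A) : Prop :=
  forall S : set A, cstar_subalgebra S -> X `<=` S -> S = setT.

Record closed_ideal (R : realType) (A : cstarAlgType R) (J : set A) : Prop := {
  ideal0 : J 0 ;
  idealD : forall x y, J x -> J y -> J (x + y) ;
  idealZ : forall (c : R[i]) x, J x -> J (c *: x) ;
  idealMl : forall a x, J x -> J (a ** x) ;
  idealMr : forall a x, J x -> J (x ** a) ;
  ideal_closed : closed J
}.

Definition closed_ideal_gen (R : realType) (A : cstarAlgType R) (X : set A) :
    set A :=
  \bigcap_(J in [set J : set A | closed_ideal J /\ X `<=` J]) J.

(* The square of C*-algebras and *-homomorphisms
         f
     P ----> A
   g |       | h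
     v       v
     B ----> C
         k
   is a pullback diagram: it commutes and every coherent pair of morphisms
   into A and B factors uniquely through P. *)
Definition is_pullback (R : realType) (P A B C : cstarAlgType R)
    (f : P -> A) (g : P -> B) (h : A -> C) (k : B -> C) : Prop :=
  (forall x, h (f x) = k (g x)) /\
  forall (D : cstarAlgType R) (a : D -> A) (b : D -> B),
    star_hom a -> star_hom b -> (forall x, h (a x) = k (b x)) ->
    exists! d : D -> P,
      [/\ star_hom d, (forall x, f (d x) = a x) & forall x, g (d x) = b x].

(** * Directed graphs and relative graphs *)

Record digraph := Digraph {
  vert : choiceType ;
  edge : choiceType ;
  rng : edge -> vert ;
  src : edge -> vert
}.

(* v E^1: edges point towards their range, so these are the edges that v
   receives. *)
Definition in_edges (E : digraph) (v : vert E) : set (edge E) :=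
  [set e | rng e = v].

Definition reg (E : digraph) : set (vert E) :=
  [set v | finite_set (in_edges v) /\ in_edges v !=set0].

Arguments reg : clear implicits.

Definition sing (E : digraph) : set (vert E) := ~` reg E.
Arguments sing : clear implicits.

Definition hereditary (E : digraph) (H : set (vert E)) : Prop :=
  forall e : edge E, H (rng e) -> H (src e).

Record relgraph := RelGraph {
  rg_graph :> digraph ;
  rg_set : set (vert rg_graph) ;
  rg_set_reg : rg_set `<=` reg rg_graph
}.
Arguments rg_set : clear implicits.

Record gemb (F E : digraph) := GEmb {
  gv : vert F -> vert E ;
  ge : edge F -> edge E ;
  ge_rng : forall e, rng (ge e) = gv (rng e) ;
  ge_src : forall e, src (ge e) = gv (src e) ;
  gv_inj : injective gv ;
  ge_inj : injective ge
}.

Lemma gcomp_rng (F G E : digraph) (j : gemb G E) (i : gemb F G) e :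
  rng (ge j (ge i e)) = gv j (gv i (rng e)).
Proof. by rewrite !ge_rng. Qed.

Lemma gcomp_src (F G E : digraph) (j : gemb G E) (i : gemb F G) e :
  src (ge j (ge i e)) = gv j (gv i (src e)).
Proof. by rewrite !ge_src. Qed.

Definition gcomp (F G E : digraph) (j : gemb G E) (i : gemb F G) : gemb F E :=
  {| gv := gv j \o gv i ; ge := ge j \o ge i ;
     ge_rng := gcomp_rng j i ; ge_src := gcomp_src j i ;
     gv_inj := inj_comp (@gv_inj _ _ j) (@gv_inj _ _ i) ;
     ge_inj := inj_comp (@ge_inj _ _ j) (@ge_inj _ _ i) |}.

(* The vertices and edges of F, seen in E along the embedding i. *)
Definition gvset (F E : digraph) (i : gemb F E) : set (vert E) := range (gv i).
Definition geset (F E : digraph) (i : gemb F E) : set (edge E) := range (ge i).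

Record relmor (F E : relgraph) := RelMor {
  rm_emb :> gemb F E ;
  rm_hereditary : hereditary (~` gvset rm_emb) ;
  rm_full : geset rm_emb =
    [set e | gvset rm_emb (rng e) /\ gvset rm_emb (src e)] ;
  rm_set : gv rm_emb @^-1` rg_set E `<=` rg_set F
}.

(* (E,A), with the embeddings i1 and i2, is the pushout of a1 and a2. Both
   graphs F1 and F2 are seen as subgraphs of E with union E and with
   intersection F0. *)
Record is_pushout (F0 F1 F2 E : relgraph) (a1 : relmor F0 F1)
    (a2 : relmor F0 F2) (i1 : gemb F1 E) (i2 : gemb F2 E) : Prop := {
  po_commv : forall v, gv i1 (gv a1 v) = gv i2 (gv a2 v) ;
  po_comme : forall e, ge i1 (ge a1 e) = ge i2 (ge a2 e) ;
  po_unionv : gvset i1 `|` gvset i2 = setT ;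
  po_unione : geset i1 `|` geset i2 = setT ;
  po_interv : gvset i1 `&` gvset i2 = gvset (gcomp i1 a1) ;
  po_intere : geset i1 `&` geset i2 = geset (gcomp i1 a1) ;
  po_set : let A1 := gv i1 @` rg_set F1 in
           let A2 := gv i2 @` rg_set F2 in
           let V0 := gvset (gcomp i1 a1) in
           rg_set E = (A1 `\` V0) `|` (A2 `\` V0) `|` (A1 `&` A2)
}.

(** * Relative Toeplitz graph algebras *)

(* \sum_(e in v F^1) s_e s_e^*; meaningful when v is regular, since [\sum_(_ \in _)]
   is the sum of the nonzero terms if these are finitely many, and 0 otherwise. *)
Definition range_sum (R : realType) (F : digraph) (D : cstarAlgType R)
    (s : edge F -> D) (v : vert F) : D :=
  \sum_(e \in in_edges v) (s e ** star (s e)).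

Record toeplitz_family (R : realType) (E : relgraph) (D : cstarAlgType R)
    (p : vert E -> D) (s : edge E -> D) : Prop := {
  tf_proj : forall v, p v ** p v = p v /\ star (p v) = p v ;
  tf_orth : forall v w, v <> w -> p v ** p w = 0 ;
  tf_piso : forall e, s e ** star (s e) ** s e = s e ;
  tf_src : forall e, star (s e) ** s e = p (src e) ;
  tf_perp : forall e f, e <> f -> star (s e) ** s f = 0 ;
  tf_rng : forall e, p (rng e) ** s e = s e ;
  tf_ck : forall v, rg_set E v -> p v = range_sum s v
}.

(* TC^*(E,A), specified (hence determined up to canonical isomorphism) as a
   C*-algebra generated by a universal family. *)
Record TCstar (R : realType) (E : relgraph) := {
  tc_alg :> cstarAlgType R ;
  tc_p : vert E -> tc_alg ;
  tc_s : edge E -> tc_alg ;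
  tc_family : toeplitz_family tc_p tc_s ;
  tc_generated : generates (range tc_p `|` range tc_s) ;
  tc_universal : forall (D : cstarAlgType R) (p : vert E -> D)
      (s : edge E -> D), toeplitz_family p s ->
    exists f : tc_alg -> D,
      [/\ star_hom f, (forall v, f (tc_p v) = p v)
        & forall e, f (tc_s e) = s e]
}.

(* f is the canonical map TC^*(E,A) -> TC^*(F,B) for F embedded in E by i. *)
Record canonical_map (R : realType) (F E : relgraph) (i : gemb F E)
    (T : TCstar R E) (T' : TCstar R F) (f : T -> T') : Prop := {
  cm_hom : star_hom f ;
  cm_p : forall v, f (tc_p T (gv i v)) = tc_p T' v ;
  cm_p0 : forall v, ~ gvset i v -> f (tc_p T v) = 0 ;
  cm_s : forall e, f (tc_s T (ge i e)) = tc_s T' e ;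
  cm_s0 : forall e, ~ geset i e -> f (tc_s T e) = 0
}.

(* J(E,A;F,B), for F embedded in E by i. The sum is over v F^1, not v E^1. *)
Definition rel_ideal (R : realType) (E : relgraph) (T : TCstar R E)
    (F : digraph) (i : gemb F E) (B : set (vert F)) : set T :=
  closed_ideal_gen
    ([set tc_p T v | v in ~` gvset i] `|`
     [set tc_p T (gv i v) - range_sum (tc_s T \o ge i) v
        | v in B `\` gv i @^-1` rg_set E]).
Arguments rel_ideal {R E} T {F} i B.

(* Main.v *)
Require Import Defs.
From HB Require Import structures.
From mathcomp Require Import all_boot all_order all_algebra.
From mathcomp Require Import finmap complex ring lra.
From mathcomp Require Import all_classical all_reals all_analysis.

(** The conditions (b), (c) and (e) differ only by set theory, because a
    morphism of relative graphs forces A1 and A2 to trace subsets of A0 on F0,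
    and a vertex of F0 that is regular in F1 and in F2 is regular in E. The
    content is that (b) gives the pullback, and that a vertex v of A0 outside
    A1 and A2 contradicts both (a) and (d).

    Suppose that A0 lies in the union of A1 and A2, and let J1, J2 be the
    kernels of the two maps out of TC^*(E,A). Each canonical map is onto with
    kernel the ideal generated by the obvious elements ([canonical_surj],
    [canonical_ker]): the quotient of TC^*(E,A) by this ideal is a C*-algebra
    with a Toeplitz family for F, so that the universal property gives maps
    both ways. The generators of J1 and J2 annihilate each other with any
    element of TC^*(E,A) in between ([ideals_orthogonal]): an edge of E with
    range in F1 that is not in F1 has its source in F2 outside F0, the same
    holds with F1 and F2 exchanged, and the vertices of F1 outside F0 and
    those of F2 outside F0 form disjoint hereditary sets. Hence J1 and J2 are
    orthogonal, so they meet in 0, their sum is closed ([ideal_sum_closed]),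
    and by admissibility this sum contains the generators of the kernel of
    the map to TC^*(F0,A0) ([diagonal_kernel]). These facts say exactly that
    TC^*(E,A) maps bijectively to the set-theoretic pullback.

    Conversely, let v be a vertex of A0 outside A1 and A2. The finite paths of
    F0 with source v carry a Toeplitz family on their l^2 space in which all
    Cuntz-Krieger relations hold except the one at v, where the gap projection
    is the projection onto the path v of length zero ([path_family],
    [path_ck], [path_gap]). This family extends by zero to F1, F2 and E. So
    the gap at v is outside the ideal I_12, although it is a generator of I_0;
    and the pair formed by its image in TC^*(F1,A1) and by 0 is coherent but
    does not lift to TC^*(E,A) ([not_pullback]).

    The C*-algebras that the argument needs are all obtained in one way: a
    *-algebra with a C*-seminorm in which Cauchy sequences converge becomes a
    C*-algebra after identification of the null vectors ([cstar_seminorm],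
    [squot]). For a quotient the seminorm is the distance to the ideal; for
    the operators on l^2 the *-algebra consists of Cauchy sequences of
    adjointable operators on finitely supported functions; the complex
    numbers are an instance too. The analytic input is elementary and avoids
    spectral theory: star homomorphisms are contractive because a
    self-adjoint h of norm below 1 is the real part of the unitary
    h + i sqrt(1 - h^2) ([star_hom_contractive]), and the C*-identity in a
    quotient uses the contractions (1 + i t j)^-1 for j self-adjoint in the
    ideal, which come from the Cayley transform ([skew_resolvent],
    [ideal_approx_unit]). *)

Set Implicit Arguments.
Unset Strict Implicit.
Unset Printing Implicit Defensive.

Import Order.TTheory GRing.Theory Num.Theory numFieldNormedType.Exports.

Local Open Scope classical_set_scope.
Local Open Scope quotient_scope.
Local Open Scope ring_scope.

(** * Real-valued norms, limits and closed sets *)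

Section RealComplex.
Variable R : realType.
Implicit Types (r s : R) (c d : R[i]).

Lemma lecC r s : (r%:C%C <= s%:C%C) = (r <= s). Proof. exact: lecR. Qed.
Lemma ltcC r s : (r%:C%C < s%:C%C) = (r < s). Proof. exact: ltcR. Qed.

Lemma reCD r s : (r + s)%:C%C = r%:C%C + s%:C%C.
Proof. exact: (rmorphD (real_complex R)). Qed.

Lemma reCM r s : (r * s)%:C%C = r%:C%C * s%:C%C.
Proof. exact: (rmorphM (real_complex R)). Qed.

Lemma ger0_reC c : 0 <= c -> c = (complex.Re c)%:C%C.
Proof. by move=> c0; apply/esym/RRe_real/ger0_real. Qed.

Definition absc c : R := complex.Re `|c|.

Lemma abscE c : `|c| = (absc c)%:C%C. Proof. exact: ger0_reC. Qed.

Lemma absc_real r : absc r%:C%C = `|r|.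
Proof. by rewrite /absc normc_def /= expr0n /= addr0 sqrtr_sqr. Qed.

Lemma posC c : 0 < c -> exists2 r : R, 0 < r & c = r%:C%C.
Proof.
move=> c0; have cE := ger0_reC (ltW c0).
by exists (complex.Re c) => //; rewrite -ltcC -cE.
Qed.

Lemma conj_reC r : (r%:C%C : R[i])^* = r%:C%C.
Proof. by apply/eqP; rewrite eq_complex /= oppr0 !eqxx. Qed.

Lemma conj_i : ('i%C : R[i])^* = - 'i%C.
Proof. by apply/eqP; rewrite eq_complex /= oppr0 !eqxx. Qed.

Lemma Re_conj c : complex.Re c^* = complex.Re c.
Proof. by case: c. Qed.

Lemma absc_ge0 c : 0 <= absc c.
Proof. by rewrite -lecC -abscE normr_ge0. Qed.

Lemma absc_eq0 c : absc c = 0 -> c = 0.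
Proof. by move=> c0; apply/eqP; rewrite -normr_eq0 abscE c0. Qed.

Lemma absc_gt0 c : c != 0 -> 0 < absc c.
Proof. by move=> c0; rewrite -ltcC -abscE normr_gt0. Qed.

Lemma abscD c d : absc (c + d) <= absc c + absc d.
Proof. by rewrite -lecC reCD -!abscE ler_normD. Qed.

Lemma abscM c d : absc (c * d) = absc c * absc d.
Proof. by apply: (@complexI R); rewrite reCM -!abscE normrM. Qed.

Lemma abscV c : c != 0 -> absc c^-1 = (absc c)^-1.
Proof.
move=> c0; have a0 := lt0r_neq0 (absc_gt0 c0).
apply: (mulfI a0); rewrite mulfV // -abscM mulfV //.
by rewrite /absc normr1.
Qed.

Lemma absc_conj c : absc c^* = absc c.
Proof. by apply: (@complexI R); rewrite -!abscE norm_conjC. Qed.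

Lemma absc_Re c : `|complex.Re c| <= absc c.
Proof. by have := normc_ge_Re c; rewrite abscE lecR. Qed.

Lemma absc_Im c : `|complex.Im c| <= absc c.
Proof.
case: c => a b; rewrite /absc normc_def /= -sqrtr_sqr ler_sqrt ?addr_ge0 ?sqr_ge0 //.
by rewrite lerDr sqr_ge0.
Qed.

Lemma absc_le c : absc c <= `|complex.Re c| + `|complex.Im c|.
Proof.
case: c => a b; rewrite /absc normc_def /= -[leRHS]ger0_norm ?addr_ge0 //.
rewrite -sqrtr_sqr ler_sqrt ?sqr_ge0 // sqrrD !real_normK ?num_real //.
by rewrite lerD2r lerDl mulrn_wge0 // mulr_ge0.
Qed.

(** Applying the inequality to c^-1 and c x gives the reverse one. *)
Lemma le_homogeneous (V : lmodType R[i]) (P : V -> Prop) (N : V -> R) :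
  (forall c x, P x -> P (c *: x)) -> (forall x, P x -> 0 <= N x) ->
  (forall c x, P x -> N (c *: x) <= absc c * N x) ->
  forall c x, P x -> N (c *: x) = absc c * N x.
Proof.
move=> PZ N0 NZ c x Px; apply/eqP; rewrite eq_le NZ //=.
have [->|c0] := eqVneq c 0.
  by rewrite /absc normr0 mul0r; apply: N0; exact: PZ.
have := NZ c^-1 (c *: x) (PZ c x Px); rewrite scalerA mulVf // scale1r abscV //.
by rewrite ler_pdivlMl // absc_gt0.
Qed.

End RealComplex.

Section RealNorm.
Variables (R : realType) (V : normedModType R[i]).
Implicit Types x y : V.

(** The norm of a module over R[i] takes values in R[i]; its real part carries
    the same information and lives in an ordered field. *)
Definition nrm x : R := complex.Re `|x|.

Lemma nrmE x : `|x| = (nrm x)%:C%C.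
Proof. exact: ger0_reC. Qed.

Lemma nrm_ge0 x : 0 <= nrm x.
Proof. by rewrite -lecC -nrmE normr_ge0. Qed.

Lemma nrm0 : nrm 0 = 0.
Proof. by rewrite /nrm normr0. Qed.

Lemma nrm0_eq0 x : nrm x = 0 -> x = 0.
Proof. by move=> x0; apply/normr0_eq0; rewrite nrmE x0. Qed.

Lemma nrmN x : nrm (- x) = nrm x.
Proof. by rewrite /nrm normrN. Qed.

Lemma nrmBC x y : nrm (x - y) = nrm (y - x).
Proof. by rewrite -nrmN opprB. Qed.

Lemma nrmD x y : nrm (x + y) <= nrm x + nrm y.
Proof. by rewrite -lecC reCD -!nrmE ler_normD. Qed.

Lemma nrmB x y : nrm (x - y) <= nrm x + nrm y.
Proof. by rewrite (le_trans (nrmD _ _)) // nrmN. Qed.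

Lemma nrm_split y x z : nrm (x - z) <= nrm (x - y) + nrm (y - z).
Proof. by rewrite (le_trans _ (nrmD _ _)) // addrA subrK. Qed.

Lemma nrmZ (c : R[i]) x : nrm (c *: x) = absc c * nrm x.
Proof. by apply: (@complexI R); rewrite reCM -!nrmE -abscE normrZ. Qed.

Lemma nrmZr (c : R) x : nrm (c%:C%C *: x) = `|c| * nrm x.
Proof. by rewrite nrmZ absc_real. Qed.

Lemma small_eq0 (r : R) : 0 <= r -> (forall e, 0 < e -> r < e) -> r = 0.
Proof.
move=> r0 re; apply/eqP; rewrite eq_le r0 andbT leNgt; apply/negP => /re.
by rewrite ltxx.
Qed.

Lemma ballE x (e : R) : ball x e%:C%C = [set y | nrm (x - y) < e].
Proof.
rewrite -ball_normE; apply/seteqP; split=> y /=; by rewrite nrmE ltcC.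
Qed.

Lemma closed_approx (S : set V) :
  closed S <->
  forall x, (forall e : R, 0 < e -> exists2 y, S y & nrm (x - y) < e) -> S x.
Proof.
split=> [cS x Sx|SP x clx].
  apply: cS => B /nbhs_ballP[e /= e0 eB]; have [r r0 er] := posC e0.
  have [y Sy xy] := Sx r r0; exists y; split=> //.
  by apply: eB; rewrite er ballE.
apply: SP => e e0.
have /clx [y [Sy]] : nbhs x (ball x e%:C%C) by apply: nbhsx_ballx; rewrite ltcC.
by rewrite ballE => xy; exists y.
Qed.

Definition cauchy_seq (u : nat -> V) : Prop := forall e : R, 0 < e ->
  exists N, forall m n, (N <= m)%N -> (N <= n)%N -> nrm (u m - u n) < e.

Definition seq_lim (u : nat -> V) (l : V) : Prop := forall e : R, 0 < e ->
  exists N, forall n, (N <= n)%N -> nrm (u n - l) < e.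

Lemma seq_lim_unique u l l' : seq_lim u l -> seq_lim u l' -> l = l'.
Proof.
move=> ul ul'; apply/eqP; rewrite -subr_eq0; apply/eqP/nrm0_eq0.
apply: small_eq0 => [|e e0]; first exact: nrm_ge0.
have e2 : 0 < e / 2 by rewrite divr_gt0.
have [N HN] := ul _ e2; have [M HM] := ul' _ e2.
have := HN _ (leq_maxl N M); have := HM _ (leq_maxr N M).
move: (maxn N M) => n ? ?; have := nrm_split (u n) l l'; rewrite (nrmBC l (u n)).
lra.
Qed.

Lemma seq_lim_closed (S : set V) u l :
  closed S -> (forall n, S (u n)) -> seq_lim u l -> S l.
Proof.
move=> /closed_approx cS Su ul; apply: cS => e /ul[N uN].
by exists (u N) => //; rewrite nrmBC uN.
Qed.

End RealNorm.

Lemma cauchy_seq_lim (R : realType) (V : completeNormedModType R[i])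
  (u : nat -> V) : cauchy_seq u -> exists l, seq_lim u l.
Proof.
move=> uC; have : cvg (u @ \oo).
  apply/cauchy_cvgP/cauchy_exP => e /posC[r r0 ->].
  have [N uN] := uC r r0; exists (u N); exists N => // n /= Nn.
  by rewrite ballE /= uN.
move=> /cvg_ex[l ul]; exists l => e e0.
have : \forall n \near \oo, ball l e%:C%C (u n).
  by apply: ul; apply: nbhsx_ballx; rewrite ltcC.
case=> N _ uN; exists N => n Nn; have := uN n Nn.
by rewrite ballE /= nrmBC.
Qed.

Lemma geometric_small (R : realType) (q C : R) : 0 <= q -> q < 1 ->
  forall e, 0 < e -> exists n, q ^+ n * C < e.
Proof.
move=> q0 q1 e e0; have q1' : `|q| < 1 by rewrite ger0_norm.
have /cvgrPdist_lt /(_ (e / (`|C| + 1))) := cvg_expr q1'.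
have C1 : 0 < `|C| + 1 by rewrite ltr_pwDr.
case=> [|N _ /(_ N (leqnn _))]; first by rewrite divr_gt0.
rewrite /= sub0r normrN ger0_norm ?exprn_ge0 // ltr_pdivlMr // => qC.
exists N; apply: le_lt_trans qC; apply: ler_wpM2l; first exact: exprn_ge0.
by rewrite (le_trans (ler_norm C)) // lerDl.
Qed.

Lemma geometric_cauchy (R : realType) (V : normedModType R[i]) (u : nat -> V)
    (q D : R) : 0 <= q -> q < 1 -> 0 <= D ->
  (forall n, nrm (u n.+1 - u n) <= q ^+ n * D) -> cauchy_seq u.
Proof.
move=> q0 q1 D0 step; have q1' : 0 < 1 - q by rewrite subr_gt0.
pose C := D / (1 - q).
have C0 : 0 <= C by rewrite divr_ge0 // ltW.
have DE : D = (1 - q) * C by rewrite /C mulrC divfK // gt_eqF.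
have tail n m : nrm (u (n + m)%N - u n) <= q ^+ n * C.
  (* The telescoped bound is what the induction on m can carry. *)
  suff: nrm (u (n + m)%N - u n) <= (q ^+ n - q ^+ (n + m)) * C.
    move=> /le_trans-> //; rewrite ler_wpM2r // gerBl exprn_ge0 //.
  elim: m => [|m IH]; first by rewrite addn0 !subrr nrm0 mul0r.
  rewrite addnS (le_trans (nrm_split (u (n + m)%N) _ _)) //.
  apply: le_trans (lerD (step _) IH) _.
  by rewrite exprS DE le_eqVlt; apply/orP; left; apply/eqP; ring.
move=> e e0; have [N HN] := geometric_small (2 * C) q0 q1 e0.
exists N => m n Nm Nn.
have := tail N (m - N)%N; have := tail N (n - N)%N; rewrite !subnKC //.
by have := nrm_split (u N) (u m) (u n); rewrite (nrmBC (u N) (u n)); lra.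
Qed.

Lemma contraction_fixpoint (R : realType) (V : completeNormedModType R[i])
    (S : set V) (phi : V -> V) (q : R) (x0 : V) :
  closed S -> S x0 -> 0 <= q -> q < 1 -> (forall x, S x -> S (phi x)) ->
  (forall x y, S x -> S y -> nrm (phi x - phi y) <= q * nrm (x - y)) ->
  exists2 x, S x & phi x = x.
Proof.
move=> cS S0 q0 q1 phiS phiq; pose u n := iter n phi x0.
have uS n : S (u n) by elim: n => //= n IH; apply: phiS.
have step n : nrm (u n.+1 - u n) <= q ^+ n * nrm (phi x0 - x0).
  elim: n => [|n IH]; first by rewrite expr0 mul1r.
  apply: le_trans (phiq _ _ (uS n.+1) (uS n)) _.
  by rewrite exprS -mulrA ler_wpM2l.
have [l ul] := cauchy_seq_lim (geometric_cauchy q0 q1 (nrm_ge0 _) step).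
have lS : S l by apply: seq_lim_closed uS ul.
exists l => //.
have ul' : seq_lim (fun n => u n.+1) l.
  move=> e /ul[N HN]; exists N => n Nn; apply: HN; exact: leqW.
suff phil : seq_lim (fun n => u n.+1) (phi l) by exact: seq_lim_unique phil ul'.
move=> e /ul[N HN]; exists N => n Nn.
apply: le_lt_trans (phiq _ _ (uS n) lS) _.
apply: le_lt_trans (HN n Nn); apply: ler_piMl; [exact: nrm_ge0|exact: ltW].
Qed.

(** * The unitization of a C*-algebra *)

Section CStarBasics.
Variables (R : realType) (A : cstarAlgType R).
Implicit Types x y z : A.

Lemma cmul0l x : 0 ** x = 0.
Proof. by apply: (addrI (0 ** x)); rewrite -cmulDl !addr0. Qed.

Lemma cmul0r x : x ** 0 = 0.
Proof. by apply: (addrI (x ** 0)); rewrite -cmulDr !addr0. Qed.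

Lemma cmulNl x y : - x ** y = - (x ** y).
Proof. by rewrite -scaleN1r cmulZl scaleN1r. Qed.

Lemma cmulNr x y : x ** - y = - (x ** y).
Proof. by rewrite -scaleN1r cmulZr scaleN1r. Qed.

Lemma cmulBl x y z : (x - y) ** z = x ** z - y ** z.
Proof. by rewrite cmulDl cmulNl. Qed.

Lemma cmulBr x y z : z ** (x - y) = z ** x - z ** y.
Proof. by rewrite cmulDr cmulNr. Qed.

Lemma star0 : star (0 : A) = 0.
Proof. by apply: (addrI (star 0)); rewrite -starD !addr0. Qed.

Lemma starN x : star (- x) = - star x.
Proof. by apply: (addrI (star x)); rewrite -starD !subrr star0. Qed.

Lemma starB x y : star (x - y) = star x - star y.
Proof. by rewrite starD starN. Qed.

Lemma nrmM x y : nrm (x ** y) <= nrm x * nrm y.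
Proof. by rewrite -lecC reCM -!nrmE cnormM. Qed.

Lemma nrm_cstar x : nrm (star x ** x) = nrm x ^+ 2.
Proof.
by apply: (@complexI R); rewrite -nrmE cnorm_star nrmE !expr2 reCM.
Qed.

Lemma nrm_star x : nrm (star x) = nrm x.
Proof.
suff le y : nrm y <= nrm (star y).
  by apply/eqP; rewrite eq_le le -{2}[x]starK le.
have [->|y0] := eqVneq (nrm y) 0; first exact: nrm_ge0.
have {}y0 : 0 < nrm y by rewrite lt_neqAle eq_sym y0 nrm_ge0.
by rewrite -(ler_pM2r y0) -expr2 -nrm_cstar nrmM.
Qed.

Lemma star_conjM x : star x ** x = 0 -> x = 0.
Proof.
move=> xx; apply/nrm0_eq0/eqP.
by rewrite -sqrf_eq0 -nrm_cstar xx nrm0.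
Qed.

End CStarBasics.

Section Unitization.
Variables (R : realType) (A : cstarAlgType R).

(** A pair (c, a) stands for the formal sum c + a; this ring acts on A, and
    it is used for algebraic identities only, so it is given no norm. *)
Definition unitization : Type := (R[i] * A)%type.

HB.instance Definition _ := GRing.Lmodule.copy unitization (R[i]^o * A)%type.

Implicit Types u v w : unitization.

Definition umul u v : unitization :=
  (u.1 * v.1, u.1 *: v.2 + v.1 *: u.2 + u.2 ** v.2).

Lemma umulA : associative umul.
Proof.
move=> [a x] [b y] [c z]; rewrite /umul /=; congr pair; first by rewrite mulrA.
rewrite !cmulDl !cmulDr !cmulZl !cmulZr !scalerDr !scalerA cmulA !addrA.
rewrite [c * a]mulrC [c * b]mulrC.
congr (_ + _); rewrite -!addrA; do 2 congr (_ + _).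
by rewrite addrCA; congr (_ + _); rewrite addrA addrC.
Qed.

Lemma umul1l : left_id ((1, 0) : unitization) umul.
Proof. by move=> [a x]; rewrite /umul /= mul1r scale1r scaler0 cmul0l !addr0. Qed.

Lemma umul1r : right_id ((1, 0) : unitization) umul.
Proof.
by move=> [a x]; rewrite /umul /= mulr1 scale1r scaler0 cmul0r addr0 add0r.
Qed.

Lemma umulDl : left_distributive umul +%R.
Proof.
move=> [a x] [b y] [c z]; rewrite /umul /=; congr pair; first by rewrite mulrDl.
rewrite /= scalerDl scalerDr cmulDl.
by rewrite [in RHS]addrACA [a *: z + _ + _]addrACA.
Qed.

Lemma umulDr : right_distributive umul +%R.
Proof.
move=> [a x] [b y] [c z]; rewrite /umul /=; congr pair; first by rewrite mulrDr.
rewrite /= scalerDl scalerDr cmulDr.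
by rewrite [in RHS]addrACA [a *: y + _ + _]addrACA.
Qed.

Lemma uone_neq0 : ((1, 0) : unitization) != 0.
Proof. by apply/eqP => -[/eqP]; rewrite oner_eq0. Qed.

HB.instance Definition _ := GRing.Zmodule_isNzRing.Build unitization
  umulA umul1l umul1r umulDl umulDr uone_neq0.

Definition ustar u : unitization := (u.1^*, star u.2).

Definition uact u (y : A) : A := u.1 *: y + u.2 ** y.

Definition inU (x : A) : unitization := (0, x).


Lemma uscaleAl (c : R[i]) u v : c *: (u * v) = (c *: u) * v.
Proof.
case: u v => [a x] [b y]; congr pair; first exact: mulrA.
by rewrite /= !scalerDr !scalerA cmulZl [b * c]mulrC.
Qed.

Lemma uscaleAr (c : R[i]) u v : c *: (u * v) = u * (c *: v).
Proof.
case: u v => [a x] [b y]; congr pair; first exact: mulrCA.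
by rewrite /= !scalerDr !scalerA cmulZr [a * c]mulrC.
Qed.

Lemma ustarD u v : ustar (u + v) = ustar u + ustar v.
Proof. by rewrite /ustar /= rmorphD starD. Qed.

Lemma ustarM u v : ustar (u * v) = ustar v * ustar u.
Proof.
case: u v => [a x] [b y]; congr pair; first by rewrite /= rmorphM mulrC.
by rewrite /= !starD !starZ starM; congr (_ + _); rewrite addrC.
Qed.

Lemma ustar1 : ustar 1 = 1.
Proof. by congr pair; rewrite /= ?rmorph1 ?star0. Qed.

Lemma ustarN u : ustar (- u) = - ustar u.
Proof. by rewrite /ustar /= rmorphN starN. Qed.

Lemma ustarZ (c : R[i]) u : ustar (c *: u) = c^* *: ustar u.
Proof. by rewrite /ustar /= rmorphM starZ. Qed.

Lemma uactMl u v y : uact (u * v) y = uact u (uact v y).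
Proof.
case: u v => [a x] [b z]; rewrite /uact /= !cmulDl !scalerDr !cmulDr.
rewrite !cmulZl !cmulZr !scalerA cmulA -!addrA; congr (_ + _).
Qed.

Lemma uact1 y : uact 1 y = y.
Proof. by rewrite /uact /= scale1r cmul0l addr0. Qed.

Lemma uactDl u v y : uact (u + v) y = uact u y + uact v y.
Proof. by rewrite /uact /= scalerDl cmulDl addrACA. Qed.

Lemma uactNl u y : uact (- u) y = - uact u y.
Proof. by rewrite /uact /= scaleNr cmulNl opprD. Qed.

Lemma inUD x y : inU (x + y) = inU x + inU y.
Proof. by congr pair; rewrite /= addr0. Qed.

Lemma inUN x : inU (- x) = - inU x.
Proof. by congr pair; rewrite /= oppr0. Qed.

Lemma inUM x y : inU (x ** y) = inU x * inU y.
Proof. by congr pair; rewrite /= ?mulr0 // !scale0r !add0r. Qed.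

Lemma uact_inU x y : uact (inU x) y = x ** y.
Proof. by rewrite /uact /= scale0r add0r. Qed.

Lemma ustar_inU x : ustar (inU x) = inU (star x).
Proof. by congr pair; rewrite /= rmorph0. Qed.

Lemma umul_inUr u y : u * inU y = inU (uact u y).
Proof. by congr pair; rewrite /= ?mulr0 // scale0r addr0. Qed.

Lemma star_uact u v y z :
  star (uact u y) ** uact v z = star y ** uact (ustar u * v) z.
Proof.
rewrite uactMl {1}/uact starD starZ starM cmulDl cmulZl -cmulA.
by rewrite -cmulZr -cmulDr.
Qed.

(** The C*-identity turns u^* u = 1 into |u y|^2 = |y^* y|, without any norm on
    the unitization. *)
Lemma unitary_isometry u y : ustar u * u = 1 -> nrm (uact u y) = nrm y.
Proof.
move=> uu; apply/eqP; rewrite -(eqrXn2 (n := 2)) ?nrm_ge0 // -!nrm_cstar.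
by rewrite star_uact uu uact1.
Qed.

End Unitization.

(** * Star homomorphisms are contractive *)

Section Contractive.
Variables (R : realType) (A B : cstarAlgType R).

Lemma nrm_half (V : normedModType R[i]) (x y z : V) (r : R) :
  x + x = y + z -> nrm y <= r -> nrm z <= r -> nrm x <= r.
Proof.
move=> xyz yr zr; have /(congr1 (@nrm R V)) := xyz.
rewrite -mulr2n -scaler_nat (_ : 2%:R = 2%:R%:C%C) ?nrmZr; last first.
  by rewrite -[2%:R]/(1 + 1) reCD.
by rewrite ger0_norm // => xyz'; have := nrmD y z; lra.
Qed.

(** The Pythagorean identity makes k + i (1 - z) unitary, and k is the mean of
    this unitary and its adjoint. *)
Lemma pythagorean_contraction (k z b : B) : star k = k -> star z = z ->
  k ** z = z ** k -> z + z = k ** k + z ** z -> nrm (k ** b) <= nrm b.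
Proof.
move=> ks zs kz zz.
pose w : unitization B := 1 - inU z; pose i : R[i] := 'i%C.
have ii : i * i = - 1 by rewrite -expr2 sqr_i.
have iconj : i^* = - i := conj_i R.
have ws : ustar w = w by rewrite ustarD ustarN ustar1 ustar_inU zs.
have wk : w * inU k = inU k * w.
  by rewrite mulrBl mulrBr mul1r mulr1 -!inUM kz.
have ww : inU k * inU k + w * w = 1.
  have {}zz : inU (k ** k) + inU (z ** z) = inU z + inU z by rewrite -!inUD zz.
  rewrite mulrBl mul1r mulrBr mulr1 -!inUM.
  have -> : inU (k ** k) = inU z + (inU z - inU (z ** z)).
    by rewrite addrA -zz addrK.
  rewrite /w -[1 - inU z - _]addrA -opprD; exact: subrKC.
pose u := inU k + i *: w; pose u' := inU k - i *: w.
have us : ustar u = u' by rewrite ustarD ustarZ ustar_inU ks ws iconj scaleNr.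
have us' : ustar u' = u.
  by rewrite ustarD ustarN ustarZ ustar_inU ks ws iconj scaleNr opprK.
have uu' : u' * u = 1 /\ u * u' = 1.
  rewrite /u /u' !mulrDl !mulrDr !mulrN !mulNr -!uscaleAl -!uscaleAr wk.
  rewrite !scalerA ii !scaleN1r opprK.
  split; first by rewrite addrA addrK.
  by rewrite addrA subrK.
apply: (@nrm_half B _ (uact u b) (uact u' b)).
- by rewrite -uactDl /u /u' addrACA subrr addr0 uactDl uact_inU.
- by rewrite unitary_isometry // us; case: uu'.
- by rewrite unitary_isometry // us'; case: uu'.
Qed.


(** The element 1 - sqrt(1 - h^2) is a fixed point of y |-> (h^2 + y^2) / 2, which
    contracts the ball of radius |h|^2; self-adjointness and commutation with h
    are closed conditions preserved by the iteration. *)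
Lemma selfadjoint_sqrt (h : A) : star h = h -> nrm h < 1 ->
  exists y, [/\ star y = y, h ** y = y ** h & y + y = h ** h + y ** y].
Proof.
move=> hs h1; pose c := nrm h ^+ 2.
have h0 := nrm_ge0 h.
have c0 : 0 <= c by rewrite exprn_ge0.
have c1 : c < 1 by rewrite expr_lt1.
pose S : set A := [set y | [/\ nrm y <= c, star y = y & h ** y = y ** h]].
pose phi (y : A) := (1 / 2%:R : R)%:C%C *: (h ** h + y ** y).
have half0 : 0 <= (1 / 2%:R : R) by rewrite divr_ge0.
have nphi y : nrm (phi y) <= (c + nrm y ^+ 2) / 2.
  rewrite nrmZr ger0_norm // mul1r mulrC ler_pM2r ?invr_gt0 //.
  apply: le_trans (nrmD _ _) (lerD _ _); first by rewrite -{1}hs nrm_cstar.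
  by rewrite expr2 nrmM.
have cS : closed S.
  apply/closed_approx => x Sx; split.
  - rewrite leNgt; apply/negP => cx.
    have [|y [yc _ _]] := Sx (nrm x - c); first by rewrite subr_gt0.
    have := nrmD (x - y) y; rewrite subrK; lra.
  - apply/eqP; rewrite -subr_eq0; apply/eqP/nrm0_eq0/small_eq0 => [|e e0].
      exact: nrm_ge0.
    have [|y [_ ys _]] := Sx (e / 2); first by rewrite divr_gt0.
    have := nrm_split y (star x) x; rewrite -{1}ys -starB nrm_star (nrmBC y x).
    lra.
  - apply/eqP; rewrite -subr_eq0; apply/eqP/nrm0_eq0/small_eq0 => [|e e0].
      exact: nrm_ge0.
    have [|y [_ _ hy]] := Sx (e / 2); first by rewrite divr_gt0.
    have -> : h ** x - x ** h = h ** (x - y) - (x - y) ** h.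
      by rewrite cmulBr cmulBl hy opprB addrA subrK.
    have := nrmB (h ** (x - y)) ((x - y) ** h).
    have := nrmM h (x - y); have := nrmM (x - y) h.
    move: (nrm_ge0 (x - y)) => ? *; nra.
have [|||||y [_ ys hy] phiy] := @contraction_fixpoint R A S phi c 0 cS.
- by split; rewrite ?nrm0 ?star0 ?cmul0l ?cmul0r.
- by [].
- by [].
- move=> x [xc xs hx]; split.
  + apply: le_trans (nphi x) _; have := nrm_ge0 x; nra.
  + by rewrite starZ starD !starM hs xs conj_reC.
  + rewrite cmulZr cmulZl cmulDr cmulDl cmulA; congr (_ *: (_ + _)).
    by rewrite cmulA hx -cmulA hx cmulA.
- move=> x z [xc _ _] [zc _ _].
  rewrite /phi -scalerBr nrmZr ger0_norm // [h ** h + _]addrC addrKA.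
  have -> : x ** x - z ** z = x ** (x - z) + (x - z) ** z.
    by rewrite cmulBr cmulBl addrA subrK.
  have := nrmD (x ** (x - z)) ((x - z) ** z).
  have := nrmM x (x - z); have := nrmM (x - z) z.
  move: (nrm_ge0 (x - z)) => ? *; nra.
exists y; split=> //; rewrite -[in LHS]phiy -scalerDl -reCD.
by rewrite (_ : 1 / 2%:R + 1 / 2%:R = 1) ?scale1r //; lra.
Qed.

Lemma star_hom0 (f : A -> B) : star_hom f -> f 0 = 0.
Proof. by move=> fh; rewrite -(scale0r 0) (star_homZ fh) scale0r. Qed.

Lemma star_homN (f : A -> B) x : star_hom f -> f (- x) = - f x.
Proof. by move=> fh; rewrite -scaleN1r (star_homZ fh) scaleN1r. Qed.

Lemma star_homB (f : A -> B) x y : star_hom f -> f (x - y) = f x - f y.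
Proof. by move=> fh; rewrite (star_homD fh) star_homN. Qed.

(** The solution y of y + y = h h + y y is carried along by f, although f is not
    known to be continuous, so that the image of h is the real part of a
    unitary as well. The C*-identity extends the bound from self-adjoint
    elements to all. *)
Lemma star_hom_contractive (f : A -> B) x : star_hom f -> nrm (f x) <= nrm x.
Proof.
move=> fh.
have unit_ball h : star h = h -> nrm h < 1 -> nrm (f h) <= 1.
  move=> hs h1; have [y [ys hy yy]] := selfadjoint_sqrt hs h1.
  have : nrm (f h ** f h) <= nrm (f h).
    apply: (@pythagorean_contraction (f h) (f y)).
    - by rewrite -(star_hom_star fh) hs.
    - by rewrite -(star_hom_star fh) ys.
    - by rewrite -!(star_homM fh) hy.
    - by rewrite -!(star_homM fh) -!(star_homD fh) yy.
  rewrite -{1}hs (star_hom_star fh) nrm_cstar => ff.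
  have := nrm_ge0 (f h); nra.
have selfadj h : star h = h -> nrm (f h) <= nrm h.
  move=> hs; rewrite leNgt; apply/negP => fhh.
  (* Scaling by any t strictly between the two norms violates the bound on the unit ball. *)
  pose t := (nrm h + nrm (f h)) / 2.
  have h0 := nrm_ge0 h.
  have t0 : 0 < t by rewrite /t; lra.
  have ts : star (t^-1%:C%C *: h) = t^-1%:C%C *: h.
    by rewrite starZ hs conj_reC.
  have := unit_ball _ ts; rewrite (star_homZ fh) !nrmZr gtr0_norm ?invr_gt0 //.
  rewrite ltr_pdivrMl // ler_pdivrMl // !mulr1 => H.
  have : nrm (f h) <= t by apply: H; rewrite /t; lra.
  by rewrite /t; lra.
have := selfadj (star x ** x); rewrite starM starK (star_homM fh).
rewrite (star_hom_star fh) !nrm_cstar => /(_ erefl).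
by rewrite ler_sqr ?nnegrE ?nrm_ge0.
Qed.

Lemma closed_ker (f : A -> B) : star_hom f -> closed [set x | f x = 0].
Proof.
move=> fh; apply/closed_approx => x xP; apply: nrm0_eq0.
apply: small_eq0 => [|e /xP[y /= fy xy]]; first exact: nrm_ge0.
apply: le_lt_trans xy; apply: le_trans (star_hom_contractive _ fh).
by rewrite (star_homB _ _ fh) fy subr0.
Qed.

Lemma eq_on_generators (f g : A -> B) (X : set A) : star_hom f -> star_hom g ->
  generates X -> (forall x, X x -> f x = g x) -> forall x, f x = g x.
Proof.
move=> fh gh genX fg x.
suff /(_ (fun x => fg x)) E : X `<=` [set x | f x = g x] ->
    [set x | f x = g x] = setT.
  by have : [set: A] x by []; rewrite -E.
apply: genX; split.
- by rewrite /= !star_hom0.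
- by move=> y z /= yE zE; rewrite (star_homD fh) (star_homD gh) yE zE.
- by move=> c y /= yE; rewrite (star_homZ fh) (star_homZ gh) yE.
- by move=> y z /= yE zE; rewrite (star_homM fh) (star_homM gh) yE zE.
- by move=> y /= yE; rewrite (star_hom_star fh) (star_hom_star gh) yE.
apply/closed_approx => y yP /=; apply/eqP; rewrite -subr_eq0.
apply/eqP/nrm0_eq0/small_eq0 => [|e e0]; first exact: nrm_ge0.
have [|z /= fgz yz] := yP (e / 2); first by rewrite divr_gt0.
have := nrm_split (f z) (f y) (g y); rewrite {2}fgz -!star_homB //.
have := star_hom_contractive (y - z) fh.
have := star_hom_contractive (z - y) gh.
rewrite (nrmBC z y); lra.
Qed.

End Contractive.

(** * Resolvents of skew-adjoint elements *)

Section Resolvent.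
Variables (R : realType) (A : cstarAlgType R).
Implicit Types x y : A.

Definition uinverse (x : A) (c : unitization A) : Prop :=
  c * (1 + inU x) = 1 /\ (1 + inU x) * c = 1.

(** The right and the left inverse 1 + d are found as fixed points of
    d |-> - x - x d and d |-> - x - d x. *)
Lemma neumann x : nrm x < 1 -> exists c, uinverse x c.
Proof.
move=> x1; have x0 := nrm_ge0 x.
have [|||||d _ dE] :=
  @contraction_fixpoint R A setT (fun d => - x - x ** d) (nrm x) 0 (@closedT A) => //.
  move=> y z _ _; rewrite opprD addrACA subrr add0r opprK addrC -cmulBr (nrmBC y z).
  exact: nrmM.
have [|||||d' _ dE'] :=
  @contraction_fixpoint R A setT (fun d => - x - d ** x) (nrm x) 0 (@closedT A) => //.
  move=> y z _ _; rewrite opprD addrACA subrr add0r opprK addrC -cmulBl (nrmBC y z).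
  by rewrite mulrC nrmM.
have R1 : (1 + inU x) * (1 + inU d) = 1.
  rewrite mulrDl mul1r mulrDr mulr1 -inUM -addrA -!inUD -{1}dE.
  by rewrite -opprD addNr; exact: addr0.
have L1 : (1 + inU d') * (1 + inU x) = 1.
  rewrite mulrDr mulr1 mulrDl mul1r -inUM -addrA -!inUD -{1}dE'.
  by rewrite -opprD addNr; exact: addr0.
exists (1 + inU d); split=> //.
have -> : 1 + inU d = 1 + inU d'.
  by rewrite -[LHS]mul1r -[X in X * _]L1 -mulrA R1 mulr1.
by [].
Qed.


(** For skew-adjoint x the Cayley transform 2 (1 + x)^-1 - 1 is unitary, and
    (1 + x)^-1 is the mean of it and the identity. *)
Lemma skew_inverse_contraction x c y :
  star x = - x -> uinverse x c -> nrm (uact c y) <= nrm y.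
Proof.
move=> xs [cx xc]; pose c' := ustar c.
have cx' : c' * (1 - inU x) = 1.
  by rewrite -inUN -xs -ustar_inU -[X in X + _]ustar1 -ustarD -ustarM xc ustar1.
(* This is c^* ((1 - x) + (1 + x)) c. *)
have cc : c' * c + c' * c = c + c'.
  have -> : c + c' = c' * ((1 - inU x) + (1 + inU x)) * c.
    by rewrite mulrDr mulrDl cx' mul1r -mulrA xc mulr1.
  by rewrite addrACA addNr addr0 mulrDr mulr1 mulrDl.
have cay : ustar (c + c - 1) * (c + c - 1) = 1.
  rewrite ustarD ustarN ustar1 ustarD -/c' mulrBr mulr1 mulrBl mul1r.
  rewrite mulrDl mulrDr cc addrACA [_ - (c + c)]addrAC subrr add0r.
  by rewrite opprB subrKC.
apply: (@nrm_half R A _ y (uact (c + c - 1) y)).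
- by rewrite !uactDl uactNl uact1 subrKC.
- by [].
- by rewrite (unitary_isometry _ cay).
Qed.

(** Since 1 + x + y = (1 + x) (1 + c y) and c is a contraction, the perturbation
    allowed for y does not depend on x; this is what lets the inverse be
    continued along a whole ray. *)
Lemma uinverse_step x y c : uinverse x c -> star x = - x -> nrm y < 1 ->
  exists c, uinverse (x + y) c.
Proof.
move=> cx xs y1.
have [|e [el er]] := @neumann (uact c y).
  exact: le_lt_trans (skew_inverse_contraction y xs cx) y1.
have xyE : 1 + inU (x + y) = (1 + inU x) * (1 + inU (uact c y)).
  by rewrite mulrDr mulr1 -umul_inUr mulrA cx.2 mul1r inUD addrA.
exists (e * c); split; rewrite xyE.
  by rewrite -mulrA (mulrA c) cx.1 mul1r.
by rewrite -mulrA (mulrA _ e) er mul1r cx.2.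
Qed.

(** Invertibility of 1 + x is reached from that of 1 in finitely many steps of
    length |x| / (N + 1) < 1. *)
Lemma skew_invertible x : star x = - x -> exists c, uinverse x c.
Proof.
move=> xs; have [N Nx] : exists N, nrm x < N.+1%:R.
  exists (Num.truncn (nrm x)); exact: truncnS_gt.
pose y := (N.+1%:R^-1 : R)%:C%C *: x.
have ys : star y = - y by rewrite starZ xs conj_reC scalerN.
have y1 : nrm y < 1.
  by rewrite nrmZr ger0_norm ?invr_ge0 // ltr_pdivrMl // mulr1.
have yn n : star (y *+ n) = - (y *+ n).
  by elim: n => [|n IH]; rewrite ?mulr0n ?star0 ?oppr0 // !mulrS starD ys IH opprD.
suff /(_ N.+1) : forall n, exists c, uinverse (y *+ n) c.
  suff -> : y *+ N.+1 = x by [].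
  have NE : N.+1%:R = (N.+1%:R : R)%:C%C by rewrite (rmorph_nat (real_complex R)).
  by rewrite -scaler_nat NE scalerA -reCM mulfV // scale1r.
elim=> [|n [c cn]].
  have E : 1 + inU (y *+ 0) = 1 by rewrite mulr0n; exact: addr0.
  by exists 1; split; rewrite E mulr1.
by rewrite mulrSr; exact: uinverse_step cn (yn n) y1.
Qed.

(** The inverse of 1 + x is 1 + d with d in the algebra itself. *)
Lemma skew_resolvent x : star x = - x -> exists d,
  [/\ d = - x - x ** d, d = - x - d ** x & forall y, nrm (y + d ** y) <= nrm y].
Proof.
move=> xs; have [c cx] := skew_invertible xs.
have c1 : c.1 = 1.
  by have /(congr1 fst) := cx.1; rewrite /= addr0 mulr1.
have cE y : uact c y = y + c.2 ** y by rewrite /uact c1 scale1r.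
exists c.2; split.
- have /(congr1 snd) := cx.2.
  rewrite /= c1 !add0r addr0 !scale1r => cE'.
  by apply/eqP; rewrite -subr_eq0 opprB opprK [_ + x]addrC addrA cE'.
- have /(congr1 snd) := cx.1.
  rewrite /= c1 !add0r addr0 !scale1r => cE'.
  by apply/eqP; rewrite -subr_eq0 opprB opprK addrA addrC addrA cE'.
by move=> y; rewrite -cE; exact: skew_inverse_contraction cx.
Qed.

End Resolvent.
(** * C*-algebras from complete C*-seminorms *)

Section SequentialCompleteness.
Variables (R : realType) (V : normedModType R[i]).

Lemma harmonic_small (e : R) : 0 < e ->
  exists N, forall n, (N <= n)%N -> n.+1%:R^-1 < e.
Proof.
move=> e0; exists (Num.truncn e^-1) => n Nn.
rewrite invf_plt ?posrE //; apply: lt_le_trans (truncnS_gt _) _.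
by rewrite ler_nat ltnS.
Qed.

(** A Cauchy filter contains balls of radius 1/(n+1); their centres form a Cauchy
    sequence, and its limit is the limit of the filter. *)
Lemma seq_complete : (forall u : nat -> V, cauchy_seq u -> exists l, seq_lim u l) ->
  forall F : set_system V, ProperFilter F -> cauchy F -> cvg F.
Proof.
move=> Vc F FF /cauchyP FC.
have r_gt0 n : 0 < (n.+1%:R^-1 : R) by rewrite invr_gt0.
have {FC} FC n : exists x, F (ball x (n.+1%:R^-1 : R)%:C%C).
  by apply: FC; rewrite ltcC.
pose u n := sval (cid (FC n)).
have Fu n : F [set y | nrm (u n - y) < n.+1%:R^-1].
  by rewrite -ballE; exact: (svalP (cid (FC n))).
have uu m n : nrm (u m - u n) < m.+1%:R^-1 + n.+1%:R^-1.
  have [y [/= ym yn]] := filter_ex (filterI (Fu m) (Fu n)).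
  apply: le_lt_trans (nrm_split y _ _) _.
  by rewrite (nrmBC y (u n)) ltrD.
have uC : cauchy_seq u.
  move=> e e0; have [|N HN] := @harmonic_small (e / 2); first by rewrite divr_gt0.
  exists N => m n /HN mN /HN nN; apply: lt_trans (uu m n) _.
  by rewrite [e]splitr ltrD.
have [l ul] := Vc u uC; apply/cvg_ex; exists l.
apply/cvg_ballP => _ /posC[e e0 ->].
have e2 : 0 < e / 2 by rewrite divr_gt0.
have [N HN] := @harmonic_small _ e2; have [M HM] := ul _ e2.
apply: filterS (Fu (maxn N M)) => y /= uy; rewrite ballE /=.
have := lt_trans uy (HN _ (leq_maxl N M)); have := HM _ (leq_maxr N M).
by have := nrm_split (u (maxn N M)) l y; rewrite (nrmBC l (u _)); lra.
Qed.

End SequentialCompleteness.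

(** A *-algebra over R[i] with a C*-seminorm for which all Cauchy sequences
    converge. Quotients by closed ideals and completions are both of this
    form, before null vectors are identified with zero. *)
Record cstar_seminorm (R : realType) (A : lmodType R[i]) := CStarSeminorm {
  smul : A -> A -> A ;
  sstar : A -> A ;
  snorm : A -> R ;
  smulA : forall x y z, smul x (smul y z) = smul (smul x y) z ;
  smulDl : forall x y z, smul (x + y) z = smul x z + smul y z ;
  smulDr : forall x y z, smul x (y + z) = smul x y + smul x z ;
  smulZl : forall (c : R[i]) x y, smul (c *: x) y = c *: smul x y ;
  smulZr : forall (c : R[i]) x y, smul x (c *: y) = c *: smul x y ;
  sstarK : forall x, sstar (sstar x) = x ;
  sstarD : forall x y, sstar (x + y) = sstar x + sstar y ;
  sstarZ : forall (c : R[i]) x, sstar (c *: x) = c^* *: sstar x ;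
  sstarM : forall x y, sstar (smul x y) = smul (sstar y) (sstar x) ;
  snormD : forall x y, snorm (x + y) <= snorm x + snorm y ;
  snormZ : forall (c : R[i]) x, snorm (c *: x) = absc c * snorm x ;
  snormM : forall x y, snorm (smul x y) <= snorm x * snorm y ;
  snorm_star : forall x, snorm (sstar x) <= snorm x ;
  snorm_cstar : forall x, snorm x ^+ 2 <= snorm (smul (sstar x) x) ;
  scomplete : forall u : nat -> A,
    (forall e : R, 0 < e -> exists N, forall m n, (N <= m)%N -> (N <= n)%N ->
      snorm (u m - u n) < e) ->
    exists l, forall e : R, 0 < e -> exists N, forall n, (N <= n)%N ->
      snorm (u n - l) < e
}.

Section SeparatedQuotient.
Variables (R : realType) (A : lmodType R[i]) (S : cstar_seminorm A).
Local Notation N := (snorm S).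
Local Notation "x *' y" := (smul S x y) (at level 40, left associativity).

Lemma snorm0 : N 0 = 0.
Proof. by rewrite -(scale0r 0) snormZ absc_real normr0 mul0r. Qed.

Lemma snormN x : N (- x) = N x.
Proof.
rewrite -scaleN1r snormZ (_ : -1 = (-1 : R)%:C%C) ?absc_real ?normrN1 ?mul1r //.
by rewrite (rmorphN (real_complex R)) (rmorph1 (real_complex R)).
Qed.

Lemma snorm_ge0 x : 0 <= N x.
Proof. by have := snormD S x (- x); rewrite subrr snorm0 snormN; lra. Qed.

Lemma snormBC x y : N (x - y) = N (y - x).
Proof. by rewrite -snormN opprB. Qed.

Lemma snorm_split y x z : N (x - z) <= N (x - y) + N (y - z).
Proof. by have := snormD S (x - y) (y - z); rewrite addrA subrK. Qed.

Lemma snorm_eq x y : N (x - y) = 0 -> N x = N y.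
Proof.
move=> xy; have := snormD S (x - y) y; have := snormD S (y - x) x.
by rewrite !subrK (snormBC y x) xy; lra.
Qed.

Lemma smulNl x y : - x *' y = - (x *' y).
Proof. by rewrite -scaleN1r smulZl scaleN1r. Qed.

Lemma smulNr x y : x *' - y = - (x *' y).
Proof. by rewrite -scaleN1r smulZr scaleN1r. Qed.

Definition snull_rel x y := N (x - y) == 0.

Lemma snull_equiv : equiv_class_of snull_rel.
Proof.
split=> [x|x y|y x z]; rewrite /snull_rel ?subrr ?snorm0 //.
  by rewrite snormBC.
move=> /eqP xy /eqP yz; rewrite eq_le snorm_ge0 andbT.
by have := snorm_split y x z; rewrite xy yz addr0.
Qed.

Canonical snull_equiv_rel := EquivRelPack snull_equiv.

Definition squot := {eq_quot snull_equiv_rel}.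

HB.instance Definition _ := Choice.on squot.

Definition spi (x : A) : squot := \pi x.

Lemma spiP x y : spi x = spi y <-> N (x - y) = 0.
Proof.
split=> [/eqmodP/eqP//|xy]; apply/eqmodP; exact/eqP.
Qed.

Definition srepr (q : squot) : A := repr q.

Lemma sreprK q : spi (srepr q) = q. Proof. exact: reprK. Qed.

(** All identities of the quotient are checked on representatives. *)
Lemma spiW (P : squot -> Prop) : (forall x, P (spi x)) -> forall q, P q.
Proof. by move=> Px q; rewrite -(sreprK q). Qed.

Lemma snorm_srepr x : N (srepr (spi x) - x) = 0.
Proof. by apply/spiP; rewrite sreprK. Qed.

Definition qadd (p q : squot) := spi (srepr p + srepr q).
Definition qopp (p : squot) := spi (- srepr p).
Definition qscale (c : R[i]) (p : squot) := spi (c *: srepr p).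
Definition qmul (p q : squot) := spi (srepr p *' srepr q).
Definition qstar (p : squot) := spi (sstar S (srepr p)).
Definition qnorm (p : squot) : R[i] := (N (srepr p))%:C%C.

Lemma qaddE x y : qadd (spi x) (spi y) = spi (x + y).
Proof.
apply/spiP; rewrite opprD addrACA.
have := snormD S (srepr (spi x) - x) (srepr (spi y) - y).
by rewrite !snorm_srepr; have := snorm_ge0 (srepr (spi x) - x + (srepr (spi y) - y)); lra.
Qed.

Lemma qscaleE c x : qscale c (spi x) = spi (c *: x).
Proof. by apply/spiP; rewrite -scalerBr snormZ snorm_srepr mulr0. Qed.

Lemma qoppE x : qopp (spi x) = spi (- x).
Proof. by apply/spiP; rewrite -opprD snormN snorm_srepr. Qed.

Lemma qmulE x y : qmul (spi x) (spi y) = spi (x *' y).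
Proof.
apply/spiP; set x' := srepr _; set y' := srepr _.
have -> : x' *' y' - x *' y = (x' - x) *' y' + x *' (y' - y).
  by rewrite smulDl smulDr smulNl smulNr addrA subrK.
have := snormD S ((x' - x) *' y') (x *' (y' - y)).
have := snormM S (x' - x) y'; have := snormM S x (y' - y).
rewrite !snorm_srepr mulr0 mul0r.
by have := snorm_ge0 ((x' - x) *' y' + x *' (y' - y)); lra.
Qed.

Lemma qstarE x : qstar (spi x) = spi (sstar S x).
Proof.
apply/spiP; rewrite -scaleN1r.
have -> : -1 *: sstar S x = sstar S (- x).
  by rewrite -[- x]scaleN1r sstarZ rmorphN rmorph1.
rewrite -sstarD; have := snorm_star S (srepr (spi x) - x).
by rewrite snorm_srepr; have := snorm_ge0 (sstar S (srepr (spi x) - x)); lra.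
Qed.

Lemma qnormE x : qnorm (spi x) = (N x)%:C%C.
Proof. by congr (_%:C%C); apply: snorm_eq; exact: snorm_srepr. Qed.

Lemma qaddA : associative qadd.
Proof.
by elim/spiW=> x; elim/spiW=> y; elim/spiW=> z; rewrite !qaddE addrA.
Qed.

Lemma qaddC : commutative qadd.
Proof. by elim/spiW=> x; elim/spiW=> y; rewrite !qaddE addrC. Qed.

Lemma qadd0 : left_id (spi 0) qadd.
Proof. by elim/spiW=> x; rewrite !qaddE add0r. Qed.

Lemma qaddN : left_inverse (spi 0) qopp qadd.
Proof. by elim/spiW=> x; rewrite qoppE qaddE addNr. Qed.

HB.instance Definition _ := GRing.isZmodule.Build squot qaddA qaddC qadd0 qaddN.

Lemma spiD x y : spi (x + y) = spi x + spi y.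
Proof. by rewrite -qaddE. Qed.

Lemma qscaleA c d p : qscale c (qscale d p) = qscale (c * d) p.
Proof. by elim/spiW: p => x; rewrite !qscaleE scalerA. Qed.

Lemma qscale1 : left_id 1 qscale.
Proof. by elim/spiW=> x; rewrite qscaleE scale1r. Qed.

Lemma qscaleDr : right_distributive qscale +%R.
Proof.
move=> c; elim/spiW=> x; elim/spiW=> y.
by rewrite -spiD !qscaleE scalerDr spiD.
Qed.

Lemma qscaleDl p : {morph qscale^~ p : c d / c + d}.
Proof. by move=> c d; elim/spiW: p => x; rewrite !qscaleE scalerDl spiD. Qed.

HB.instance Definition _ := GRing.Zmodule_isLmodule.Build R[i] squot
  qscaleA qscale1 qscaleDr qscaleDl.

Lemma spiZ c x : spi (c *: x) = c *: spi x.
Proof. by rewrite -qscaleE. Qed.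

Lemma spiB x y : spi (x - y) = spi x - spi y.
Proof. by rewrite spiD -scaleN1r spiZ scaleN1r. Qed.

Lemma qnormD p q : qnorm (p + q) <= qnorm p + qnorm q.
Proof.
elim/spiW: p => x; elim/spiW: q => y.
by rewrite -spiD !qnormE -reCD lecC snormD.
Qed.

Lemma qnormZ c p : qnorm (c *: p) = `|c| * qnorm p.
Proof. by elim/spiW: p => x; rewrite -spiZ !qnormE snormZ reCM -abscE. Qed.

Lemma qnorm0_eq0 p : qnorm p = 0 -> p = 0.
Proof.
elim/spiW: p => x; rewrite qnormE => /(@complexI R) x0.
by apply/spiP; rewrite subr0.
Qed.

HB.instance Definition _ := Lmodule_isNormed.Build R[i] squot
  qnormD qnormZ qnorm0_eq0.

Lemma nrm_spi x : nrm (spi x) = N x.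
Proof. by apply: (@complexI R); rewrite -nrmE; exact: qnormE. Qed.

Lemma squot_seq_complete (u : nat -> squot) :
  cauchy_seq u -> exists l, seq_lim u l.
Proof.
move=> uC; pose v n := srepr (u n).
have uE n : u n = spi (v n) by rewrite sreprK.
have [|l vl] := @scomplete _ _ S v.
  move=> e /uC[M HM]; exists M => m n Mm Mn; have := HM m n Mm Mn.
  by rewrite !uE -spiB nrm_spi.
exists (spi l) => e /vl[M HM]; exists M => n /HM.
by rewrite uE -spiB nrm_spi.
Qed.

HB.instance Definition _ := Uniform_isComplete.Build squot
  (seq_complete squot_seq_complete).

Lemma qmulA p q r : qmul p (qmul q r) = qmul (qmul p q) r.
Proof.
by elim/spiW: p => x; elim/spiW: q => y; elim/spiW: r => z; rewrite !qmulE smulA.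
Qed.

Lemma qmulDl p q r : qmul (p + q) r = qmul p r + qmul q r.
Proof.
elim/spiW: p => x; elim/spiW: q => y; elim/spiW: r => z.
by rewrite -spiD !qmulE -spiD smulDl.
Qed.

Lemma qmulDr p q r : qmul p (q + r) = qmul p q + qmul p r.
Proof.
elim/spiW: p => x; elim/spiW: q => y; elim/spiW: r => z.
by rewrite -spiD !qmulE -spiD smulDr.
Qed.

Lemma qmulZl c p q : qmul (c *: p) q = c *: qmul p q.
Proof.
by elim/spiW: p => x; elim/spiW: q => y; rewrite -spiZ !qmulE -spiZ smulZl.
Qed.

Lemma qmulZr c p q : qmul p (c *: q) = c *: qmul p q.
Proof.
by elim/spiW: p => x; elim/spiW: q => y; rewrite -spiZ !qmulE -spiZ smulZr.
Qed.

Lemma qstarK p : qstar (qstar p) = p.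
Proof. by elim/spiW: p => x; rewrite !qstarE sstarK. Qed.

Lemma qstarD p q : qstar (p + q) = qstar p + qstar q.
Proof.
by elim/spiW: p => x; elim/spiW: q => y; rewrite -spiD !qstarE -spiD sstarD.
Qed.

Lemma qstarZ c p : qstar (c *: p) = c^* *: qstar p.
Proof. by elim/spiW: p => x; rewrite -spiZ !qstarE -spiZ sstarZ. Qed.

Lemma qstarM p q : qstar (qmul p q) = qmul (qstar q) (qstar p).
Proof.
by elim/spiW: p => x; elim/spiW: q => y; rewrite qmulE !qstarE qmulE sstarM.
Qed.

Lemma qnormM p q : `|qmul p q| <= `|p| * `|q|.
Proof.
elim/spiW: p => x; elim/spiW: q => y; rewrite qmulE !nrmE !nrm_spi -reCM lecC.
exact: snormM.
Qed.

Lemma qnorm_cstar p : `|qmul (qstar p) p| = `|p| ^+ 2.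
Proof.
elim/spiW: p => x; rewrite qstarE qmulE !nrmE !nrm_spi expr2 -reCM.
congr (_%:C%C); apply/eqP; rewrite eq_le -expr2 snorm_cstar andbT expr2.
apply: le_trans (snormM _ _ _) _; apply: ler_wpM2r (snorm_star _ _).
exact: snorm_ge0.
Qed.

HB.instance Definition _ := isCStarAlgebra.Build R squot
  qmulA qmulDl qmulDr qmulZl qmulZr qstarK qstarD qstarZ qstarM qnormM
  qnorm_cstar.

Lemma spiM x y : spi (x *' y) = spi x ** spi y.
Proof. by rewrite -qmulE. Qed.

Lemma spi_star x : spi (sstar S x) = star (spi x).
Proof. by rewrite -qstarE. Qed.

Lemma spi_eq0 x : spi x = 0 <-> N x = 0.
Proof. by rewrite -[x in N x]subr0; exact: spiP. Qed.

End SeparatedQuotient.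
(** * Quotients by closed ideals *)

Section ClosedIdeals.
Variables (R : realType) (A : cstarAlgType R) (J : set A).
Hypothesis HJ : closed_ideal J.
Implicit Types x y j : A.

Lemma idealN x : J x -> J (- x).
Proof. by move=> Jx; rewrite -scaleN1r; apply: (idealZ HJ). Qed.

Lemma idealB x y : J x -> J y -> J (x - y).
Proof. by move=> Jx Jy; apply: (idealD HJ) => //; exact: idealN. Qed.

(** The witness is d = (1 + i t j)^-1 - 1 for large t: the element 1 + d is a
    contraction, and t (1 + d) j is i d, whose norm is at most 2. *)
Lemma ideal_approx_unit j (e : R) : J j -> star j = j -> 0 < e ->
  exists d, [/\ J d, forall y, nrm (y + d ** y) <= nrm y
              & nrm (j + d ** j) < e].
Proof.
move=> Jj js e0; pose t : R := 4 / e.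
have t0 : 0 < t by rewrite divr_gt0.
pose i : R[i] := 'i%C; pose x := (t%:C%C * i) *: j.
have xs : star x = - x.
  by rewrite starZ js rmorphM /= conj_i conj_reC mulrN scaleNr.
have Jx : J x by apply: (idealZ HJ).
have [d [dl dr dc]] := skew_resolvent xs.
exists d; split=> //.
  rewrite dl; apply: idealB; first exact: idealN.
  by apply: (Defs.idealMr HJ).
(* The contraction bound at y = d^* gives |d|^2 = |d d^*| <= 2 |d|. *)
have d2 : nrm d <= 2.
  have : nrm (d ** star d) <= nrm (star d) + nrm (star d).
    apply: le_trans (lerD (dc (star d)) (lexx _)).
    by rewrite -{1}[d ** _](addrK (star d)) [d ** _ + _]addrC nrmB.
  rewrite -{1}[d]starK nrm_cstar nrm_star expr2.
  have := nrm_ge0 d; nra.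
have : nrm (x + d ** x) <= 2.
  (* Hence t |j + d j| = |x + d x| = |d|, and t = 4 / e. *)
  suff -> : x + d ** x = - d by rewrite nrmN.
  by rewrite [in RHS]dr opprB opprK addrC.
have -> : x + d ** x = (t%:C%C * i) *: (j + d ** j).
  by rewrite scalerDr cmulZr.
rewrite -scalerA nrmZr gtr0_norm // nrmZ.
have -> : absc i = 1.
  by rewrite /absc /i normc_def /= expr0n /= add0r expr1n sqrtr1.
rewrite mul1r /t => tj.
have : nrm (j + d ** j) <= 2 * (e / 4).
  by rewrite -ler_pdivrMr ?divr_gt0 // invf_div mulrC.
lra.
Qed.

(** For j in J the element h = j^* j is a self-adjoint member of J, and for the d
    attached to h the norm of j^* + d j^* is small, because its square is that of
    (1 + d) h (1 + d)^*. So j^* is a limit of the elements - d j^* of J. *)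
Lemma ideal_star j : J j -> J (star j).
Proof.
move=> Jj; apply: ((closed_approx J).1 (ideal_closed HJ)) => e e0.
pose h := star j ** j.
have Jh : J h by apply: (idealMl HJ).
have hs : star h = h by rewrite starM starK.
have e2 : 0 < e ^+ 2 / 4 by rewrite divr_gt0 // exprn_gt0.
have [d [Jd dc dh]] := ideal_approx_unit Jh hs e2.
exists (- (d ** star j)); first by apply: idealN; apply: (Defs.idealMr HJ).
rewrite opprK; set z := star j + d ** star j.
have zz : z ** star z = (h + d ** h) + (h + d ** h) ** star d.
  rewrite /z starD starM starK cmulDl !cmulDr !cmulA -cmulA [in RHS]cmulDl.
  by rewrite -!cmulA -addrA [RHS]addrACA addrA addrACA.
have d2 : nrm d <= 3.
  have := dc (star d); rewrite nrm_star => dd.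
  have : nrm (d ** star d) <= 2 * nrm d.
    have := nrmB (star d + d ** star d) (star d).
    by rewrite addrC addKr nrm_star; lra.
  rewrite -{1}[d]starK nrm_cstar nrm_star; have := nrm_ge0 d; nra.
have : nrm z ^+ 2 < e ^+ 2.
  rewrite -nrm_star -nrm_cstar starK zz.
  apply: le_lt_trans (nrmD _ _) _.
  have := nrmM (h + d ** h) (star d); rewrite nrm_star.
  have := nrm_ge0 (h + d ** h); have := nrm_ge0 d; nra.
by rewrite ltr_sqr ?nnegrE ?nrm_ge0 // ltW.
Qed.

Definition qdist x : R := inf [set nrm (x + j) | j in J].

Lemma qdist_le x j : J j -> qdist x <= nrm (x + j).
Proof.
move=> Jj; apply: ge_inf; last by exists j.
by exists 0 => _ [k _ <-]; exact: nrm_ge0.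
Qed.

Lemma qdist_approx x e : 0 < e -> exists2 j, J j & nrm (x + j) < qdist x + e.
Proof.
move=> e0; have [|_ [j Jj <-] je] := @inf_adherent R [set nrm (x + j) | j in J] e e0.
  split; first by exists (nrm (x + 0)); exists 0 => //; exact: (ideal0 HJ).
  by exists 0 => _ [k _ <-]; exact: nrm_ge0.
by exists j.
Qed.

Lemma qdist_ge0 x : 0 <= qdist x.
Proof.
apply: lb_le_inf => [|_ [k _ <-]]; last exact: nrm_ge0.
by exists (nrm (x + 0)); exists 0 => //; exact: (ideal0 HJ).
Qed.

Lemma qdist_eq0 x : qdist x = 0 <-> J x.
Proof.
split=> [x0|Jx].
  apply: ((closed_approx J).1 (ideal_closed HJ)) => e e0.
  have [j Jj] := qdist_approx x e0; rewrite x0 add0r => xj.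
  by exists (- j); [exact: idealN|rewrite opprK].
apply/eqP; rewrite eq_le qdist_ge0 andbT.
by have := qdist_le x (idealN Jx); rewrite subrr nrm0.
Qed.

Lemma qdistD x y : qdist (x + y) <= qdist x + qdist y.
Proof.
apply/ler_addgt0Pr => e e0; have e2 : 0 < e / 2 by rewrite divr_gt0.
have [j Jj xj] := qdist_approx x e2; have [k Jk yk] := qdist_approx y e2.
have := qdist_le (x + y) (idealD HJ Jj Jk); rewrite addrACA.
by have := nrmD (x + j) (y + k); lra.
Qed.

Lemma qdistZ_le c x : qdist (c *: x) <= absc c * qdist x.
Proof.
have c0 := absc_ge0 c.
apply/ler_addgt0Pr => e e0.
have e2 : 0 < e / (absc c + 1) by rewrite divr_gt0 // ltr_pwDr.
have [j Jj xj] := qdist_approx x e2.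
apply: le_trans (qdist_le _ (idealZ HJ c Jj)) _.
rewrite -scalerDr nrmZ; apply: le_trans (ler_wpM2l c0 (ltW xj)) _.
rewrite mulrDr lerD2l mulrCA ler_piMr ?ltW // ltr_pdivrMr ?mul1r ?ltrDl //.
by rewrite ltr_pwDr.
Qed.

Lemma qdistZ c x : qdist (c *: x) = absc c * qdist x.
Proof.
apply: (@le_homogeneous R A setT qdist) => // [y _|d y _]; first exact: qdist_ge0.
exact: qdistZ_le.
Qed.

Lemma qdistM x y : qdist (x ** y) <= qdist x * qdist y.
Proof.
have le e : 0 < e -> qdist (x ** y) <= (qdist x + e) * (qdist y + e).
  move=> e0; have [j Jj xj] := qdist_approx x e0.
  have [k Jk yk] := qdist_approx y e0.
  have Jm : J (x ** k + j ** (y + k)).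
    by apply: (idealD HJ); [apply: (idealMl HJ)|apply: (Defs.idealMr HJ)].
  apply: le_trans (qdist_le _ Jm) _.
  rewrite addrA -cmulDr -cmulDl; apply: le_trans (nrmM _ _) _.
  by apply: ler_pM; rewrite ?nrm_ge0 // ltW.
have x0 := qdist_ge0 x; have y0 := qdist_ge0 y.
apply/ler_addgt0Pr => e e0; pose r := Num.min 1 (e / (qdist x + qdist y + 1)).
have d0 : 0 < qdist x + qdist y + 1 by lra.
have r0 : 0 < r by rewrite lt_min ltr01 divr_gt0.
have r1 : r <= 1 by rewrite ge_min lexx.
have re : r * (qdist x + qdist y + 1) <= e.
  by rewrite -ler_pdivlMr // ge_min lexx orbT.
by apply: le_trans (le r r0) _; nra.
Qed.

Lemma qdist_star x : qdist (star x) <= qdist x.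
Proof.
apply/ler_addgt0Pr => e /(qdist_approx x)[j Jj xj].
apply: le_trans (qdist_le _ (ideal_star Jj)) _.
by rewrite -starD nrm_star ltW.
Qed.

(** If x^* x + j almost attains the distance, then cutting x down by 1 + d^*, with
    d attached to j, leaves x in its coset and makes the contribution of j to
    (1 + d) (x^* x + j) (1 + d)^* negligible. *)
Lemma qdist_cstar x : qdist x ^+ 2 <= qdist (star x ** x).
Proof.
apply/ler_addgt0Pr => e e0; have e2 : 0 < e / 2 by rewrite divr_gt0.
have [k Jk xk] := qdist_approx (star x ** x) e2.
have hs : star (star x ** x) = star x ** x by rewrite starM starK.
(* The near-minimizer k may be replaced by its real part, as x^* x is self-adjoint. *)
pose j := (1 / 2%:R : R)%:C%C *: (k + star k).
have Jj : J j by apply: (idealZ HJ); apply: (idealD HJ) => //; exact: ideal_star.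
have js : star j = j by rewrite starZ starD starK conj_reC addrC.
have xj : nrm (star x ** x + j) < qdist (star x ** x) + e / 2.
  apply: le_lt_trans xk.
  apply: (@nrm_half R A _ (star x ** x + k) (star x ** x + star k)) => //.
    rewrite addrACA [RHS]addrACA -scalerDl -reCD.
    by rewrite (_ : 1 / 2%:R + 1 / 2%:R = 1) ?scale1r //; lra.
  by rewrite -{1}hs -starD nrm_star.
have [d [Jd dc dj]] := ideal_approx_unit Jj js e2.
have dc' y : nrm (y + y ** star d) <= nrm y.
  by rewrite -nrm_star starD starM starK (le_trans (dc _)) // nrm_star.
have Jxd : J (x ** star d) by apply: (idealMl HJ); exact: ideal_star.
apply: le_trans (_ : nrm (x + x ** star d) ^+ 2 <= _).
  by rewrite ler_sqr ?nnegrE ?nrm_ge0 ?qdist_ge0 // qdist_le.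
pose conjd y := (y + d ** y) + (y + d ** y) ** star d.
have conjd_le y : nrm (conjd y) <= nrm y by exact: le_trans (dc' _) (dc _).
have conjdB y z : conjd (y - z) = conjd y - conjd z.
  rewrite /conjd cmulBr addrACA -opprD cmulBl addrACA -opprD.
  by [].
rewrite -nrm_cstar.
have -> : star (x + x ** star d) ** (x + x ** star d) = conjd (star x ** x).
  have ax : (star x + d ** star x) ** x = star x ** x + d ** (star x ** x).
    by rewrite cmulDl -cmulA.
  by rewrite starD starM starK cmulDr cmulA ax.
have -> : star x ** x = (star x ** x + j) - j by rewrite addrK.
rewrite conjdB addrK; have := nrmB (conjd (star x ** x + j)) (conjd j).
have := conjd_le (star x ** x + j); have := dc' (j + d ** j).
rewrite -/(conjd j); lra.
Qed.

(** From a subsequence with geometrically small consecutive distances, correcting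
    terms in J are chosen one after the other so that the corrected sequence is
    Cauchy in norm. *)
Lemma qdist_complete (u : nat -> A) :
  (forall e : R, 0 < e -> exists N, forall m n, (N <= m)%N -> (N <= n)%N ->
      qdist (u m - u n) < e) ->
    exists l, forall e : R, 0 < e -> exists N, forall n, (N <= n)%N ->
      qdist (u n - l) < e.
Proof.
move=> uC; pose r n : R := 2^-1 ^+ n.
have r0 n : 0 < r n by rewrite exprn_gt0.
pose M k := sval (cid (uC (r k) (r0 k))).
have MP k m n : (M k <= m)%N -> (M k <= n)%N -> qdist (u m - u n) < r k.
  exact: (svalP (cid (uC (r k) (r0 k)))).
have stepP k : exists2 j, J j & nrm (u (M k.+1) - u (M k) + j) < r k * 2.
  have lt2 : qdist (u (M k.+1) - u (M k)) < r k * 2.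
    pose n := maxn (M k) (M k.+1).
    have := MP k n (M k) (leq_maxl _ _) (leqnn _).
    have := MP k.+1 (M k.+1) n (leqnn _) (leq_maxr _ _).
    have -> : r k.+1 = r k / 2 by rewrite /r exprS mulrC.
    have := qdistD (u (M k.+1) - u n) (u n - u (M k)); rewrite addrA subrK.
    by have := r0 k; lra.
  have [|j Jj jr] := @qdist_approx (u (M k.+1) - u (M k)) (r k * 2 - qdist (u (M k.+1) - u (M k))).
    by rewrite subr_gt0.
  by exists j; rewrite // -[r k * 2](subrKC (qdist (u (M k.+1) - u (M k)))).
pose jj k := s2val (cid2 (stepP k)).
have Jjj k : J (jj k) by exact: (s2valP (cid2 (stepP k))).
have jjr k : nrm (u (M k.+1) - u (M k) + jj k) < r k * 2.
  exact: (s2valP' (cid2 (stepP k))).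
(* Adding the partial sums keeps each term in its coset. *)
pose w k := u (M k) + \sum_(i < k) jj i.
have Jsum k : J (\sum_(i < k) jj i).
  by elim/big_ind: _ => *; [exact: (ideal0 HJ)|exact: (idealD HJ)|].
have wstep k : nrm (w k.+1 - w k) <= 2^-1 ^+ k * 2.
  rewrite /w big_ord_recr /= opprD addrACA [_ + jj k]addrC addrK.
  exact: ltW (jjr k).
have h0 : 0 <= 2^-1 :> R by rewrite invr_ge0.
have h1 : 2^-1 < 1 :> R by rewrite invf_lt1 // ltr1n.
have [l wl] := cauchy_seq_lim (geometric_cauchy h0 h1 (ltW (ltr0Sn R 1)) wstep).
exists l => e e0; have e2 : 0 < e / 2 by rewrite divr_gt0.
have [K1 HK1] := wl _ e2; have [K2 HK2] := geometric_small 1 h0 h1 e2.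
pose K := maxn K1 K2.
have rK : r K < e / 2.
  rewrite -[r K]mulr1; apply: le_lt_trans HK2; rewrite ler_pM2r //.
  by rewrite ler_wiXn2l ?leq_maxr // ltW.
exists (M K) => n Mn.
have := MP K n (M K) Mn (leqnn _).
have := qdistD (u n - u (M K)) (u (M K) - l); rewrite addrA subrK.
have := qdist_le (u (M K) - l) (Jsum K); rewrite addrAC -/(w K).
by have := HK1 K (leq_maxl _ _); lra.
Qed.

Definition ideal_seminorm : cstar_seminorm A :=
  CStarSeminorm (@cmulA R A) (@cmulDl R A) (@cmulDr R A) (@cmulZl R A)
    (@cmulZr R A) (@starK R A) (@starD R A) (@starZ R A) (@starM R A)
    qdistD qdistZ qdistM qdist_star qdist_cstar qdist_complete.

Definition ideal_quotient : cstarAlgType R := squot ideal_seminorm.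

Definition ideal_proj (x : A) : ideal_quotient := spi ideal_seminorm x.

Lemma ideal_proj_hom : star_hom ideal_proj.
Proof.
split=> *; [exact: spiD|exact: spiZ|exact: (spiM ideal_seminorm)|].
exact: (spi_star ideal_seminorm).
Qed.

Lemma ideal_proj_surj q : exists x, ideal_proj x = q.
Proof. by elim/spiW: q => x; exists x. Qed.

Lemma ideal_proj_ker x : ideal_proj x = 0 <-> J x.
Proof.
by split=> [/(spi_eq0 ideal_seminorm)/qdist_eq0|/qdist_eq0/(spi_eq0 ideal_seminorm)].
Qed.

End ClosedIdeals.
(** * Completions of algebras of adjointable operators *)

Section Submodules.
Variables (K : nzRingType) (M : lmodType K).

(** A submodule is given by a proposition; its type is the subtype of the
    corresponding boolean predicate, from which the module structure is
    inherited. *)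
Record submodule := Submodule {
  subm_set : M -> Prop ;
  subm0 : subm_set 0 ;
  submP : forall a x y, subm_set x -> subm_set y -> subm_set (a *: x + y)
}.

Definition subm_pred (S : submodule) : {pred M} := [pred x | `[< subm_set S x >]].

Lemma subm_pred_closed (S : submodule) : submod_closed (subm_pred S).
Proof.
split=> [|a x y /asboolP Sx /asboolP Sy]; apply/asboolP; first exact: subm0.
exact: submP.
Qed.

HB.instance Definition _ (S : submodule) :=
  GRing.isSubmodClosed.Build K M (subm_pred S) (subm_pred_closed S).

Definition subm_type (S : submodule) : Type := {x : M | x \in subm_pred S}.

HB.instance Definition _ (S : submodule) :=
  SubType.copy (subm_type S) {x : M | x \in subm_pred S}.
HB.instance Definition _ (S : submodule) := [Choice of subm_type S by <:].
HB.instance Definition _ (S : submodule) :=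
  [SubChoice_isSubLmodule of subm_type S by <:].

Definition in_subm (S : submodule) x (Sx : subm_set S x) : subm_type S :=
  exist (fun x => x \in subm_pred S) x (asboolT Sx).

Lemma subm_valP (S : submodule) (x : subm_type S) : subm_set S (val x).
Proof. by apply/asboolP; exact: (valP x). Qed.

End Submodules.

Section PreHilbert.
Variables (R : realType).

(** Completion takes place at the level of operators, not of vectors. *)
Record prehilbert := PreHilbert {
  ph_sort :> lmodType R[i] ;
  dot : ph_sort -> ph_sort -> R[i] ;
  dotDl : forall x y z, dot (x + y) z = dot x z + dot y z ;
  dotZl : forall c x y, dot (c *: x) y = c * dot x y ;
  dotC : forall x y, dot y x = (dot x y)^* ;
  dot_ge0 : forall x, 0 <= dot x x ;
  dot_eq0 : forall x, dot x x = 0 -> x = 0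
}.

Variable V : prehilbert.
Implicit Types x y z : V.

Lemma dotDr x y z : dot x (y + z) = dot x y + dot x z.
Proof. by rewrite dotC dotDl rmorphD /= -!dotC. Qed.

Lemma dotZr c x y : dot x (c *: y) = c^* * dot x y.
Proof. by rewrite dotC dotZl rmorphM /= -dotC. Qed.

Lemma dot0l x : dot 0 x = 0.
Proof. by rewrite -(scale0r 0) dotZl mul0r. Qed.

Lemma dotNl x y : dot (- x) y = - dot x y.
Proof. by rewrite -scaleN1r dotZl mulN1r. Qed.

Lemma dotNr x y : dot x (- y) = - dot x y.
Proof. by rewrite dotC dotNl rmorphN /= -dotC. Qed.

Definition vsq x : R := complex.Re (dot x x).
Definition vn x : R := Num.sqrt (vsq x).

Lemma dotxx x : dot x x = (vsq x)%:C%C.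
Proof. exact/ger0_reC/dot_ge0. Qed.

Lemma vsq_ge0 x : 0 <= vsq x.
Proof. by rewrite -lecC -dotxx dot_ge0. Qed.

Lemma vn_sq x : vn x ^+ 2 = vsq x.
Proof. by rewrite sqr_sqrtr // vsq_ge0. Qed.

Lemma vn_ge0 x : 0 <= vn x. Proof. exact: sqrtr_ge0. Qed.

Lemma vn0 : vn 0 = 0.
Proof. by rewrite /vn /vsq dot0l sqrtr0. Qed.

Lemma vn_eq0 x : vn x = 0 -> x = 0.
Proof. by move=> x0; apply: dot_eq0; rewrite dotxx -vn_sq x0 expr0n. Qed.

Lemma vnZ c x : vn (c *: x) = absc c * vn x.
Proof.
have c0 := absc_ge0 c.
apply/eqP; rewrite -(eqrXn2 (n := 2)) ?mulr_ge0 ?vn_ge0 // exprMn !vn_sq.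
apply/eqP/(@complexI R); rewrite reCM -!dotxx expr2 reCM -abscE dotZl dotZr.
by rewrite mulrA -expr2 normCK.
Qed.

Lemma cauchy_schwarz x y : absc (dot x y) <= vn x * vn y.
Proof.
have [y0|y0] := eqVneq (vn y) 0.
  rewrite (vn_eq0 y0) -(scale0r 0) dotZr rmorph0 mul0r.
  by rewrite /absc normr0 mulr_ge0 ?vn_ge0.
have {}y0 : 0 < vn y by rewrite lt_neqAle eq_sym y0 vn_ge0.
have a0 := absc_ge0 (dot x y).
rewrite -ler_sqr ?nnegrE ?mulr_ge0 ?vn_ge0 // exprMn !vn_sq.
have sy0 : 0 < vsq y by rewrite -vn_sq exprn_gt0.
(* The vector c y is the orthogonal projection of x onto y. *)
pose c := dot x y / (vsq y)%:C%C.
have : 0 <= dot (x - c *: y) (x - c *: y) by exact: dot_ge0.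
have cE : c * (vsq y)%:C%C = dot x y by rewrite /c divfK // gt_eqF // ltcC.
rewrite dotDl !dotDr !dotNl !dotNr !dotZl !dotZr opprK (dotxx y).
rewrite mulrCA cE [- (c * _) + _]addrC addrA subrK (dotC x y) [c * _]mulrC.
have -> : (dot x y)^* * c = (absc (dot x y) ^+ 2 / vsq y)%:C%C.
  rewrite /c mulrA [_ * dot x y]mulrC -normCK abscE.
  by rewrite reCM expr2 reCM (fmorphV (real_complex R)).
rewrite dotxx -(rmorphB (real_complex R)) (lecC 0) subr_ge0.
by rewrite ler_pdivrMr.
Qed.

Lemma vnD x y : vn (x + y) <= vn x + vn y.
Proof.
rewrite -ler_sqr ?nnegrE ?addr_ge0 ?vn_ge0 // sqrrD !vn_sq.
have -> : vsq (x + y) = vsq x + complex.Re (dot x y + dot y x) + vsq y.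
  by rewrite /vsq dotDl !dotDr !(raddfD (@complex.Re R)) /=; lra.
rewrite lerD2r lerD2l.
have := le_trans (ler_norm _) (absc_Re (dot x y)).
have := le_trans (ler_norm _) (absc_Re (dot y x)).
have := cauchy_schwarz x y; have := cauchy_schwarz y x.
by rewrite (raddfD (@complex.Re R)) /=; lra.
Qed.

End PreHilbert.

Section Operators.
Variables (R : realType) (V : prehilbert R).
Implicit Types (S T : V -> V) (x y : V).

Definition isadj S S' : Prop := forall x y, dot (S x) y = dot x (S' y).

Definition opbound S (M : R) : Prop := forall x, vn (S x) <= M * vn x.

(** On an incomplete space the adjoint of a bounded operator need not exist, so
    its existence is part of the definition. Linearity follows from it. *)
Definition adjointable S : Prop :=
  (exists S', isadj S S') /\ exists M, opbound S M.

(** The value 0 on operators without adjoint is a dummy. *)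
Definition adj S : V -> V := xget 0 [set S' | isadj S S'].

(** The operator norm as the least bound; it makes sense on the zero space. *)
Definition opn S : R := inf [set M | 0 <= M /\ opbound S M].

Lemma dot_ext x y : (forall z, dot x z = dot y z) -> x = y.
Proof.
move=> xy; apply/eqP; rewrite -subr_eq0; apply/eqP/dot_eq0.
by rewrite dotDl dotNl xy subrr.
Qed.

Lemma isadj_sym S S' : isadj S S' -> isadj S' S.
Proof. by move=> SS x y; rewrite dotC -SS -dotC. Qed.

Lemma isadj_unique S S1 S2 : isadj S S1 -> isadj S S2 -> S1 = S2.
Proof.
move=> /isadj_sym a1 /isadj_sym a2; apply/funext => x.
by apply: dot_ext => z; rewrite a1 a2.
Qed.

Lemma isadjD S S' x y : isadj S S' -> S (x + y) = S x + S y.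
Proof. by move=> SS; apply: dot_ext => z; rewrite SS !dotDl -!SS. Qed.

Lemma isadjZ S S' c x : isadj S S' -> S (c *: x) = c *: S x.
Proof. by move=> SS; apply: dot_ext => z; rewrite SS !dotZl -SS. Qed.

Lemma adjP S : adjointable S -> isadj S (adj S).
Proof. by case=> -[S' SS] _; apply: (@xgetPex _ 0 [set S' | isadj S S']); exists S'. Qed.

Lemma adjE S S' : isadj S S' -> adj S = S'.
Proof.
move=> SS; apply: (isadj_unique _ SS).
by apply: (@xgetPex _ 0 [set S' | isadj S S']); exists S'.
Qed.

Lemma opn_ge0 S : adjointable S -> 0 <= opn S.
Proof.
case=> _ [M SM]; apply: lb_le_inf => [|? []//].
exists `|M|; split=> // x; apply: le_trans (SM x) _.
by rewrite ler_wpM2r ?vn_ge0 // ler_norm.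
Qed.

Lemma opn_le S M : 0 <= M -> opbound S M -> opn S <= M.
Proof. by move=> M0 SM; apply: ge_inf; [exists 0 => ? []|split]. Qed.

Lemma opnP S : adjointable S -> opbound S (opn S).
Proof.
move=> [_ [M SM]] x.
have hi : has_inf [set M | 0 <= M /\ opbound S M].
  split; last by exists 0 => ? [].
  exists `|M|; split=> // y; apply: le_trans (SM y) _.
  by rewrite ler_wpM2r ?vn_ge0 // ler_norm.
have [x0|x0] := eqVneq (vn x) 0.
  by have := SM x; rewrite x0 !mulr0.
have {}x0 : 0 < vn x by rewrite lt_neqAle eq_sym x0 vn_ge0.
rewrite -ler_pdivrMr //; apply/ler_addgt0Pr => e e0.
have [K [K0 SK] Ke] := inf_adherent e0 hi.
by apply: le_trans (ltW Ke); rewrite ler_pdivrMr.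
Qed.

(** For y in V, |S' y|^2 = <S S' y, y> <= M |S' y| |y|. *)
Lemma opbound_adj S S' M : 0 <= M -> isadj S S' -> opbound S M -> opbound S' M.
Proof.
move=> M0 SS SM y.
have : vn (S' y) ^+ 2 <= M * vn y * vn (S' y).
  rewrite vn_sq /vsq (isadj_sym SS) dotC.
  rewrite Re_conj; apply: le_trans (ler_norm _) _; apply: le_trans (absc_Re _) _.
  apply: le_trans (cauchy_schwarz _ _) _.
  by rewrite mulrAC ler_wpM2r ?vn_ge0.
have := vn_ge0 (S' y); rewrite le_eqVlt => /predU1P[<- _|y0].
  by rewrite mulr_ge0 // vn_ge0.
by rewrite expr2 ler_pM2r.
Qed.

Lemma adjointable_adj S : adjointable S -> adjointable (adj S).
Proof.
move=> aS; split; first by exists S; apply/isadj_sym/adjP.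
by exists (opn S); apply: (opbound_adj (opn_ge0 aS) (adjP aS)); exact: opnP.
Qed.

Lemma adjK S : adjointable S -> adj (adj S) = S.
Proof. by move=> aS; apply/adjE/isadj_sym/adjP. Qed.

Lemma opn_adj S : adjointable S -> opn (adj S) <= opn S.
Proof.
move=> aS; apply: (opn_le (opn_ge0 aS)).
by apply: (opbound_adj (opn_ge0 aS) (adjP aS)); exact: opnP.
Qed.

Lemma isadj_comp S S' T T' : isadj S S' -> isadj T T' -> isadj (S \o T) (T' \o S').
Proof. by move=> SS TT x y; rewrite /= SS TT. Qed.

Lemma isadj_add S S' T T' : isadj S S' -> isadj T T' -> isadj (S + T) (S' + T').
Proof. by move=> SS TT x y; rewrite /= dotDl dotDr SS TT. Qed.

Lemma isadj_scale c S S' : isadj S S' -> isadj (c *: S) (c^* *: S').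
Proof. by move=> SS x y; rewrite /= dotZl dotZr conjCK SS. Qed.

Lemma opbound_comp S T M K : 0 <= M ->
  opbound S M -> opbound T K -> opbound (S \o T) (M * K).
Proof.
move=> M0 SM TK x; apply: le_trans (SM _) _.
by rewrite -mulrA ler_wpM2l.
Qed.

Lemma opbound_add S T M K : opbound S M -> opbound T K -> opbound (S + T) (M + K).
Proof.
move=> SM TK x; apply: le_trans (vnD _ _) _.
by rewrite mulrDl lerD.
Qed.

Lemma opbound_scale c S M : opbound S M -> opbound (c *: S) (absc c * M).
Proof.
by move=> SM x; rewrite vnZ -mulrA ler_wpM2l ?absc_ge0 //.
Qed.

Lemma adjointable_comp S T :
  adjointable S -> adjointable T -> adjointable (S \o T).
Proof.
move=> aS aT; split.
  by exists (adj T \o adj S); apply: isadj_comp; exact: adjP.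
by exists (opn S * opn T); apply: opbound_comp (opnP aS) (opnP aT); exact: opn_ge0.
Qed.

Lemma adjointableD S T : adjointable S -> adjointable T -> adjointable (S + T).
Proof.
move=> aS aT; split.
  by exists (adj S + adj T); apply: isadj_add; exact: adjP.
by exists (opn S + opn T); exact: opbound_add (opnP aS) (opnP aT).
Qed.

Lemma adjointableZ c S : adjointable S -> adjointable (c *: S).
Proof.
move=> aS; split; first by exists (c^* *: adj S); exact/isadj_scale/adjP.
by exists (absc c * opn S); exact/opbound_scale/opnP.
Qed.

Lemma adjointable0 : adjointable 0.
Proof.
split; first by exists 0 => x y; rewrite dot0l dotC dot0l rmorph0.
by exists 0 => x; rewrite mul0r vn0.
Qed.

Lemma opn_comp S T : adjointable S -> adjointable T ->
  opn (S \o T) <= opn S * opn T.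
Proof.
move=> aS aT; apply: opn_le; first by rewrite mulr_ge0 // opn_ge0.
by apply: opbound_comp (opnP aS) (opnP aT); exact: opn_ge0.
Qed.

Lemma opnD S T : adjointable S -> adjointable T -> opn (S + T) <= opn S + opn T.
Proof.
move=> aS aT; apply: opn_le; first by rewrite addr_ge0 // opn_ge0.
exact: opbound_add (opnP aS) (opnP aT).
Qed.

Lemma opnZ c S : adjointable S -> opn (c *: S) = absc c * opn S.
Proof.
apply: (@le_homogeneous R _ adjointable opn); first exact: adjointableZ.
  exact: opn_ge0.
move=> d T aT; apply: opn_le; first by rewrite mulr_ge0 ?absc_ge0 ?opn_ge0.
exact/opbound_scale/opnP.
Qed.

(** For x in V, |S x|^2 = <S^* S x, x> <= |S^* S| |x|^2. *)
Lemma opn_cstar S : adjointable S -> opn S ^+ 2 <= opn (adj S \o S).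
Proof.
move=> aS; have a0 := adjointable_comp (adjointable_adj aS) aS.
have n0 := opn_ge0 a0.
rewrite -[leRHS]sqr_sqrtr // ler_sqr ?nnegrE ?opn_ge0 ?sqrtr_ge0 //.
apply: opn_le => [|x]; first exact: sqrtr_ge0.
rewrite -ler_sqr ?nnegrE ?mulr_ge0 ?sqrtr_ge0 ?vn_ge0 // exprMn (sqr_sqrtr n0).
rewrite [vn (S x) ^+ 2]vn_sq [vsq (S x)]/vsq (adjP aS) dotC.
rewrite Re_conj; apply: le_trans (ler_norm _) _; apply: le_trans (absc_Re _) _.
apply: le_trans (cauchy_schwarz _ _) _.
by rewrite expr2 mulrA ler_wpM2r ?vn_ge0 //; exact: (opnP a0).
Qed.

Lemma opn_eq0 S : adjointable S -> opn S = 0 -> S = 0.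
Proof.
move=> aS S0; apply/funext => x; apply: vn_eq0; apply/eqP.
by rewrite eq_le vn_ge0 andbT; have := opnP aS x; rewrite S0 mul0r.
Qed.

End Operators.

Section OperatorCompletion.
Variables (R : realType) (V : prehilbert R).
Implicit Types (u v : nat -> V -> V).

(** The completion consists of Cauchy sequences of operators, so that products and
    adjoints are formed termwise and the algebraic laws are inherited; sequences
    with difference tending to 0 are identified later. *)
Definition opcauchy u : Prop := (forall n, adjointable (u n)) /\
  forall e : R, 0 < e -> exists N, forall m n, (N <= m)%N -> (N <= n)%N ->
    opn (u m - u n) < e.

Lemma adjointableB (S T : V -> V) :
  adjointable S -> adjointable T -> adjointable (S - T).
Proof.
by move=> aS aT; rewrite -scaleN1r; apply: adjointableD; last exact: adjointableZ.
Qed.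

Lemma opnN (S : V -> V) : adjointable S -> opn (- S) = opn S.
Proof. by move=> aS; rewrite -scaleN1r opnZ // /absc normrN1 mul1r. Qed.

Lemma opnBC (S T : V -> V) : adjointable S -> adjointable T ->
  opn (S - T) = opn (T - S).
Proof. by move=> aS aT; rewrite -opprB opnN //; exact: adjointableB. Qed.

Lemma opn_split (T S U : V -> V) : adjointable S -> adjointable T ->
  adjointable U -> opn (S - U) <= opn (S - T) + opn (T - U).
Proof.
move=> aS aT aU; have := opnD (adjointableB aS aT) (adjointableB aT aU).
by rewrite addrA subrK.
Qed.

Lemma opn0 : opn (0 : V -> V) = 0.
Proof.
by rewrite -(scale0r 0) (opnZ 0 (@adjointable0 _ V)) /absc normr0 mul0r.
Qed.

Lemma opcauchy0 : opcauchy 0.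
Proof.
split=> [n|e e0]; first exact: adjointable0.
by exists 0%N => m n _ _; rewrite subrr opn0.
Qed.

Lemma opcauchyP (c : R[i]) u v : opcauchy u -> opcauchy v -> opcauchy (c *: u + v).
Proof.
move=> [au uC] [av vC]; split=> [n|e e0].
  by apply: adjointableD => //; exact: adjointableZ.
have c1 : 0 < absc c + 1 by rewrite ltr_pwDr // absc_ge0.
have [|N HN] := uC (e / 2 / (absc c + 1)); first by rewrite !divr_gt0.
have [|M HM] := vC (e / 2); first by rewrite divr_gt0.
exists (maxn N M) => m n; rewrite !geq_max => /andP[Nm Mm] /andP[Nn Mn].
have -> : (c *: u + v) m - (c *: u + v) n = c *: (u m - u n) + (v m - v n).
  by rewrite scalerBr addrACA -opprD.
have aum := adjointableB (au m) (au n); have avm := adjointableB (av m) (av n).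
have aZ := adjointableZ c aum.
apply: le_lt_trans (opnD aZ avm) _; rewrite opnZ // [e]splitr ltr_leD //.
  have := HN m n Nm Nn; rewrite ltr_pdivlMr // => /(le_lt_trans _); apply.
  by rewrite mulrC ler_wpM2l ?opn_ge0 // lerDl.
by rewrite ltW // HM.
Qed.

Definition opseq := subm_type (Submodule opcauchy0 opcauchyP).

Definition opval (u : opseq) : nat -> V -> V := val u.

Lemma opvalP (u : opseq) : opcauchy (opval u).
Proof. exact: (subm_valP u). Qed.

Definition mkop u (uC : opcauchy u) : opseq :=
  @in_subm _ _ (Submodule opcauchy0 opcauchyP) u uC.

Lemma mkopE u (uC : opcauchy u) n : opval (mkop uC) n = u n.
Proof. by []. Qed.

Lemma opseqP (a b : opseq) : (forall n, opval a n = opval b n) -> a = b.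
Proof. by move=> ab; apply: val_inj; apply/funext. Qed.

Lemma op_adj (a : opseq) n : adjointable (opval a n).
Proof. exact: (opvalP a).1. Qed.

Lemma opn_dist (S T : V -> V) : adjointable S -> adjointable T ->
  `|opn S - opn T| <= opn (S - T).
Proof.
move=> aS aT; have := opnD (adjointableB aS aT) aT; rewrite subrK => ST.
have := opnD (adjointableB aT aS) aS; rewrite subrK opnBC // => TS.
by rewrite ler_norml; apply/andP; split; lra.
Qed.

Definition opsn (a : opseq) : R := limn (fun n => opn (opval a n)).

Lemma opsn_cvg (a : opseq) : opn (opval a n) @[n --> \oo] --> opsn a.
Proof.
apply/cauchy_cvgP/cauchy_exP => e e0.
have [N HN] := (opvalP a).2 e e0; exists (opn (opval a N)); exists N => // n /= Nn.
rewrite /ball /=; apply: le_lt_trans (HN N n (leqnn _) Nn).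
by apply: opn_dist; exact: op_adj.
Qed.

Arguments opsn_cvg a : clear implicits.

Lemma lim_le (f g : nat -> R) l l' : f @ \oo --> l -> g @ \oo --> l' ->
  (forall n, f n <= g n) -> l <= l'.
Proof.
by move=> fl gl fg; apply: (ler_cvg_to fl gl); exact: nearW.
Qed.

Lemma opsn_le (a : opseq) (r : R) N :
  (forall n, (N <= n)%N -> opn (opval a n) <= r) -> opsn a <= r.
Proof.
move=> ar; apply: limr_le; first exact: cvgP _ (opsn_cvg a).
by exists N.
Qed.

Lemma opsn_lt (a : opseq) (r : R) : opsn a < r ->
  exists N, forall n, (N <= n)%N -> opn (opval a n) < r.
Proof.
move=> ar; have /cvgrPdist_lt/(_ (r - opsn a)) := opsn_cvg a.
case=> [|N _ HN]; first by rewrite subr_gt0.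
by exists N => n /HN /=; rewrite ltr_norml => /andP[]; lra.
Qed.

Lemma op_bounded (a : opseq) : exists2 M, 0 <= M & forall n, opn (opval a n) <= M.
Proof.
have [aa aC] := opvalP a; have [N HN] := aC 1 ltr01.
have sum0 n : 0 <= \sum_(i < n) opn (opval a i).
  by apply: sumr_ge0 => i _; exact: opn_ge0.
exists (opn (opval a N) + 1 + \sum_(i < N) opn (opval a i)).
  by rewrite !addr_ge0 ?opn_ge0.
move=> n; have [nN|Nn] := ltnP n N.
  rewrite (bigD1 (Ordinal nN)) //= addrCA lerDl addr_ge0 ?addr_ge0 ?opn_ge0 //.
  by apply: sumr_ge0 => i _; exact: opn_ge0.
apply: le_trans (_ : opn (opval a N) + 1 <= _); last by rewrite lerDl.
have := HN n N Nn (leqnn _).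
by have := opnD (adjointableB (aa n) (aa N)) (aa N); rewrite subrK; lra.
Qed.

Lemma opcauchyM (a b : opseq) : opcauchy (fun n => opval a n \o opval b n).
Proof.
have [aa aC] := opvalP a; have [ab bC] := opvalP b.
split=> [n|e e0]; first exact: adjointable_comp.
have [M M0 aM] := op_bounded a; have [K K0 bK] := op_bounded b.
(* The bounds M and K on the two sequences control the two terms of
     a b - a' b' = (a - a') b + a' (b - b'). *)
have d0 : 0 < e / 2 / (M + K + 1) by rewrite !divr_gt0 //; lra.
have [N HN] := aC _ d0; have [N' HN'] := bC _ d0.
exists (maxn N N') => m n; rewrite !geq_max => /andP[Nm Mm] /andP[Nn Mn].
have -> : (opval a m \o opval b m) - (opval a n \o opval b n) =
    ((opval a m - opval a n) \o opval b m) +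
    (opval a n \o (opval b m - opval b n)).
  apply/funext => x /=; rewrite !fctE /=.
  have L := adjP (aa n).
  rewrite (isadjD _ _ L) -(scaleN1r (opval b n x)) (isadjZ _ _ L) scaleN1r.
  by rewrite addrA subrK.
have aam := adjointableB (aa m) (aa n); have abm := adjointableB (ab m) (ab n).
apply: le_lt_trans (opnD (adjointable_comp aam (ab m)) (adjointable_comp (aa n) abm)) _.
have := opn_comp aam (ab m); have := opn_comp (aa n) abm.
have := HN m n Nm Nn; have := HN' m n Mm Mn.
have := aM n; have := bK m; have := opn_ge0 aam; have := opn_ge0 abm.
have := opn_ge0 (aa n); have := opn_ge0 (ab m).
have dE : e / 2 / (M + K + 1) * (M + K + 1) = e / 2.
  by rewrite divfK // gt_eqF //; lra.
move: d0 dE; move: (e / 2 / (M + K + 1)) => d d0 dE; nra.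
Qed.

Lemma opcauchy_star (a : opseq) : opcauchy (fun n => adj (opval a n)).
Proof.
have [aa aC] := opvalP a.
split=> [n|e /aC[N HN]]; first exact: adjointable_adj.
exists N => m n Nm Nn; apply: le_lt_trans (HN m n Nm Nn).
have aB := adjointableB (aa m) (aa n).
rewrite -(adjE (S := opval a m - opval a n) (S' := adj (opval a m) - adj (opval a n))).
  exact: opn_adj.
apply: isadj_add; first exact: adjP.
rewrite -scaleN1r -[- adj _]scaleN1r.
have -> : -1 *: adj (opval a n) = (-1)^* *: adj (opval a n).
  by rewrite rmorphN rmorph1.
by apply: isadj_scale; exact: adjP.
Qed.

Definition opmul (a b : opseq) : opseq := mkop (opcauchyM a b).
Definition opstar (a : opseq) : opseq := mkop (opcauchy_star a).

Lemma opvalD a b n : opval (a + b) n = opval a n + opval b n.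
Proof. by []. Qed.

Lemma opvalZ k a n : opval (k *: a) n = k *: opval a n.
Proof. by []. Qed.

Lemma opval_sub (a b : opseq) n : opval (a - b) n = opval a n - opval b n.
Proof. by []. Qed.

Lemma opvalM a b n : opval (opmul a b) n = opval a n \o opval b n.
Proof. by []. Qed.

Lemma opval_star a n : opval (opstar a) n = adj (opval a n).
Proof. by []. Qed.

Lemma opmulA a b c : opmul a (opmul b c) = opmul (opmul a b) c.
Proof. by apply: opseqP => n; rewrite !opvalM compA. Qed.

Lemma opmulDl a b c : opmul (a + b) c = opmul a c + opmul b c.
Proof. by apply: opseqP => n; rewrite opvalD !opvalM opvalD. Qed.

Lemma opmulDr a b c : opmul a (b + c) = opmul a b + opmul a c.
Proof.
apply: opseqP => n; rewrite opvalD !opvalM opvalD; apply/funext => x.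
exact: (isadjD _ _ (adjP (op_adj a n))).
Qed.

Lemma opmulZl k a b : opmul (k *: a) b = k *: opmul a b.
Proof. by apply: opseqP => n; rewrite opvalZ !opvalM opvalZ. Qed.

Lemma opmulZr k a b : opmul a (k *: b) = k *: opmul a b.
Proof.
apply: opseqP => n; rewrite opvalZ !opvalM opvalZ; apply/funext => x.
exact: (isadjZ _ _ (adjP (op_adj a n))).
Qed.

Lemma opstarK a : opstar (opstar a) = a.
Proof. by apply: opseqP => n; rewrite !opval_star (adjK (op_adj a n)). Qed.

Lemma opstarD a b : opstar (a + b) = opstar a + opstar b.
Proof.
apply: opseqP => n; rewrite opvalD !opval_star opvalD.
exact: adjE (isadj_add (adjP (op_adj a n)) (adjP (op_adj b n))).
Qed.

Lemma opstarZ k a : opstar (k *: a) = k^* *: opstar a.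
Proof.
apply: opseqP => n; rewrite opvalZ !opval_star opvalZ.
exact: adjE (isadj_scale k (adjP (op_adj a n))).
Qed.

Lemma opstarM a b : opstar (opmul a b) = opmul (opstar b) (opstar a).
Proof.
apply: opseqP => n; rewrite opvalM !opval_star opvalM.
exact: adjE (isadj_comp (adjP (op_adj a n)) (adjP (op_adj b n))).
Qed.

Lemma opsnD a b : opsn (a + b) <= opsn a + opsn b.
Proof.
apply: (lim_le (opsn_cvg _) (cvgD (opsn_cvg a) (opsn_cvg b))) => n.
by rewrite opvalD; exact: opnD (op_adj a n) (op_adj b n).
Qed.

Lemma opsnZ k a : opsn (k *: a) = absc k * opsn a.
Proof.
have E : (fun n => opn (opval (k *: a) n)) = (fun n => absc k * opn (opval a n)).
  by apply/funext => n; rewrite opvalZ (opnZ k (op_adj a n)).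
by rewrite {1}/opsn E; apply: cvg_lim => //; exact: cvgMl_tmp (opsn_cvg a).
Qed.

Lemma opsnM a b : opsn (opmul a b) <= opsn a * opsn b.
Proof.
apply: (lim_le (opsn_cvg _) (cvgM (opsn_cvg a) (opsn_cvg b))) => n.
by rewrite opvalM; exact: opn_comp (op_adj a n) (op_adj b n).
Qed.

Lemma opsn_star a : opsn (opstar a) <= opsn a.
Proof.
apply: (lim_le (opsn_cvg _) (opsn_cvg a)) => n.
by rewrite opval_star; exact: opn_adj (op_adj a n).
Qed.

Lemma opsn_cstar a : opsn a ^+ 2 <= opsn (opmul (opstar a) a).
Proof.
rewrite expr2; apply: (lim_le (cvgM (opsn_cvg a) (opsn_cvg a)) (opsn_cvg _)) => n.
by rewrite opvalM opval_star; exact: opn_cstar (op_adj a n).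
Qed.

(** Diagonal argument: the limit takes from the k-th sequence a term beyond which
    this sequence varies by less than 1/(k+1). *)
Lemma opseq_complete (a : nat -> opseq) :
  (forall e : R, 0 < e -> exists N, forall m n, (N <= m)%N -> (N <= n)%N ->
      opsn (a m - a n) < e) ->
    exists l, forall e : R, 0 < e -> exists N, forall n, (N <= n)%N ->
      opsn (a n - l) < e.
Proof.
move=> aC; have r0 k : 0 < (k.+1%:R^-1 : R) by rewrite invr_gt0.
pose N k := sval (cid ((opvalP (a k)).2 _ (r0 k))).
have NP k m n : (N k <= m)%N -> (N k <= n)%N ->
    opn (opval (a k) m - opval (a k) n) < k.+1%:R^-1.
  exact: (svalP (cid ((opvalP (a k)).2 _ (r0 k)))).
pose l k := opval (a k) (N k).
have al k : adjointable (l k) by exact: op_adj.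
have diag k j p : (N k <= p)%N -> (N j <= p)%N ->
    opn (l k - l j) <= k.+1%:R^-1 + opn (opval (a k) p - opval (a j) p) + j.+1%:R^-1.
  move=> kp jp.
  apply: le_trans (opn_split (al k) (op_adj (a j) p) (al j)) _; apply: lerD.
    apply: le_trans (opn_split (al k) (op_adj (a k) p) (op_adj _ _)) _.
    by apply: lerD => //; apply/ltW/NP.
  exact/ltW/NP.
have lC : opcauchy l.
  split=> // e e0; have e3 : 0 < e / 3 by rewrite divr_gt0.
  have [K HK] := aC _ e3; have [K' HK'] := harmonic_small e3.
  exists (maxn K K') => k j; rewrite !geq_max => /andP[Kk Kk'] /andP[Kj Kj'].
  have [P HP] := opsn_lt (HK k j Kk Kj); pose p := maxn P (maxn (N k) (N j)).
  apply: le_lt_trans (diag k j p _ _) _.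
  - by rewrite /p !leq_max leqnn !orbT.
  - by rewrite /p !leq_max leqnn !orbT.
  have := HK' k Kk'; have := HK' j Kj'; have := HP p (leq_maxl _ _).
  rewrite opval_sub; move: (k.+1%:R^-1) (j.+1%:R^-1) => ? ?; lra.
exists (mkop lC) => e e0; have e4 : 0 < e / 4 by rewrite divr_gt0.
have [K HK] := aC _ e4; have [K' HK'] := harmonic_small e4.
exists (maxn K K') => k; rewrite geq_max => /andP[Kk Kk'].
suff : opsn (a k - mkop lC) <= 3 * (e / 4) by lra.
apply: (@opsn_le _ _ (maxn (N k) (maxn K K'))) => m.
rewrite !geq_max => /andP[Nm /andP[Km Km']]; rewrite opval_sub mkopE.
have [P HP] := opsn_lt (HK k m Kk Km); pose p := maxn P (maxn (N k) (N m)).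
have kp : (N k <= p)%N by rewrite /p !leq_max leqnn !orbT.
have mp : (N m <= p)%N by rewrite /p !leq_max leqnn !orbT.
have := opn_split (op_adj (a k) m) (op_adj (a k) p) (al m).
have := opn_split (op_adj (a k) p) (op_adj (a m) p) (al m).
have := NP k m p Nm kp; have := NP m p (N m) mp (leqnn _).
have := HP p (leq_maxl _ _); rewrite opval_sub.
have := HK' k Kk'; have := HK' m Km'.
rewrite -/(l m); move: (k.+1%:R^-1) (m.+1%:R^-1) => ? ?; lra.
Qed.

Definition op_seminorm : cstar_seminorm opseq :=
  CStarSeminorm opmulA opmulDl opmulDr opmulZl opmulZr opstarK opstarD opstarZ
    opstarM opsnD opsnZ opsnM opsn_star opsn_cstar opseq_complete.

Definition op_algebra : cstarAlgType R := squot op_seminorm.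

Lemma opcauchy_cst S : adjointable S -> opcauchy (fun=> S).
Proof. by move=> aS; split=> // e e0; exists 0%N => m n _ _; rewrite subrr opn0. Qed.

Definition op_elt S (aS : adjointable S) : op_algebra :=
  spi op_seminorm (mkop (opcauchy_cst aS)).

Lemma op_elt_eq S T (aS : adjointable S) (aT : adjointable T) :
  S = T -> op_elt aS = op_elt aT.
Proof. by move=> ST; congr (spi _ _); exact: opseqP. Qed.

Lemma op_eltM S T (aS : adjointable S) (aT : adjointable T)
    (aST : adjointable (S \o T)) : op_elt aS ** op_elt aT = op_elt aST.
Proof.
rewrite -[LHS](spiM op_seminorm); congr (spi _ _); exact: opseqP.
Qed.

Lemma op_eltD S T (aS : adjointable S) (aT : adjointable T)
    (aST : adjointable (S + T)) : op_elt aS + op_elt aT = op_elt aST.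
Proof.
rewrite -[LHS](spiD op_seminorm); congr (spi _ _); exact: opseqP.
Qed.

Lemma op_elt_star S S' (aS : adjointable S) (aS' : adjointable S') :
  isadj S S' -> star (op_elt aS) = op_elt aS'.
Proof.
move=> SS; rewrite -[LHS](spi_star op_seminorm); congr (spi _ _).
by apply: opseqP => n; exact: adjE.
Qed.

Lemma opsn_cst S (aS : adjointable S) : opsn (mkop (opcauchy_cst aS)) = opn S.
Proof.
have E : (fun n => opn (opval (mkop (opcauchy_cst aS)) n)) = fun=> opn S.
  by apply/funext => n; rewrite mkopE.
by rewrite /opsn E lim_cst.
Qed.

Lemma op_elt_eq0 S (aS : adjointable S) : op_elt aS = 0 <-> S = 0.
Proof.
split=> [/(spi_eq0 op_seminorm) S0|S0].
  by apply: (opn_eq0 aS); rewrite -(opsn_cst aS).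
apply/(spi_eq0 op_seminorm).
by rewrite -[LHS]/(opsn (mkop (opcauchy_cst aS))) opsn_cst S0 opn0.
Qed.

End OperatorCompletion.
(** * Partial bijections acting on finitely supported functions *)

Section PartialBijections.
Variables (R : realType) (X : choiceType) (x0 : X).

Definition fin_supp (f : X -> R[i]^o) : Prop := finite_set [set x | f x <> 0].

Lemma fin_supp0 : fin_supp 0.
Proof. by apply: (sub_finite_set _ (finite_set0 X)) => x. Qed.

Lemma fin_suppP (c : R[i]) (f g : X -> R[i]^o) :
  fin_supp f -> fin_supp g -> fin_supp (c *: f + g).
Proof.
move=> ff fg; have : finite_set ([set x | f x <> 0] `|` [set x | g x <> 0]).
  by rewrite finite_setU.
apply: sub_finite_set => x /= xn0; apply: contrapT => /not_orP[/contrapT fx /contrapT gx].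
by apply: xn0; rewrite !fctE fx gx scaler0 addr0.
Qed.

Definition fsfct : lmodType R[i] := subm_type (Submodule fin_supp0 fin_suppP).

Definition fsval (f : fsfct) : X -> R[i] := val f.

Definition mkfs f (ff : fin_supp f) : fsfct :=
  @in_subm _ _ (Submodule fin_supp0 fin_suppP) f ff.

Lemma fsvalP (f : fsfct) : fin_supp (fsval f).
Proof. exact: (subm_valP f). Qed.

Lemma fs_ext (f g : fsfct) : (forall x, fsval f x = fsval g x) -> f = g.
Proof. by move=> fg; apply: val_inj; apply/funext. Qed.

Definition fdot (f g : fsfct) : R[i] :=
  \sum_(x \in [set: X]) (fsval f x * (fsval g x)^*).

Lemma fdotE (D : set X) (f g : fsfct) : finite_set D ->
  (forall x, ~ D x -> fsval f x = 0) ->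
  fdot f g = \sum_(x <- fset_set D) (fsval f x * (fsval g x)^*).
Proof.
move=> fD f0; rewrite -fsbig_finite //; apply/esym/fsbig_widen => // x [_ /f0 /= ->].
by rewrite mul0r.
Qed.

Lemma fdotDl (f g h : fsfct) : fdot (f + g) h = fdot f h + fdot g h.
Proof.
pose D := [set x | fsval f x <> 0] `|` [set x | fsval g x <> 0].
have fD : finite_set D by rewrite finite_setU; split; exact: fsvalP.
have f0 x : ~ D x -> fsval f x = 0 by move=> /not_orP[/contrapT].
have g0 x : ~ D x -> fsval g x = 0 by move=> /not_orP[_ /contrapT].
have fg x : fsval (f + g) x = fsval f x + fsval g x by [].
rewrite !(fdotE (D := D)) // => [|x Dx]; last by rewrite fg f0 // g0 // addr0.
by rewrite -big_split; apply: eq_bigr => x _; rewrite /= fg mulrDl.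
Qed.

Lemma fdotZl (c : R[i]) (f h : fsfct) : fdot (c *: f) h = c * fdot f h.
Proof.
pose D := [set x | fsval f x <> 0].
have fD : finite_set D by exact: fsvalP.
have f0 x : ~ D x -> fsval f x = 0 by move=> /contrapT.
have cf x : fsval (c *: f) x = c * fsval f x by [].
rewrite !(fdotE (D := D)) // => [|x Dx]; last by rewrite cf f0 // mulr0.
by rewrite mulr_sumr; apply: eq_bigr => x _; rewrite cf mulrA.
Qed.

Lemma fdotC (f g : fsfct) : fdot g f = (fdot f g)^*.
Proof.
pose D := [set x | fsval f x <> 0] `|` [set x | fsval g x <> 0].
have fD : finite_set D by rewrite finite_setU; split; exact: fsvalP.
have f0 x : ~ D x -> fsval f x = 0 by move=> /not_orP[/contrapT].
have g0 x : ~ D x -> fsval g x = 0 by move=> /not_orP[_ /contrapT].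
rewrite !(fdotE (D := D)) // rmorph_sum; apply: eq_bigr => x _.
by rewrite /= rmorphM /= conjCK mulrC.
Qed.

Lemma fdot_ge0 f : 0 <= fdot f f.
Proof. by apply: fsumr_ge0 => x _; rewrite -normCK exprn_ge0. Qed.

Lemma fdot_eq0 f : fdot f f = 0 -> f = 0.
Proof.
have fD : finite_set [set x | fsval f x <> 0] by exact: fsvalP.
rewrite (fdotE _ fD) => [|x /contrapT //] /eqP.
rewrite psumr_eq0 => [/allP f0|x _]; last by rewrite -normCK exprn_ge0.
apply: fs_ext => x; apply: contrapT => fx.
have /f0 : x \in fset_set [set x | fsval f x <> 0] by rewrite in_fset_set // inE.
by rewrite /= -normCK sqrf_eq0 normr_eq0 => /eqP.
Qed.

Definition fspace : prehilbert R :=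
  @PreHilbert R fsfct fdot fdotDl fdotZl fdotC fdot_ge0 fdot_eq0.

(** A partial bijection, given with its partial inverse. The operators below pull
    functions back along pfun, so a product of operators corresponds to the
    composition of the partial maps from left to right. *)
Record pbij := PBij {
  pfun : X -> option X ;
  pinv : X -> option X ;
  pbijP : forall x y, pfun x = Some y <-> pinv y = Some x
}.

Implicit Types P Q N : pbij.

Definition pbij_inv P : pbij :=
  {| pfun := pinv P ; pinv := pfun P ;
     pbijP := fun x y => iff_sym (pbijP P y x) |}.

Lemma pbij_fin_supp P (f : fsfct) :
  fin_supp (fun x => oapp (fsval f) 0 (pfun P x)).
Proof.
have : finite_set ((fun y => odflt x0 (pinv P y)) @` [set y | fsval f y <> 0]).
  by apply: finite_image; exact: fsvalP.
apply: sub_finite_set => x /=; case Px : (pfun P x) => [y|//] /= fy.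
by exists y => //; have /pbijP -> := Px.
Qed.

Definition pop P (f : fspace) : fspace := mkfs (pbij_fin_supp P f).

Lemma popE P f x : fsval (pop P f) x = oapp (fsval f) 0 (pfun P x).
Proof. by []. Qed.

(** The sum defining the left side runs over the domain of P, the one on the right
    over its range, and P matches them term by term. *)
Lemma pop_isadj P : isadj (pop P) (pop (pbij_inv P)).
Proof.
move=> f g; rewrite /= /fdot.
pose D := [set x | pfun P x <> None]; pose D' := [set y | pinv P y <> None].
transitivity (\sum_(x \in D) (fsval (pop P f) x * (fsval g x)^*)).
  apply/esym/fsbig_widen => // x [_ /contrapT Px].
  by rewrite /= popE Px mul0r.
transitivity (\sum_(y \in D') (fsval f y * (fsval (pop (pbij_inv P) g) y)^*)); last first.
  apply/fsbig_widen => // y [_ /contrapT Py].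
  by rewrite /= popE /= Py rmorph0 mulr0.
rewrite (reindex_fsbig (fun x => odflt x0 (pfun P x)) D D').
  apply: eq_fsbigr => x; rewrite inE /D /= !popE.
  case Px : (pfun P x) => [y|//] _ /=.
  by have /pbijP -> := Px.
split.
- move=> x; rewrite /D /D' /=; case Px : (pfun P x) => [y|//] _ /=.
  by have /pbijP -> := Px.
- move=> x y; rewrite !inE /D /=; case Px : (pfun P x) => [z|//] _.
  case Py : (pfun P y) => [z'|//] _ /= zz'.
  have /pbijP := Px; have /pbijP := Py.
  by rewrite zz' => -> [].
- move=> y; rewrite /D' /=; case Py : (pinv P y) => [x|//] _.
  have /pbijP Px := Py.
  by exists x; rewrite /D /= ?Px.
Qed.

(** With S the operator and g = S^* S f, the vectors g and f - g are orthogonal and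
    |g| = |S f|. *)
Lemma pop_opbound P : opbound (pop P) 1.
Proof.
move=> f; rewrite mul1r; have pa := @pop_isadj P.
pose g := pop (pbij_inv P) (pop P f).
have gP : pop P g = pop P f.
  apply: fs_ext => x; rewrite !popE; case Px : (pfun P x) => [y|//] /=.
  by have /pbijP Py := Px; rewrite /g popE /= Py /= popE Px.
have fg : dot f g = dot (pop P f) (pop P f) by rewrite pa.
have gf : dot g f = dot (pop P f) (pop P f) by rewrite dotC fg -dotC.
have gg : dot g g = dot (pop P f) (pop P f) by have := pa g (pop P f); rewrite gP => ->.
have pf : vsq (pop P f) = vsq f - vsq (f - g).
  rewrite /vsq -(raddfB (@complex.Re R)); congr complex.Re.
  rewrite dotDl !dotDr !dotNl !dotNr gf gg fg opprK addNr addr0.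
  by rewrite opprB subrKC.
rewrite -ler_sqr ?nnegrE ?vn_ge0 // !vn_sq pf gerBl; exact: vsq_ge0.
Qed.

Lemma pop_adjointable P : adjointable (pop P).
Proof.
by split; [exists (pop (pbij_inv P)); exact: pop_isadj|exists 1; exact: pop_opbound].
Qed.

Definition pelt P : op_algebra fspace := op_elt (pop_adjointable P).

Lemma pelt_star P : star (pelt P) = pelt (pbij_inv P).
Proof. by apply: op_elt_star; exact: pop_isadj. Qed.

Lemma pelt_eq P Q : pfun P =1 pfun Q -> pelt P = pelt Q.
Proof.
move=> PQ; apply: op_elt_eq; apply/funext => f; apply: fs_ext => x.
by rewrite !popE PQ.
Qed.

Lemma peltM P Q N : (forall x, obind (pfun Q) (pfun P x) = pfun N x) ->
  pelt P ** pelt Q = pelt N.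
Proof.
move=> PQN; rewrite (op_eltM _ _ (adjointable_comp (pop_adjointable P) (pop_adjointable Q))).
apply: op_elt_eq; apply/funext => f; apply: fs_ext => x.
by rewrite /= !popE -PQN; case: (pfun P x) => //= y.
Qed.

Lemma peltD P Q N :
  (forall x, pfun P x = pfun N x /\ pfun Q x = None \/
             pfun Q x = pfun N x /\ pfun P x = None) ->
  pelt P + pelt Q = pelt N.
Proof.
move=> PQN; rewrite (op_eltD _ _ (adjointableD (pop_adjointable P) (pop_adjointable Q))).
apply: op_elt_eq; apply/funext => f; apply: fs_ext => x.
have -> : fsval ((pop P + pop Q) f) x = fsval (pop P f) x + fsval (pop Q f) x by [].
by rewrite !popE; case: (PQN x) => -[-> ->]; rewrite ?addr0 ?add0r.
Qed.

Lemma pelt_eq0 P : pelt P = 0 <-> forall x, pfun P x = None.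
Proof.
split=> [/op_elt_eq0 P0 x|P0]; last first.
  by apply/op_elt_eq0/funext => f; apply: fs_ext => x; rewrite popE P0.
case Px : (pfun P x) => [y|//].
have fd : fin_supp (fun z => if z == y then 1 else 0).
  apply: sub_finite_set (finite_set1 y) => z /=; case: eqP => //.
have /(congr1 (fun f => fsval f x)) : pop P (mkfs fd) = 0 by rewrite P0.
rewrite popE Px /= /fsval /= eqxx => /eqP.
by rewrite oner_eq0.
Qed.

Lemma pid_proof (b : pred X) x y :
  (if b x then Some x else None) = Some y <->
  (if b y then Some y else None) = Some x.
Proof. by split; case: ifP => // bx [<-]; rewrite bx. Qed.

Definition pid (b : pred X) : pbij := PBij (pid_proof b).

End PartialBijections.

(** * The path representation *)

Section PathRepresentation.
Variables (R : realType) (F : digraph) (v0 : vert F).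
Implicit Types (e f : edge F) (l : seq (edge F)) (v w : vert F).

Definition path_rng l : vert F := if l is e :: _ then rng e else v0.

(** A path e_1 .. e_n with source v0 is the list of its edges; since the source
    is fixed, the empty list can stand for the vertex v0. *)
Fixpoint is_path l : bool :=
  if l is e :: l' then (src e == path_rng l') && is_path l' else true.

(** The operator obtained by pulling back along this map sends the indicator of l
    to the indicator of e l if this is a path, and to 0 otherwise. *)
Definition edge_fun e l : option (seq (edge F)) :=
  if l is f :: l' then (if (f == e) && is_path l then Some l' else None) else None.

Definition edge_inv e l : option (seq (edge F)) :=
  if is_path (e :: l) then Some (e :: l) else None.

Lemma edge_pbijP e l l' : edge_fun e l = Some l' <-> edge_inv e l' = Some l.
Proof.
rewrite /edge_fun /edge_inv; case: l => [|f l].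
  by split=> //; case: ifP.
split.
  by case: ifP => // /andP[/eqP -> fl] [<-]; rewrite fl.
by case: ifP => // el' [<- <-]; rewrite eqxx el'.
Qed.

Definition edge_pbij e := PBij (edge_pbijP e).

Definition vert_pbij v := pid (fun l => is_path l && (path_rng l == v)).

(** The partial identity that sums the range projections of the edges of r. *)
Definition start_pbij (r : seq (edge F)) :=
  pid (fun l => is_path l && (if l is e :: _ then e \in r else false)).

Local Notation pelt P := (@pelt R _ [::] P).

Definition path_p v := pelt (vert_pbij v).
Definition path_s e := pelt (edge_pbij e).

Lemma pid_pelt_proj (b : pred (seq (edge F))) :
  pelt (pid b) ** pelt (pid b) = pelt (pid b) /\ star (pelt (pid b)) = pelt (pid b).
Proof.
split; last by rewrite pelt_star; exact: pelt_eq.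
by apply: peltM => l /=; case: ifP => //= ->.
Qed.

Lemma pelt_eq0_M (P Q : pbij (seq (edge F))) :
  (forall l, obind (pfun Q) (pfun P l) = None) -> pelt P ** pelt Q = 0.
Proof.
move=> PQ; rewrite (@peltM _ _ _ P Q (pid pred0)) => [|l]; last by rewrite PQ.
by apply/pelt_eq0.
Qed.

Lemma path_s_range e : path_s e ** star (path_s e) = pelt (start_pbij [:: e]).
Proof.
rewrite pelt_star; apply: peltM => -[|f l] //=.
rewrite inE; case: (eqVneq f e) => [->|_] /=; last by rewrite andbF.
rewrite andbT; case: ifP => //= el; rewrite /edge_inv /= el.
by [].
Qed.

Lemma path_s_source e : star (path_s e) ** path_s e = path_p (src e).
Proof.
rewrite pelt_star; apply: peltM => l /=.
rewrite /edge_inv /= [path_rng l == _]eq_sym andbC; case: ifP => //= el.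
by rewrite eqxx /= andbC el.
Qed.

Lemma path_sum (r : seq (edge F)) : uniq r ->
  \sum_(e <- r) (path_s e ** star (path_s e)) = pelt (start_pbij r).
Proof.
elim: r => [_|e r IH /= /andP[er ur]].
  rewrite big_nil; apply/esym/pelt_eq0 => -[|f l] //=.
  by rewrite andbF.
rewrite big_cons IH // path_s_range; apply: peltD => -[|f l] /=; first by left.
rewrite !inE; case: (eqVneq f e) => [->|fe] /=; last by right; rewrite !andbF.
by left; rewrite (negbTE er) andbF.
Qed.

Lemma path_range_sum v : finite_set (in_edges v) ->
  exists2 r : seq (edge F), (forall e, (e \in r) = (rng e == v)) &
    range_sum path_s v = pelt (start_pbij r).
Proof.
move=> fv; exists (fset_set (in_edges v)).
  move=> e; rewrite -[LHS]/(e \in fset_set (in_edges v)) in_fset_set //.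
  apply/idP/eqP; first by rewrite inE.
  by move=> <-; rewrite inE.
by rewrite /range_sum fsbig_finite // path_sum.
Qed.

(** A path with source v0 and range v different from v0 has a first edge. *)
Lemma path_ck v : reg F v -> v != v0 -> path_p v = range_sum path_s v.
Proof.
move=> [fv _] vv0; have [r rv ->] := path_range_sum fv.
apply: pelt_eq => -[|e l] /=; first by rewrite eq_sym (negbTE vv0).
by rewrite rv.
Qed.

(** The path v0 of length zero is not of the form e l, so the projection onto it
    tells the two sides apart. *)
Lemma path_gap : finite_set (in_edges v0) -> path_p v0 <> range_sum path_s v0.
Proof.
move=> fv; have [r rv ->] := path_range_sum fv.
pose Q := pelt (pid (fun l : seq (edge F) => l == [::])).
move=> /(congr1 (fun x => Q ** x)).
rewrite [RHS]pelt_eq0_M => [|l /=]; last by case: eqP => [->|].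
rewrite (@peltM _ _ _ _ _ (pid (fun l => l == [::]))) => [|l /=].
  by move=> /pelt_eq0/(_ [::]).
by case: eqP => [->|] //=; rewrite eqxx.
Qed.

Definition no_ck_graph : relgraph := RelGraph (sub0set (reg F)).

Lemma path_family : @toeplitz_family R no_ck_graph _ path_p path_s.
Proof.
split=> //.
- by move=> v; exact: pid_pelt_proj.
- move=> v w vw; apply: pelt_eq0_M => l /=; case: ifP => //= /andP[-> /eqP ->].
  by case: eqP.
- move=> e; rewrite path_s_range; apply: peltM => -[|f l] //=.
  rewrite inE; case: (eqVneq f e) => [->|_] /=; last by rewrite andbF.
  by rewrite andbT; case: ifP => //= el; rewrite eqxx el.
- exact: path_s_source.
- move=> e f ef; rewrite pelt_star; apply: pelt_eq0_M => l /=.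
  by rewrite /edge_inv; case: ifP => //= _; case: eqP.
- move=> e; apply: peltM => -[|f l] /=; first by case: ifP.
  case: (eqVneq f e) => [->|fe] /=; last by case: ifP => //= _; rewrite (negbTE fe).
  by rewrite eqxx andbT; case: ifP => //= el; rewrite eqxx el.
Qed.

End PathRepresentation.
(** * The C*-algebra of complex numbers *)

Section ComplexAlgebra.
Variable R : realType.
Implicit Types (c d : R[i]).

Lemma real_cauchy_lim (u : nat -> R) :
  (forall e : R, 0 < e -> exists N, forall m n, (N <= m)%N -> (N <= n)%N ->
     `|u m - u n| < e) ->
  exists l, forall e : R, 0 < e -> exists N, forall n, (N <= n)%N -> `|u n - l| < e.
Proof.
move=> uC; have : cvg (u @ \oo).
  apply/cauchy_cvgP/cauchy_exP => e /uC[N uN].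
  by exists (u N); exists N => // n /= Nn; exact: uN.
move=> /cvg_ex[l /cvgrPdist_lt ul]; exists l => e /ul[N _ HN].
by exists N => n /HN /=; rewrite distrC.
Qed.

Lemma complex_complete (u : nat -> R[i]^o) :
    (forall e : R, 0 < e -> exists N, forall m n, (N <= m)%N -> (N <= n)%N ->
      absc (u m - u n) < e) ->
    exists l, forall e : R, 0 < e -> exists N, forall n, (N <= n)%N ->
      absc (u n - l) < e.
Proof.
move=> uC.
have [|a ua] := @real_cauchy_lim (fun n => complex.Re (u n)).
  move=> e /uC[N HN]; exists N => m n Nm Nn; apply: le_lt_trans (HN m n Nm Nn).
  by rewrite -(raddfB (@complex.Re R)) absc_Re.
have [|b ub] := @real_cauchy_lim (fun n => complex.Im (u n)).
  move=> e /uC[N HN]; exists N => m n Nm Nn; apply: le_lt_trans (HN m n Nm Nn).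
  by rewrite -(raddfB (@complex.Im R)) absc_Im.
exists (a +i* b)%C => e e0; have e2 : 0 < e / 2 by rewrite divr_gt0.
have [N HN] := ua _ e2; have [M HM] := ub _ e2.
exists (maxn N M) => n; rewrite geq_max => /andP[/HN na /HM nb].
apply: le_lt_trans (absc_le _) _.
rewrite (raddfB (@complex.Re R)) (raddfB (@complex.Im R)) /=; lra.
Qed.

(** The complex numbers serve as a test object: homomorphisms out of them pick
    projections. *)
Definition complex_seminorm : cstar_seminorm R[i]^o.
Proof.
refine (@CStarSeminorm R R[i]^o (fun c d => c * d) (fun c => c^*) (@absc R)
  _ _ _ _ _ _ _ _ _ _ _ _ _ _ complex_complete).
- exact: mulrA.
- exact: mulrDl.
- exact: mulrDr.
- by move=> c x y; exact/esym/mulrA.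
- by move=> c x y; exact: mulrCA.
- exact: conjCK.
- by move=> x y; rewrite rmorphD.
- by move=> c x; rewrite -[RHS]/(c^* * x^*) -rmorphM.
- by move=> x y; rewrite rmorphM mulrC.
- exact: abscD.
- by move=> c x; rewrite -[c *: x]/(c * x) abscM.
- by move=> x y; rewrite abscM.
- by move=> x; rewrite absc_conj.
- by move=> x; rewrite abscM absc_conj expr2.
Defined.

Definition complex_alg : cstarAlgType R := squot complex_seminorm.

Lemma complex_sreprK c : srepr (spi complex_seminorm c) = c.
Proof.
by apply/eqP; rewrite -subr_eq0; apply/eqP/absc_eq0; exact: (snorm_srepr complex_seminorm).
Qed.

Lemma projection_hom (B : cstarAlgType R) (P : B) :
  P ** P = P -> star P = P ->
  star_hom (fun q : complex_alg => (srepr q : R[i]) *: P).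
Proof.
move=> PP Ps; split.
- elim/spiW=> x; elim/spiW=> y.
  by rewrite -(spiD complex_seminorm) !complex_sreprK scalerDl.
- move=> c; elim/spiW=> x.
  by rewrite -(spiZ complex_seminorm) !complex_sreprK scalerA.
- elim/spiW=> x; elim/spiW=> y.
  by rewrite -(spiM complex_seminorm) !complex_sreprK cmulZl cmulZr scalerA PP.
- elim/spiW=> x.
  by rewrite -(spi_star complex_seminorm) !complex_sreprK starZ Ps.
Qed.

End ComplexAlgebra.
(** * Canonical maps and their kernels *)

Section Annihilators.
Variables (R : realType) (A : cstarAlgType R).
Implicit Types (x y z a : A) (S J : set A).

Lemma closed_annl a : closed [set x | a ** x = 0].
Proof.
apply/closed_approx => x ax; apply/nrm0_eq0/small_eq0; first exact: nrm_ge0.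
move=> e e0; have a1 : 0 < nrm a + 1 by rewrite ltr_pwDr // nrm_ge0.
have [|y ay xy] := ax (e / (nrm a + 1)); first by rewrite divr_gt0.
have -> : a ** x = a ** (x - y) by rewrite cmulBr ay subr0.
apply: le_lt_trans (nrmM _ _) _; move: xy; rewrite ltr_pdivlMr //.
by have := nrm_ge0 (x - y); lra.
Qed.

Lemma closed_annr a : closed [set x | x ** a = 0].
Proof.
have := @closed_annl (star a); move=> /closed_approx ca; apply/closed_approx => x xa.
have /(congr1 (@star R A)) : star a ** star x = 0.
  apply: ca => e /xa[y ya xy]; exists (star y); rewrite -?starB ?nrm_star //=.
  by rewrite -starM ya star0.
by rewrite starM !starK star0.
Qed.

Lemma closed_preimage_mull z S : closed S -> closed [set x | S (z ** x)].
Proof.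
move=> /closed_approx cS; apply/closed_approx => x Sx; apply: cS => e e0.
have a1 : 0 < nrm z + 1 by rewrite ltr_pwDr // nrm_ge0.
have [|y Sy xy] := Sx (e / (nrm z + 1)); first by rewrite divr_gt0.
exists (z ** y) => //; rewrite -cmulBr.
apply: le_lt_trans (nrmM _ _) _; move: xy; rewrite ltr_pdivlMr //.
by have := nrm_ge0 (x - y); lra.
Qed.

Lemma ker_closed_ideal (B : cstarAlgType R) (f : A -> B) :
  star_hom f -> closed_ideal [set x | f x = 0].
Proof.
move=> fh; split.
- exact: star_hom0.
- by move=> x y /= fx fy; rewrite (star_homD fh) fx fy addr0.
- by move=> c x /= fx; rewrite (star_homZ fh) fx scaler0.
- by move=> a x /= fx; rewrite (star_homM fh) fx cmul0r.
- by move=> a x /= fx; rewrite (star_homM fh) fx cmul0l.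
- exact: closed_ker.
Qed.

Lemma closed_ideal_genP X : closed_ideal (closed_ideal_gen X : set A).
Proof.
split.
- by move=> J [HJ _]; exact: (ideal0 HJ).
- by move=> x y Jx Jy J [HJ XJ]; apply: (idealD HJ); [exact: Jx|exact: Jy].
- by move=> c x Jx J [HJ XJ]; apply: (idealZ HJ); exact: Jx.
- by move=> a x Jx J [HJ XJ]; apply: (idealMl HJ); exact: Jx.
- by move=> a x Jx J [HJ XJ]; apply: (Defs.idealMr HJ); exact: Jx.
- by apply: closed_bigI => J [HJ _]; exact: (ideal_closed HJ).
Qed.

Lemma sub_closed_ideal_gen (X : set A) : X `<=` closed_ideal_gen X.
Proof. by move=> x Xx J [_]; apply. Qed.

Lemma closed_ideal_gen_min (X : set A) J :
  closed_ideal J -> X `<=` J -> closed_ideal_gen X `<=` J.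
Proof. by move=> HJ XJ x; apply. Qed.

Lemma star_hom_comp (B C : cstarAlgType R) (f : A -> B) (g : B -> C) :
  star_hom f -> star_hom g -> star_hom (g \o f).
Proof.
move=> fh gh; split=> /= [x y|c x|x y|x].
- by rewrite (star_homD fh) (star_homD gh).
- by rewrite (star_homZ fh) (star_homZ gh).
- by rewrite (star_homM fh) (star_homM gh).
- by rewrite (star_hom_star fh) (star_hom_star gh).
Qed.

End Annihilators.

Section ToeplitzFamilies.
Variables (R : realType) (E : relgraph) (D : cstarAlgType R).
Variables (p : vert E -> D) (s : edge E -> D).
Hypothesis ps : toeplitz_family p s.

Lemma tf_pp v w : p v ** p w = if v == w then p v else 0.
Proof.
case: eqP => [->|vw]; first exact: (tf_proj ps w).1.
exact: (tf_orth ps).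
Qed.

Lemma tf_ps v e : p v ** s e = if v == rng e then s e else 0.
Proof.
rewrite -{1}(tf_rng ps e) cmulA tf_pp; case: eqP => [->|_].
  exact: (tf_rng ps).
by rewrite cmul0l.
Qed.

Lemma tf_s_src e : s e ** p (src e) = s e.
Proof. by rewrite -(tf_src ps) cmulA (tf_piso ps). Qed.

Lemma tf_sp v e : s e ** p v = if v == src e then s e else 0.
Proof.
rewrite -{1}(tf_s_src e) -cmulA tf_pp [src e == v]eq_sym; case: eqP => _.
  exact: tf_s_src.
by rewrite cmul0r.
Qed.

Lemma tf_star_p v : star (p v) = p v. Proof. exact: (tf_proj ps v).2. Qed.

Lemma tf_sstar_p e v : star (s e) ** p v = if v == rng e then star (s e) else 0.
Proof.
by rewrite -{1}(tf_star_p v) -starM tf_ps; case: eqP; rewrite ?star0.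
Qed.

Lemma tf_p_sstar e v : p v ** star (s e) = if v == src e then star (s e) else 0.
Proof.
by rewrite -{1}(tf_star_p v) -starM tf_sp; case: eqP; rewrite ?star0.
Qed.

Lemma tf_ss e f : star (s e) ** s f = if e == f then p (src f) else 0.
Proof.
by case: eqP => [->|ef]; [exact: (tf_src ps)|exact: (tf_perp ps)].
Qed.

End ToeplitzFamilies.

Section Bigops.
Variables (R : realType) (D : cstarAlgType R) (I : Type) (r : seq I) (F : I -> D).

Lemma cmul_suml x : (\sum_(i <- r) F i) ** x = \sum_(i <- r) (F i ** x).
Proof.
by elim/big_rec2: _ => [|i y z _ <-]; rewrite ?cmul0l // cmulDl.
Qed.

Lemma cmul_sumr x : x ** (\sum_(i <- r) F i) = \sum_(i <- r) (x ** F i).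
Proof.
by elim/big_rec2: _ => [|i y z _ <-]; rewrite ?cmul0r // cmulDr.
Qed.

Lemma star_sum : star (\sum_(i <- r) F i) = \sum_(i <- r) star (F i).
Proof. by elim/big_rec2: _ => [|i y z _ <-]; rewrite ?star0 // starD. Qed.

Lemma star_hom_sum (B : cstarAlgType R) (f : D -> B) : star_hom f ->
  f (\sum_(i <- r) F i) = \sum_(i <- r) f (F i).
Proof.
move=> fh; elim/big_rec2: _ => [|i y z _ <-]; first exact: star_hom0.
by rewrite (star_homD fh).
Qed.

End Bigops.

Definition in_seq (F : digraph) (v : vert F) : seq (edge F) :=
  enum_fset (fset_set (in_edges v)).

Lemma mem_in_seq (F : digraph) (v : vert F) e :
  finite_set (in_edges v) -> (e \in in_seq v) = (rng e == v).
Proof.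
move=> fv; rewrite -[LHS]/(e \in fset_set (in_edges v)) in_fset_set //.
by apply/idP/eqP => [|<-]; rewrite inE.
Qed.

Lemma uniq_in_seq (F : digraph) (v : vert F) : uniq (in_seq v).
Proof. exact: fset_uniq. Qed.

Lemma range_sumE (R : realType) (F : digraph) (D : cstarAlgType R)
    (s : edge F -> D) v : finite_set (in_edges v) ->
  range_sum s v = \sum_(e <- in_seq v) (s e ** star (s e)).
Proof. by move=> fv; rewrite /range_sum fsbig_finite. Qed.

Lemma range_sum_hom (R : realType) (F : digraph) (D B : cstarAlgType R)
    (f : D -> B) (s : edge F -> D) v : star_hom f -> finite_set (in_edges v) ->
  f (range_sum s v) = range_sum (f \o s) v.
Proof.
move=> fh fv; rewrite !range_sumE // (star_hom_sum _ _ fh).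
by apply: eq_bigr => e _; rewrite (star_homM fh) (star_hom_star fh).
Qed.

(** Edges of E outside F contribute nothing to a range sum at a vertex of F
    when their partial isometries vanish. *)
Lemma range_sum_embed (R : realType) (F E : digraph) (i : gemb F E)
    (D : cstarAlgType R) (s : edge E -> D) v :
  (forall e, rng e = gv i v -> ~ geset i e -> s e = 0) ->
  range_sum s (gv i v) = range_sum (s \o ge i) v.
Proof.
move=> s0; rewrite /range_sum.
rewrite -(fsbig_widen (ge i @` in_edges v) (in_edges (gv i v))); first last.
- move=> e [/= ev eF]; rewrite /= s0 ?cmul0l // => -[e' _ e'E].
  by apply: eF; exists e' => //; apply: (@gv_inj _ _ i); rewrite -ge_rng e'E.
- by move=> _ [e ev <-]; rewrite /in_edges /= ge_rng ev.
by rewrite fsbig_image // => e e' _ _; exact: ge_inj.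
Qed.

Section GapProjections.
Variables (R : realType) (F E : relgraph) (i : gemb F E) (D : cstarAlgType R).
Variables (p : vert E -> D) (s : edge E -> D).
Hypothesis ps : toeplitz_family p s.
Variables (v : vert F).
Hypothesis fv : finite_set (in_edges v).

(** The gap projection of v relative to F; with the vertex projections outside
    F these elements generate the ideal J(E,A;F,B). *)
Definition gap : D := p (gv i v) - range_sum (s \o ge i) v.

Let rs := range_sumE (s \o ge i) fv.

Lemma sum_in_seq_ss (f : edge E) :
  (range_sum (s \o ge i) v) ** s f =
  if `[< exists2 e, rng e = v & ge i e = f >] then s f else 0.
Proof.
rewrite rs cmul_suml; case: asboolP => [[e ev <-]|ef].
  rewrite (bigD1_seq e) ?uniq_in_seq ?mem_in_seq ?ev //= big1 => [|e' e'e].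
    by rewrite addr0 -cmulA (tf_src ps) (tf_s_src ps).
  rewrite -cmulA (tf_perp ps) ?cmul0r // => /ge_inj ee'.
  by rewrite ee' eqxx in e'e.
rewrite big_seq big1 // => e; rewrite mem_in_seq // => /eqP ev.
rewrite -cmulA (tf_perp ps) ?cmul0r // => eif; apply: ef.
by exists e.
Qed.

Lemma gap_s_in e : rng e = v -> gap ** s (ge i e) = 0.
Proof.
move=> ev; rewrite cmulBl (tf_ps ps) sum_in_seq_ss ge_rng ev eqxx.
by rewrite asboolT ?subrr //; exists e.
Qed.

Lemma gap_s_rng f : rng f <> gv i v -> gap ** s f = 0.
Proof.
move=> fv'; rewrite cmulBl (tf_ps ps) sum_in_seq_ss asboolF.
  by case: eqP => [vf|_]; [case: fv'|rewrite subrr].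
by move=> [e ev ef]; apply: fv'; rewrite -ef ge_rng ev.
Qed.

Lemma gap_star : star gap = gap.
Proof.
rewrite /gap starB (tf_star_p ps) rs star_sum; congr (_ - _).
by apply: eq_bigr => e _; rewrite starM starK.
Qed.

Lemma p_gap w : p w ** gap = if w == gv i v then gap else 0.
Proof.
rewrite cmulBr (tf_pp ps) rs cmul_sumr.
have -> : \sum_(e <- in_seq v) p w ** ((s \o ge i) e ** star ((s \o ge i) e)) =
    if w == gv i v then range_sum (s \o ge i) v else 0.
  rewrite rs big_seq; case: eqP => [->|wv].
    rewrite [RHS]big_seq; apply: eq_bigr => e; rewrite mem_in_seq // => /eqP ev.
    by rewrite cmulA /= (tf_ps ps) ge_rng ev eqxx.
  rewrite big1 // => e; rewrite mem_in_seq // => /eqP ev.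
  rewrite cmulA /= (tf_ps ps) ge_rng ev; case: eqP => // _.
  by rewrite cmul0l.
by case: eqP => [->|_]; rewrite ?subr0.
Qed.

Lemma gap_p w : gap ** p w = if w == gv i v then gap else 0.
Proof.
rewrite -[LHS]starK starM gap_star (tf_star_p ps) p_gap.
by case: eqP; rewrite ?gap_star ?star0.
Qed.

Lemma sstar_gap_in e : rng e = v -> star (s (ge i e)) ** gap = 0.
Proof. by move=> ev; rewrite -[LHS]starK starM gap_star starK gap_s_in ?star0. Qed.

Lemma gap_s_out f : rng f = gv i v -> ~ geset i f -> gap ** s f = s f.
Proof.
move=> fv' fF; rewrite cmulBl (tf_ps ps) sum_in_seq_ss fv' eqxx asboolF ?subr0 //.
by move=> [e _ ef]; apply: fF; exists e.
Qed.

Lemma sstar_gap_out f : rng f = gv i v -> ~ geset i f ->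
  star (s f) ** gap = star (s f).
Proof. by move=> fv' fF; rewrite -[LHS]starK starM gap_star starK gap_s_out. Qed.

Lemma sstar_gap_rng f : rng f <> gv i v -> star (s f) ** gap = 0.
Proof. by move=> fv'; rewrite -[LHS]starK starM gap_star starK gap_s_rng ?star0. Qed.

Lemma gap_idem : gap ** gap = gap.
Proof.
rewrite [X in _ ** X]/gap cmulBr gap_p eqxx rs cmul_sumr big_seq big1 ?subr0 //.
move=> e; rewrite mem_in_seq // => /eqP ev.
by rewrite cmulA /= gap_s_in // cmul0l.
Qed.

End GapProjections.

Section CanonicalMaps.
Variables (R : realType) (F E : relgraph) (m : relmor F E).
Variables (T : TCstar R E) (T' : TCstar R F) (f : T -> T').
Hypothesis cf : canonical_map m f.

Definition rel_gens (B : set (vert F)) : set T :=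
  [set tc_p T v | v in ~` gvset m] `|`
  [set gap m (tc_p T) (tc_s T) v | v in B `\` gv m @^-1` rg_set E].

Lemma rel_idealE B : rel_ideal T m B = closed_ideal_gen (rel_gens B).
Proof. by []. Qed.

Lemma relmor_full e : gvset m (rng e) -> gvset m (src e) -> geset m e.
Proof. by move=> re se; rewrite (rm_full m). Qed.

(** If the range of e is in F then fullness keeps the source out of F, and
    otherwise heredity does. *)
Lemma relmor_edge e : ~ geset m e -> ~ gvset m (src e).
Proof.
move=> em sm; have [rm|rm] := pselect (gvset m (rng e)).
  exact: em (relmor_full rm sm).
exact: rm_hereditary rm sm.
Qed.

Lemma canonical_gens : rel_gens (rg_set F) `<=` [set x | f x = 0].
Proof.
move=> _ [[v vF <-]|[v [vB _] <-]] /=; first exact: (cm_p0 cf).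
have fv : finite_set (in_edges v) by case: (rg_set_reg vB).
rewrite (star_homB _ _ (cm_hom cf)) (cm_p cf) (range_sum_hom _ (cm_hom cf)) //.
apply/eqP; rewrite subr_eq0; apply/eqP; rewrite (tf_ck (tc_family T') vB).
by congr range_sum; apply/funext => e /=; rewrite (cm_s cf).
Qed.

Section Factor.
Variables (J : set T) (HJ : closed_ideal J).
Hypothesis gJ : rel_gens (rg_set F) `<=` J.

Let q := @ideal_proj R T J HJ.
Let qh : star_hom q := ideal_proj_hom HJ.

Let q_p v : ~ gvset m v -> q (tc_p T v) = 0.
Proof. by move=> vF; apply/ideal_proj_ker/gJ; left; exists v. Qed.

Let q_s e : ~ geset m e -> q (tc_s T e) = 0.
Proof.
move=> eF; rewrite -(tf_s_src (tc_family T)) (star_homM qh) q_p ?cmul0r //.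
exact: relmor_edge.
Qed.

(** At a vertex of B the relation holds in the quotient for one of two reasons:
    either it comes from the relation of E, whose surplus edges have source
    outside F and vanish, or the gap is one of the generators. *)
Lemma quotient_family :
  toeplitz_family (fun v => q (tc_p T (gv m v))) (fun e => q (tc_s T (ge m e))).
Proof.
have fT := tc_family T; split.
- move=> v; rewrite -(star_homM qh) -(star_hom_star qh).
  by have [-> ->] := tf_proj fT (gv m v).
- move=> v w vw; rewrite -(star_homM qh) (tf_orth fT) ?star_hom0 //.
  by move=> /gv_inj.
- move=> e; rewrite -(star_hom_star qh) -!(star_homM qh).
  by rewrite (tf_piso fT).
- by move=> e; rewrite -(star_hom_star qh) -(star_homM qh) (tf_src fT) ge_src.
- move=> e e' ee'; rewrite -(star_hom_star qh) -(star_homM qh) (tf_perp fT).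
    exact: star_hom0.
  by move=> /ge_inj.
- by move=> e; rewrite -ge_rng -(star_homM qh) (tf_rng fT).
move=> v vB; have fv : finite_set (in_edges v) by case: (rg_set_reg vB).
have -> : range_sum (fun e => q (tc_s T (ge m e))) v =
    q (range_sum (tc_s T \o ge m) v) by rewrite (range_sum_hom _ qh).
apply/eqP; rewrite -subr_eq0 -(star_homB _ _ qh); apply/eqP.
have [vA|vA] := pselect (rg_set E (gv m v)); last first.
  by apply/ideal_proj_ker/gJ; right; exists v.
rewrite (star_homB _ _ qh) (tf_ck fT vA) !(range_sum_hom _ qh) //; last first.
  by case: (rg_set_reg vA).
rewrite range_sum_embed ?subrr // => e _ eF; exact: q_s.
Qed.

(** The quotient carries a family for F, so the universal property factors the
    quotient map through f; therefore the kernel of f lies in J. *)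
Lemma canonical_factor : exists th : T' -> ideal_quotient HJ,
  star_hom th /\ forall x, th (f x) = q x.
Proof.
have [th [th_h th_p th_s]] := tc_universal T' quotient_family.
exists th; split=> // x.
refine (eq_on_generators (star_hom_comp (cm_hom cf) th_h) qh (@tc_generated _ _ T) _ x).
move=> _ [[v _ <-]|[e _ <-]] /=.
  have [[v' _ <-]|vF] := pselect (gvset m v).
    by rewrite (cm_p cf) th_p.
  by rewrite (cm_p0 cf) // q_p // star_hom0.
have [[e' _ <-]|eF] := pselect (geset m e).
  by rewrite (cm_s cf) th_s.
by rewrite (cm_s0 cf) // q_s // star_hom0.
Qed.

Lemma canonical_ker_sub x : f x = 0 -> J x.
Proof.
move=> fx; have [th [th_h thf]] := canonical_factor.
by apply/(ideal_proj_ker HJ); rewrite -/(q x) -thf fx star_hom0.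
Qed.

End Factor.

Lemma canonical_ker x : f x = 0 <-> rel_ideal T m (rg_set F) x.
Proof.
rewrite rel_idealE; split.
  by apply: canonical_ker_sub; [exact: closed_ideal_genP|exact: sub_closed_ideal_gen].
by apply: closed_ideal_gen_min canonical_gens _; exact: ker_closed_ideal (cm_hom cf).
Qed.

(** The map induced by f on the quotient by its kernel has a right inverse, given
    by the universal property: the composite fixes the generators. *)
Lemma canonical_surj y : exists x, f x = y.
Proof.
have HJ := ker_closed_ideal (cm_hom cf).
have [th [th_h thf]] := canonical_factor HJ canonical_gens.
pose phi (q : ideal_quotient HJ) : T' := f (srepr q).
have phiE x : phi (ideal_proj HJ x) = f x.
  apply/eqP; rewrite -subr_eq0 -(star_homB _ _ (cm_hom cf)); apply/eqP.
  by apply/(qdist_eq0 HJ); exact: (snorm_srepr (ideal_seminorm HJ)).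
have fh := cm_hom cf; have qh := ideal_proj_hom HJ.
have phih : star_hom phi.
  split=> [q r|c q|q r|q].
  - have [x <-] := ideal_proj_surj q; have [z <-] := ideal_proj_surj r.
    by rewrite -(star_homD qh) !phiE (star_homD fh).
  - have [x <-] := ideal_proj_surj q.
    by rewrite -(star_homZ qh) !phiE (star_homZ fh).
  - have [x <-] := ideal_proj_surj q; have [z <-] := ideal_proj_surj r.
    by rewrite -(star_homM qh) !phiE (star_homM fh).
  - have [x <-] := ideal_proj_surj q.
    by rewrite -(star_hom_star qh) !phiE (star_hom_star fh).
have idh : star_hom (@id T') by [].
exists (srepr (th y)); rewrite -/(phi (th y)).
refine (eq_on_generators (star_hom_comp th_h phih) idh (@tc_generated _ _ T') _ y).
move=> _ [[v _ <-]|[e _ <-]] /=.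
  by rewrite -(cm_p cf) thf phiE.
by rewrite -(cm_s cf) thf phiE.
Qed.

End CanonicalMaps.
(** * Orthogonality of the two kernels over a pushout *)

Section LeftInvariance.
Variables (R : realType) (F E : relgraph) (m : relmor F E) (T : TCstar R E).
Variable B : set (vert F).
Hypothesis finB : forall v, B v -> finite_set (in_edges v).
Implicit Types (l : seq (edge E)) (g x y t : T).
Local Notation p := (tc_p T).
Local Notation s := (tc_s T).
Local Notation X := (@rel_gens R F E m T B).
Let fT : toeplitz_family p s := tc_family T.

(** The product g s_(e_n)^* .. s_(e_1)^* for the word e_1 .. e_n, which need not
    be a path. Such products are stable under right multiplication by adjoints,
    and that makes their right annihilator a left ideal. *)
Fixpoint word_mul l g : T :=
  if l is e :: l' then word_mul l' g ** star (s e) else g.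

Definition word_ann y : Prop := forall l g, X g -> word_mul l g ** y = 0.

Lemma gens_p g w : X g -> g ** p w = g \/ g ** p w = 0.
Proof.
case=> [[v vF <-]|[v [vB _] <-]].
  by rewrite (tf_pp fT); case: eqP => _; [left|right].
by rewrite (gap_p _ fT (finB vB)); case: eqP => _; [left|right].
Qed.

Lemma word_p l g w : X g -> word_mul l g ** p w = word_mul l g \/ word_mul l g ** p w = 0.
Proof.
case: l => [|e l] Xg; first exact: gens_p.
rewrite /= -cmulA (tf_sstar_p fT); case: eqP => _; [left|right] => //.
by rewrite cmul0r.
Qed.

Lemma word_ann_p y w : word_ann y -> word_ann (p w ** y).
Proof.
move=> Qy l g Xg; rewrite cmulA; case: (@word_p l g w Xg) => ->; last exact: cmul0l.
exact: Qy.
Qed.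

Lemma word_ann_sstar y e : word_ann y -> word_ann (star (s e) ** y).
Proof. by move=> Qy l g Xg; rewrite cmulA; exact: (Qy (e :: l)). Qed.

(** For a word with at least one letter, the relations for s_e^* s_f apply. For
    the empty word, g s_f vanishes if the source of f is in F, and otherwise
    s_f y = s_f p_(src f) y = 0, because p_(src f) is itself a generator. *)
Lemma word_ann_s y f : word_ann y -> word_ann (s f ** y).
Proof.
move=> Qy.
have out : ~ gvset m (src f) -> s f ** y = 0.
  move=> fF; rewrite -(tf_s_src fT) -cmulA (Qy [::] (p (src f))) ?cmul0r //.
  by left; exists (src f).
move=> [|e l] g Xg /=.
  have [fF|fF] := pselect (gvset m (src f)); last by rewrite out // cmul0r.
  rewrite cmulA; suff -> : g ** s f = 0 by rewrite cmul0l.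
  have fm : geset m f by apply: contrapT => /relmor_edge.
  case: fm => f' _ f'E; case: Xg => [[v vF <-]|[v [vB _] <-]].
    rewrite (tf_ps fT); case: eqP => // vf; case: vF.
    by rewrite vf -f'E ge_rng; exists (rng f').
  have [vf|vf] := eqVneq (rng f') v.
    by rewrite -f'E (gap_s_in _ fT (finB vB)).
  apply: (gap_s_rng fT (finB vB)); rewrite -f'E ge_rng => /gv_inj.
  exact/eqP.
rewrite -cmulA (cmulA (star (s e))) (tf_ss fT); case: eqP => _.
  exact: word_ann_p.
by rewrite cmul0l cmul0r.
Qed.

(** The elements t such that t and t^* preserve the annihilator form a C*-subalgebra
    that contains the generators of TC^*(E,A). *)
Lemma word_ann_left t y : word_ann y -> word_ann (t ** y).
Proof.
pose S : set T := [set t | forall y, word_ann y ->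
  word_ann (t ** y) /\ word_ann (star t ** y)].
suff ST : S = setT.
  have St : S t by rewrite ST.
  by move=> Qy; have [] := St y Qy.
move=> {y}; apply: (@tc_generated _ _ T).
  have annD y z : word_ann y -> word_ann z -> word_ann (y + z).
    by move=> Qy Qz l g Xg; rewrite cmulDr Qy // Qz // addr0.
  have annZ c y : word_ann y -> word_ann (c *: y).
    by move=> Qy l g Xg; rewrite cmulZr Qy // scaler0.
  split.
  - by move=> y Qy; split=> l g Xg; rewrite ?star0 cmul0l cmul0r.
  - move=> u v Su Sv y Qy; have [Qu Qu'] := Su y Qy; have [Qv Qv'] := Sv y Qy.
    by split; rewrite ?starD cmulDl; exact: annD.
  - move=> c u Su y Qy; have [Qu Qu'] := Su y Qy.
    by split; rewrite ?starZ cmulZl; exact: annZ.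
  - move=> u v Su Sv y Qy; split.
      by rewrite -cmulA; apply: (Su _ _).1; exact: (Sv _ _).1.
    by rewrite starM -cmulA; apply: (Sv _ _).2; exact: (Su _ _).2.
  - by move=> u Su y Qy; rewrite starK; have [] := Su y Qy.
  apply/closed_approx => u Su y Qy.
  split=> l g Xg; rewrite cmulA.
    apply: ((closed_approx [set t | word_mul l g ** t ** y = 0]).1 _ u).
      rewrite (_ : [set t | _] = [set t | [set z | z ** y = 0] (word_mul l g ** t)]) //.
      by apply: closed_preimage_mull; exact: closed_annr.
    move=> e /Su[v Sv uv]; exists v => //=.
    by rewrite -cmulA; exact: (Sv y Qy).1.
  apply: ((closed_approx [set t | word_mul l g ** t ** y = 0]).1 _ (star u)).
    rewrite (_ : [set t | _] = [set t | [set z | z ** y = 0] (word_mul l g ** t)]) //.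
    by apply: closed_preimage_mull; exact: closed_annr.
  move=> e /Su[v Sv uv]; exists (star v); last by rewrite -starB nrm_star.
  by rewrite /= -cmulA; exact: (Sv y Qy).2.
move=> _ [[v _ <-]|[e _ <-]] y Qy.
  by rewrite (tf_star_p fT); split; exact: word_ann_p.
by split; [exact: word_ann_s|exact: word_ann_sstar].
Qed.

End LeftInvariance.

Section Pushout.
Variables (F0 F1 F2 E : relgraph) (a1 : relmor F0 F1) (a2 : relmor F0 F2).
Variables (i1 : gemb F1 E) (i2 : gemb F2 E).
Hypothesis HE : is_pushout a1 a2 i1 i2.

Lemma pushout_both v1 v2 : gv i1 v1 = gv i2 v2 ->
  exists v0, gv a1 v0 = v1 /\ gv a2 v0 = v2.
Proof.
move=> vv; have : (gvset i1 `&` gvset i2) (gv i1 v1).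
  by split; [exists v1|exists v2].
rewrite (po_interv HE) => -[v0 _ v0E]; exists v0.
split; first by apply: (@gv_inj _ _ i1); exact: v0E.
by apply: (@gv_inj _ _ i2); rewrite -(po_commv HE) -vv.
Qed.

Lemma pushout_edge_cases (e : edge E) : geset i1 e \/ geset i2 e.
Proof. by have : [set: edge E] e by []; rewrite -(po_unione HE). Qed.

Lemma pushout_vert_cases (v : vert E) : gvset i1 v \/ gvset i2 v.
Proof. by have : [set: vert E] v by []; rewrite -(po_unionv HE). Qed.

(** An edge with range outside F1 comes from F2, where the complement of F0 is
    hereditary. *)
Lemma pushout_hereditary : hereditary (~` gvset i1).
Proof.
move=> e re [v1 _ v1E].
case: (pushout_edge_cases e) => -[e' _ e'E]; rewrite -e'E in re v1E.
  by apply: re; rewrite ge_rng; exists (rng e').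
rewrite ge_src in v1E; have [v0 [v01 v02]] := pushout_both v1E.
have [r2|r2] := pselect (gvset a2 (rng e')).
  case: r2 => w0 _ w0E; apply: re; rewrite ge_rng -w0E -(po_commv HE).
  by exists (gv a1 w0).
by have /= := rm_hereditary r2; apply; rewrite -v02; exists v0.
Qed.

Lemma pushout_full :
  geset i1 = [set e | gvset i1 (rng e) /\ gvset i1 (src e)].
Proof.
apply/seteqP; split=> [_ [e _ <-]|e [[v _ vE] [w _ wE]]].
  by rewrite /= ge_rng ge_src; split; [exists (rng e)|exists (src e)].
case: (pushout_edge_cases e) => // -[e' _ e'E]; move: vE wE.
rewrite -e'E ge_rng ge_src => /pushout_both[v0 [_ v02]] /pushout_both[w0 [_ w02]].
have : geset a2 e' by apply: relmor_full; [exists v0|exists w0].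
by move=> [e0 _ e0E]; exists (ge a1 e0) => //; rewrite (po_comme HE) e0E.
Qed.

Lemma pushout_set : gv i1 @^-1` rg_set E `<=` rg_set F1.
Proof.
move=> v1; rewrite /= (po_set HE) => -[[[[w Bw /gv_inj <-] _]//|[[v2 Bv v2E] nv]]|].
  have [v0 [v01 v02]] := pushout_both (esym v2E).
  by case: nv; exists v0 => //=; rewrite v01.
by move=> [[w Bw /gv_inj <-]].
Qed.

Definition pushout_relmor : relmor F1 E :=
  RelMor pushout_hereditary pushout_full pushout_set.

Lemma pushout_sym : is_pushout a2 a1 i2 i1.
Proof.
have V : gvset (gcomp i2 a2) = gvset (gcomp i1 a1).
  by apply/seteqP; split=> _ [v _ <-]; exists v => //=; rewrite (po_commv HE).
have Ed : geset (gcomp i2 a2) = geset (gcomp i1 a1).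
  by apply/seteqP; split=> _ [v _ <-]; exists v => //=; rewrite (po_comme HE).
split.
- by move=> v; rewrite (po_commv HE).
- by move=> v; rewrite (po_comme HE).
- by rewrite setUC (po_unionv HE).
- by rewrite setUC (po_unione HE).
- by rewrite setIC (po_interv HE) V.
- by rewrite setIC (po_intere HE) Ed.
- by rewrite /= (po_set HE) V [X in X `|` _]setUC [X in _ `|` X]setIC.
Qed.

Lemma pushout_set_mem v0 :
  rg_set E (gv i1 (gv a1 v0)) <-> rg_set F1 (gv a1 v0) /\ rg_set F2 (gv a2 v0).
Proof.
rewrite (po_set HE); split.
  case=> [[[_ []]|[_ []]]|]; try by exists v0.
  move=> [[v1 B1 /gv_inj v1E] [v2 B2 v2E]]; rewrite v1E in B1; split=> //.
  by move: v2E; rewrite (po_commv HE) => /gv_inj <-.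
move=> [B1 B2]; right; split; first by exists (gv a1 v0).
by exists (gv a2 v0) => //; rewrite (po_commv HE).
Qed.

Lemma pushout_set_only v1 : rg_set F1 v1 -> ~ rg_set E (gv i1 v1) -> gvset a1 v1.
Proof.
move=> B1 nA; apply: contrapT => nv; apply: nA; rewrite (po_set HE).
left; left; split; first by exists v1.
by move=> [v0 _ v0E]; apply: nv; exists v0 => //; apply: (@gv_inj _ _ i1).
Qed.

End Pushout.

Section Orthogonality.
Variables (R : realType) (F0 F1 F2 E : relgraph).
Variables (a1 : relmor F0 F1) (a2 : relmor F0 F2).
Variables (i1 : gemb F1 E) (i2 : gemb F2 E).
Hypothesis HE : is_pushout a1 a2 i1 i2.
Variable T : TCstar R E.
Local Notation p := (tc_p T).
Local Notation s := (tc_s T).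
Let fT : toeplitz_family p s := tc_family T.
Let m1 : relmor F1 E := pushout_relmor HE.
Let m2 : relmor F2 E := pushout_relmor (pushout_sym HE).
Let X1 := @rel_gens R _ _ m1 T (rg_set F1).
Let X2 := @rel_gens R _ _ m2 T (rg_set F2).

Let fin1 v : rg_set F1 v -> finite_set (in_edges v).
Proof. by move=> /(@rg_set_reg F1)[]. Qed.

Let fin2 v : rg_set F2 v -> finite_set (in_edges v).
Proof. by move=> /(@rg_set_reg F2)[]. Qed.

(** Adjoints of edges carry a vertex outside F2 to vertices outside F2, which are
    in F1 but not in F0 and so are not met by the generators for F1. *)
Lemma word_outside l g u y : X1 g -> ~ gvset i2 u ->
  word_mul l g ** (p u ** y) = 0.
Proof.
move=> Xg; elim: l u y => [|e l IH] u y u2 /=.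
  rewrite cmulA; suff -> : g ** p u = 0 by rewrite cmul0l.
  case: Xg => [[v v1 <-]|[w [w1 wA] <-]].
    rewrite (tf_pp fT); case: eqP => // vu.
    by case: (pushout_vert_cases HE v) => // v2; case: u2; rewrite -vu.
  rewrite (gap_p _ fT (fin1 w1)); case: eqP => // uw; case: u2.
  have [w0 _ w0E] := pushout_set_only HE w1 wA.
  by rewrite uw -w0E /= (po_commv HE); exists (gv a2 w0).
rewrite -cmulA (cmulA _ (p u)) (tf_sstar_p fT); case: eqP => [eu|_].
  have -> : star (s e) = p (src e) ** star (s e).
    by rewrite (tf_p_sstar fT) eqxx.
  rewrite -cmulA; apply: IH; apply: (@rm_hereditary _ _ m2).
  by rewrite -eu.
by rewrite cmul0l cmul0r.
Qed.

(** The gap at w is annihilated by the adjoint of every edge, except those with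
    range w that are not in F2; their source is outside F2. For the empty word,
    the gaps in the two families sit at different vertices, as a common one would
    be in A. *)
Lemma word_ann_gens h : X2 h -> word_ann m1 (rg_set F1) h.
Proof.
case=> [[u u2 <-]|[w [w2 wA] <-]] l g Xg.
  rewrite -[p u](tf_proj fT u).1; exact: word_outside.
have [w0 _ w0E] := pushout_set_only (pushout_sym HE) w2 wA.
have w0E1 : gv i2 w = gv i1 (gv a1 w0) by rewrite (po_commv HE) w0E.
case: l => [|e l] /=.
  case: Xg => [[v v1 <-]|[w' [w'1 w'A] <-]].
    rewrite (p_gap _ fT (fin2 w2)); case: eqP => // vw; case: v1.
    by rewrite vw /= w0E1; exists (gv a1 w0).
  have -> : gap m2 p s w = p (gv m2 w) ** gap m2 p s w.
    by rewrite (p_gap _ fT (fin2 w2)) eqxx.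
  rewrite cmulA (gap_p _ fT (fin1 w'1)); case: eqP => [ww'|_]; last exact: cmul0l.
  case: wA; rewrite /= w0E1; apply/(pushout_set_mem HE); rewrite w0E; split=> //.
  by move: ww'; rewrite /= w0E1 => /gv_inj ->.
rewrite -cmulA; have [ew|ew] := pselect (rng e = gv m2 w); last first.
  by rewrite (sstar_gap_rng fT (fin2 w2) ew) cmul0r.
have [[e' _ e'E]|em] := pselect (geset m2 e).
  rewrite -e'E (sstar_gap_in _ fT (fin2 w2)) ?cmul0r //.
  by move: ew; rewrite -e'E ge_rng => /gv_inj.
rewrite (sstar_gap_out fT (fin2 w2) ew em).
have -> : star (s e) = p (src e) ** star (s e) by rewrite (tf_p_sstar fT) eqxx.
by apply: word_outside => //; exact: (relmor_edge em).
Qed.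

(** From generators to ideals on one side at a time, annihilators being closed. *)
Lemma ideals_orthogonal x y :
  rel_ideal T i1 (rg_set F1) x -> rel_ideal T i2 (rg_set F2) y -> x ** y = 0.
Proof.
have N2 z : rel_ideal T i2 (rg_set F2) z ->
    forall g, X1 g -> g ** z = 0 /\ forall t, g ** (t ** z) = 0.
  move=> Jz g Xg; pose N : set T := [set z | g ** z = 0 /\ forall t, g ** (t ** z) = 0].
  have HN : closed_ideal N.
    split.
    - by split=> [|t]; rewrite !cmul0r.
    - by move=> u v [u0 ut] [v0 vt]; split=> [|t]; rewrite !cmulDr ?u0 ?v0 ?ut ?vt addr0.
    - by move=> c u [u0 ut]; split=> [|t]; rewrite !cmulZr ?u0 ?ut scaler0.
    - by move=> a u [u0 ut]; split=> [|t]; rewrite ?ut // (cmulA t) ut.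
    - by move=> a u [u0 ut]; split=> [|t]; rewrite ?(cmulA t) cmulA ?u0 ?ut cmul0l.
    rewrite (_ : N = [set z | g ** z = 0] `&`
        \bigcap_(t in setT) [set z | [set w | g ** w = 0] (t ** z)]).
      apply: closedI; first exact: closed_annl.
      by apply: closed_bigI => t _; apply: closed_preimage_mull; exact: closed_annl.
    by apply/seteqP; split=> u [u0 ut]; split=> // t; [move=> _; exact: ut|exact: ut].
  apply: (closed_ideal_gen_min HN _ Jz) => h Xh; split.
    exact: (word_ann_gens Xh [::]).
  move=> t; exact: (word_ann_left fin1 t (word_ann_gens Xh) [::]).
move=> Jx Jy; pose N : set T := [set x | forall y, rel_ideal T i2 (rg_set F2) y -> x ** y = 0].
have J2 : closed_ideal (rel_ideal T i2 (rg_set F2)) by exact: closed_ideal_genP.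
have HN : closed_ideal N.
  split.
  - by move=> z _; rewrite cmul0l.
  - by move=> u v Nu Nv z Jz; rewrite cmulDl Nu // Nv // addr0.
  - by move=> c u Nu z Jz; rewrite cmulZl Nu // scaler0.
  - by move=> a u Nu z Jz; rewrite -cmulA Nu // cmul0r.
  - by move=> a u Nu z Jz; rewrite -cmulA Nu //; exact: (idealMl J2).
  rewrite (_ : N = \bigcap_(z in rel_ideal T i2 (rg_set F2)) [set u | u ** z = 0]) //.
  by apply: closed_bigI => z _; exact: closed_annr.
by apply: (closed_ideal_gen_min HN _ Jx) Jy => g Xg z /N2/(_ g Xg)[].
Qed.

End Orthogonality.
(** * The pullback square *)

Section IdealSums.
Variables (R : realType) (A : cstarAlgType R) (I J : set A).
Hypotheses (HI : closed_ideal I) (HJ : closed_ideal J).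
Hypothesis IJ : forall x y, I x -> J y -> x ** y = 0.

Definition ideal_sum : set A := [set z | exists2 x, I x & J (z - x)].

(** For x in I and y in J, x^* (x + y) = x^* x, so |x| <= |x + y|. *)
Lemma orthogonal_nrm x y : I x -> J y -> nrm x <= nrm (x + y).
Proof.
move=> Ix Jy; have sx : star x ** (x + y) = star x ** x.
  by rewrite cmulDr (IJ (ideal_star HI Ix) Jy) addr0.
have := nrmM (star x) (x + y); rewrite sx nrm_cstar nrm_star expr2.
have [->|x0] := eqVneq (nrm x) 0; first by move=> _; exact: nrm_ge0.
by rewrite ler_pM2l // lt_neqAle eq_sym x0 nrm_ge0.
Qed.

(** By the norm inequality the components in I of a convergent sequence in I + J
    form a Cauchy sequence. *)
Lemma ideal_sum_closed : closed ideal_sum.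
Proof.
apply/closed_approx => z zS.
have r0 n : 0 < (n.+1%:R^-1 : R) by rewrite invr_gt0.
pose w n := s2val (cid2 (zS _ (r0 n))).
have wS n : ideal_sum (w n) by exact: (s2valP (cid2 (zS _ (r0 n)))).
have zw n : nrm (z - w n) < n.+1%:R^-1 by exact: (s2valP' (cid2 (zS _ (r0 n)))).
pose x n := s2val (cid2 (wS n)).
have Ix n : I (x n) by exact: (s2valP (cid2 (wS n))).
have Jwx n : J (w n - x n) by exact: (s2valP' (cid2 (wS n))).
have wz : seq_lim w z.
  move=> e /harmonic_small[N HN]; exists N => n Nn.
  by rewrite nrmBC; exact: lt_trans (zw n) (HN n Nn).
have xC : cauchy_seq x.
  move=> e e0; have e2 : 0 < e / 2 by rewrite divr_gt0.
  have [N HN] := wz _ e2; exists N => m n Nm Nn.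
  have := orthogonal_nrm (idealB HI (Ix m) (Ix n)) (idealB HJ (Jwx m) (Jwx n)).
  rewrite (_ : x m - x n + _ = w m - w n); last first.
    by rewrite addrACA -opprD !subrKC.
  move=> /le_lt_trans; apply; apply: le_lt_trans (nrm_split z _ _) _.
  by rewrite [e]splitr (nrmBC z); apply: ltrD; exact: HN.
have [l xl] := cauchy_seq_lim xC; exists l.
  exact: seq_lim_closed (ideal_closed HI) Ix xl.
apply: (seq_lim_closed (ideal_closed HJ) Jwx) => e e0.
have e2 : 0 < e / 2 by rewrite divr_gt0.
have [N HN] := wz _ e2; have [M HM] := xl _ e2.
exists (maxn N M) => n; rewrite geq_max => /andP[/HN nz /HM nl].
have -> : w n - x n - (z - l) = (w n - z) - (x n - l).
  rewrite !opprB -!addrA; congr (_ + _).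
  by rewrite addrCA [RHS]addrCA [- x n - z]addrC.
by apply: le_lt_trans (nrmB _ _) _; rewrite [e]splitr; exact: ltrD.
Qed.

Lemma ideal_sum_ideal : closed_ideal ideal_sum.
Proof.
split.
- by exists 0; [exact: (ideal0 HI)|rewrite subrr; exact: (ideal0 HJ)].
- move=> u v [x Ix Jx] [y Iy Jy]; exists (x + y); first exact: (idealD HI).
  by rewrite opprD addrACA; exact: (idealD HJ).
- move=> c u [x Ix Jx]; exists (c *: x); first exact: (idealZ HI).
  by rewrite -scalerBr; exact: (idealZ HJ).
- move=> a u [x Ix Jx]; exists (a ** x); first exact: (idealMl HI).
  by rewrite -cmulBr; exact: (idealMl HJ).
- move=> a u [x Ix Jx]; exists (x ** a); first exact: (Defs.idealMr HI).
  by rewrite -cmulBl; exact: (Defs.idealMr HJ).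
exact: ideal_sum_closed.
Qed.

Lemma ideal_sum_l x : I x -> ideal_sum x.
Proof. by move=> Ix; exists x => //; rewrite subrr; exact: (ideal0 HJ). Qed.

Lemma ideal_sum_r x : J x -> ideal_sum x.
Proof. by move=> Jx; exists 0; [exact: (ideal0 HI)|rewrite subr0]. Qed.

End IdealSums.

Section RelmorComp.
Variables (F G E : relgraph) (m : relmor F G) (n : relmor G E).

Lemma comp_hereditary : hereditary (~` gvset (gcomp n m)).
Proof.
move=> e re [v _ vE]; apply: re; have [[w _ wE]|rG] := pselect (gvset n (rng e)).
  have eG : geset n e by apply: relmor_full; [exists w|exists (gv m v)].
  case: eG => e' _ e'E; rewrite -e'E ge_rng /=.
  have [[u _ uE]|rF] := pselect (gvset m (rng e')).
    by exists u => //=; rewrite uE.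
  exfalso; apply: (rm_hereditary rF); exists v => //.
  by apply: (@gv_inj _ _ n); rewrite -ge_src e'E.
by exfalso; apply: (rm_hereditary rG); exists (gv m v).
Qed.

Lemma comp_full : geset (gcomp n m) =
  [set e | gvset (gcomp n m) (rng e) /\ gvset (gcomp n m) (src e)].
Proof.
apply/seteqP; split=> [_ [e _ <-]|e [[v _ vE] [w _ wE]]].
  by rewrite /= !ge_rng !ge_src; split; [exists (rng e)|exists (src e)].
have : geset n e by apply: relmor_full; [exists (gv m v)|exists (gv m w)].
case=> e' _ e'E; have : geset m e'.
  by apply: relmor_full; [exists v|exists w] => //; apply: (@gv_inj _ _ n);
    rewrite -?ge_rng -?ge_src e'E.
by case=> e0 _ e0E; exists e0 => //=; rewrite e0E.
Qed.

Lemma comp_set : gv (gcomp n m) @^-1` rg_set E `<=` rg_set F.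
Proof. by move=> v vE; apply: (rm_set (r := m)); apply: (rm_set (r := n)). Qed.

Definition comp_relmor : relmor F E := RelMor comp_hereditary comp_full comp_set.

End RelmorComp.

(** The analogue of a canonical map whose target is an arbitrary C*-algebra with
    a family for F instead of the universal one. *)
Record extends_by_zero (R : realType) (F E : relgraph) (i : gemb F E)
    (T : TCstar R E) (D : cstarAlgType R) (p : vert F -> D) (s : edge F -> D)
    (f : T -> D) : Prop := {
  ez_hom : star_hom f ;
  ez_p : forall v, f (tc_p T (gv i v)) = p v ;
  ez_p0 : forall v, ~ gvset i v -> f (tc_p T v) = 0 ;
  ez_s : forall e, f (tc_s T (ge i e)) = s e ;
  ez_s0 : forall e, ~ geset i e -> f (tc_s T e) = 0
}.

Section ExtensionByZero.
Variables (R : realType) (F E : relgraph) (m : relmor F E) (T : TCstar R E).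
Variables (D : cstarAlgType R) (p : vert F -> D) (s : edge F -> D).
Hypothesis ps : @toeplitz_family R (no_ck_graph F) D p s.
Hypothesis ck : forall v, rg_set E (gv m v) -> p v = range_sum s v.

Definition zext (X Y : choiceType) (h : X -> Y) (k : X -> D) (y : Y) : D :=
  if pselect (exists x, h x = y) is left H then k (sval (cid H)) else 0.

Lemma zextE (X Y : choiceType) (h : X -> Y) (k : X -> D) x :
  injective h -> zext h k (h x) = k x.
Proof.
move=> hi; rewrite /zext; case: pselect => [H|[]]; last by exists x.
by congr k; apply: hi; exact: (svalP (cid H)).
Qed.

Lemma zext0 (X Y : choiceType) (h : X -> Y) (k : X -> D) y :
  ~ range h y -> zext h k y = 0.
Proof.
by move=> hy; rewrite /zext; case: pselect => // -[x xy]; case: hy; exists x.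
Qed.

Let P := zext (gv m) p.
Let S := zext (ge m) s.
Let PE v : P (gv m v) = p v. Proof. exact/zextE/gv_inj. Qed.
Let SE e : S (ge m e) = s e. Proof. exact/zextE/ge_inj. Qed.
Let P0 v : ~ gvset m v -> P v = 0. Proof. exact: zext0. Qed.
Let S0 e : ~ geset m e -> S e = 0. Proof. exact: zext0. Qed.

(** At a vertex outside F the Cuntz-Krieger relation reads 0 = 0, because edges with
    range outside F are not in F. *)
Lemma zext_family : toeplitz_family P S.
Proof.
split.
- move=> v; have [[w _ <-]|vF] := pselect (gvset m v).
    by rewrite PE; exact: (tf_proj ps).
  by rewrite P0 // cmul0l star0.
- move=> v w vw; have [[v' _ vE]|vF] := pselect (gvset m v); last first.
    by rewrite P0 // cmul0l.
  have [[w' _ wE]|wF] := pselect (gvset m w); last by rewrite (P0 wF) cmul0r.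
  rewrite -vE -wE !PE (tf_orth ps) // => vw'.
  by apply: vw; rewrite -vE -wE vw'.
- move=> e; have [[w _ <-]|eF] := pselect (geset m e).
    by rewrite SE; exact: (tf_piso ps).
  by rewrite S0 // cmul0r.
- move=> e; have [[w _ <-]|eF] := pselect (geset m e).
    by rewrite SE ge_src PE; exact: (tf_src ps).
  by rewrite S0 // cmul0r P0 //; exact: relmor_edge.
- move=> e f ef; have [[e' _ eE]|eF] := pselect (geset m e); last first.
    by rewrite S0 // star0 cmul0l.
  have [[f' _ fE]|fF] := pselect (geset m f); last by rewrite (S0 fF) cmul0r.
  rewrite -eE -fE !SE (tf_perp ps) // => ef'.
  by apply: ef; rewrite -eE -fE ef'.
- move=> e; have [[w _ <-]|eF] := pselect (geset m e).
    by rewrite SE ge_rng PE; exact: (tf_rng ps).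
  by rewrite S0 // cmul0r.
move=> v vA; have [[w _ wE]|vF] := pselect (gvset m v).
  rewrite -wE in vA *; rewrite PE ck // range_sum_embed => [|e _]; last exact: S0.
  by congr range_sum; apply/funext => e /=; rewrite SE.
rewrite P0 // /range_sum fsbig1 // => e ev; rewrite S0 ?cmul0l // => -[e' _ e'E].
by apply: vF; rewrite -ev -e'E ge_rng; exists (rng e').
Qed.

Lemma zext_hom : exists f : T -> D, extends_by_zero m p s f.
Proof.
have [f [fh fp fs]] := tc_universal T zext_family.
exists f; split=> //.
- by move=> v; rewrite fp PE.
- by move=> v vF; rewrite fp P0.
- by move=> e; rewrite fs SE.
- by move=> e eF; rewrite fs S0.
Qed.

End ExtensionByZero.

Lemma extends_comp (R : realType) (F G E : relgraph) (m : gemb F G) (n : gemb G E)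
    (T : TCstar R E) (T' : TCstar R G) (D : cstarAlgType R)
    (p : vert F -> D) (s : edge F -> D) (f : T -> T') (g : T' -> D) :
  canonical_map n f -> extends_by_zero m p s g ->
  extends_by_zero (gcomp n m) p s (g \o f).
Proof.
move=> cf eg; have gh := ez_hom eg; split=> /=.
- exact: star_hom_comp (cm_hom cf) gh.
- by move=> v; rewrite (cm_p cf) (ez_p eg).
- move=> v vF; have [[w _ wE]|vG] := pselect (gvset n v).
    rewrite -wE (cm_p cf) (ez_p0 eg) // => -[u _ uE].
    by apply: vF; exists u => //=; rewrite uE.
  by rewrite (cm_p0 cf) // star_hom0.
- by move=> v; rewrite (cm_s cf) (ez_s eg).
- move=> v vF; have [[w _ wE]|vG] := pselect (geset n v).
    rewrite -wE (cm_s cf) (ez_s0 eg) // => -[u _ uE].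
    by apply: vF; exists u => //=; rewrite uE.
  by rewrite (cm_s0 cf) // star_hom0.
Qed.

Lemma extends_unique (R : realType) (F E : relgraph) (m : gemb F E)
    (T : TCstar R E) (D : cstarAlgType R) (p : vert F -> D) (s : edge F -> D)
    (f g : T -> D) :
  extends_by_zero m p s f -> extends_by_zero m p s g -> forall x, f x = g x.
Proof.
move=> ef eg x.
refine (eq_on_generators (ez_hom ef) (ez_hom eg) (@tc_generated _ _ T) _ x).
move=> _ [[v _ <-]|[e _ <-]].
  have [[w _ <-]|vF] := pselect (gvset m v); first by rewrite (ez_p ef) (ez_p eg).
  by rewrite (ez_p0 ef) // (ez_p0 eg).
have [[w _ <-]|eF] := pselect (geset m e); first by rewrite (ez_s ef) (ez_s eg).
by rewrite (ez_s0 ef) // (ez_s0 eg).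
Qed.

(** Modulo an ideal containing the vertices outside F2, the edges of F1 that
    are not in F0 vanish, so the gaps at a common vertex agree. *)
Lemma gap_diff (R : realType) (F0 F1 F2 E : relgraph)
    (a1 : relmor F0 F1) (a2 : relmor F0 F2) (i1 : gemb F1 E) (i2 : gemb F2 E)
    (HE : is_pushout a1 a2 i1 i2) (T : TCstar R E) (J : set T)
    (HJ : closed_ideal J) v :
  (forall u, ~ gvset i2 u -> J (tc_p T u)) -> finite_set (in_edges (gv a1 v)) ->
  J (gap (gcomp i1 a1) (tc_p T) (tc_s T) v - gap i1 (tc_p T) (tc_s T) (gv a1 v)).
Proof.
move=> Jp fv; have qh := ideal_proj_hom HJ.
have fv0 : finite_set (in_edges v).
  have : finite_set (ge a1 @^-1` in_edges (gv a1 v)).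
    by apply: finite_preimage => // e e' _ _; exact: ge_inj.
  by apply: sub_finite_set => e ev; rewrite /in_edges /= ge_rng ev.
apply/(ideal_proj_ker HJ); rewrite !(star_homB _ _ qh) !(range_sum_hom _ qh) //.
rewrite [X in _ - (_ - X)]range_sum_embed ?subrr // => e ev eF.
rewrite /= -(tf_s_src (tc_family T)) (star_homM qh).
rewrite (proj2 (ideal_proj_ker HJ (tc_p T (src (ge i1 e))))) ?cmul0r //.
apply: Jp; rewrite ge_src => -[w _ /esym/(pushout_both HE)[u [u1 _]]].
by apply: (relmor_edge eF); exists u.
Qed.

Section Square.
Variables (R : realType) (F0 F1 F2 E : relgraph).
Variables (a1 : relmor F0 F1) (a2 : relmor F0 F2).
Variables (i1 : gemb F1 E) (i2 : gemb F2 E).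
Hypothesis HE : is_pushout a1 a2 i1 i2.
Variables (T : TCstar R E) (T1 : TCstar R F1) (T2 : TCstar R F2) (T0 : TCstar R F0).
Variables (pi1 : T -> T1) (pi2 : T -> T2) (rho1 : T1 -> T0) (rho2 : T2 -> T0).
Hypotheses (Hpi1 : canonical_map i1 pi1) (Hpi2 : canonical_map i2 pi2).
Hypotheses (Hrho1 : canonical_map a1 rho1) (Hrho2 : canonical_map a2 rho2).

Let i0 := gcomp i1 a1.
Let m1 : relmor F1 E := pushout_relmor HE.
Let m2 : relmor F2 E := pushout_relmor (pushout_sym HE).
Let m0 : relmor F0 E := comp_relmor a1 m1.
Let A0 : set (vert F0) := rg_set F0.
Let A1 : set (vert F0) := gv a1 @^-1` rg_set F1.
Let A2 : set (vert F0) := gv a2 @^-1` rg_set F2.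

Let finA0 v : A0 v -> finite_set (in_edges v).
Proof. by move=> /(@rg_set_reg F0)[]. Qed.

Lemma extends_swap (D : cstarAlgType R) (p : vert F0 -> D) (s : edge F0 -> D)
    (f : T -> D) :
  extends_by_zero (gcomp i2 a2) p s f -> extends_by_zero i0 p s f.
Proof.
move=> ef; split; first exact: (ez_hom ef).
- by move=> v; rewrite /= (po_commv HE) (ez_p ef).
- move=> v vF; apply: (ez_p0 ef) => -[w _ wE]; apply: vF.
  by exists w => //=; rewrite (po_commv HE).
- by move=> v; rewrite /= (po_comme HE) (ez_s ef).
- move=> v vF; apply: (ez_s0 ef) => -[w _ wE]; apply: vF.
  by exists w => //=; rewrite (po_comme HE).
Qed.

Lemma canonical_extends (F G : relgraph) (n : gemb F G) (S : TCstar R G)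
    (S' : TCstar R F) (f : S -> S') :
  canonical_map n f -> extends_by_zero n (tc_p S') (tc_s S') f.
Proof. by case. Qed.

Lemma extends_canonical (F G : relgraph) (n : gemb F G) (S : TCstar R G)
    (S' : TCstar R F) (f : S -> S') :
  extends_by_zero n (tc_p S') (tc_s S') f -> canonical_map n f.
Proof. by case. Qed.

Lemma square_commutes x : rho1 (pi1 x) = rho2 (pi2 x).
Proof.
have e1 := extends_comp Hpi1 (canonical_extends Hrho1).
have e2 := extends_swap (extends_comp Hpi2 (canonical_extends Hrho2)).
exact: (extends_unique e1 e2).
Qed.

Local Notation p := (tc_p T).
Local Notation s := (tc_s T).
Let fT : toeplitz_family p s := tc_family T.

Lemma gap_swap v : gap (gcomp i2 a2) p s v = gap i0 p s v.
Proof.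
rewrite /gap /= (po_commv HE); congr (_ - range_sum _ _).
by apply/funext => e /=; rewrite (po_comme HE).
Qed.

Lemma ez_gap (D : cstarAlgType R) (pp : vert F0 -> D) (ss : edge F0 -> D)
    (f : T -> D) v :
  extends_by_zero i0 pp ss f -> A0 v ->
  f (gap i0 p s v) = pp v - range_sum ss v.
Proof.
move=> ef A0v; have fh := ez_hom ef.
rewrite (star_homB _ _ fh) (ez_p ef) (range_sum_hom _ fh (finA0 A0v)).
by congr (_ - range_sum _ _); apply/funext => e /=; rewrite (ez_s ef).
Qed.

Section Admissible.
Hypothesis adm : A0 `<=` A1 `|` A2.

Let J1 := rel_ideal T i1 (rg_set F1).
Let J2 := rel_ideal T i2 (rg_set F2).
Let HJ1 : closed_ideal J1 := @closed_ideal_genP _ _ _.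
Let HJ2 : closed_ideal J2 := @closed_ideal_genP _ _ _.
Let K := ideal_sum J1 J2.
Let HK : closed_ideal K :=
  ideal_sum_ideal HJ1 HJ2 (@ideals_orthogonal _ _ _ _ _ _ _ _ _ HE T).

Let ker1 x : pi1 x = 0 <-> J1 x.
Proof. exact: (@canonical_ker _ _ _ m1). Qed.

Let ker2 x : pi2 x = 0 <-> J2 x.
Proof. exact: (@canonical_ker _ _ _ m2). Qed.

(** Admissibility puts each gap projection of F0 in the sum of the two kernels:
    up to an element of the other kernel, the gap at a vertex of A1 is a generator
    of the first one, and symmetrically. *)
Lemma diagonal_kernel x : rho1 (pi1 x) = 0 -> K x.
Proof.
have cm0 : canonical_map m0 (rho1 \o pi1).
  exact: extends_canonical (extends_comp Hpi1 (canonical_extends Hrho1)).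
apply: (canonical_ker_sub cm0 HK) => _ [[v v0 <-]|[v [vA0 vE] <-]].
  have [[w _ wE]|v1] := pselect (gvset i1 v); last first.
    apply: ideal_sum_l => //; apply: (@sub_closed_ideal_gen _ _ (rel_gens m1 (rg_set F1))).
    by left; exists v.
  apply: ideal_sum_r => //; apply: (@sub_closed_ideal_gen _ _ (rel_gens m2 (rg_set F2))).
  left; exists v => // -[w' _ w'E]; apply: v0.
  have [|u [u1 _]] := pushout_both HE (v1 := w) (v2 := w'); first by rewrite wE w'E.
  by exists u => //=; rewrite u1.
case: (adm vA0) => [v1|v2].
  exists (gap i1 p s (gv a1 v)).
    apply: (@sub_closed_ideal_gen _ _ (rel_gens m1 (rg_set F1))).
    by right; exists (gv a1 v).
  apply: (gap_diff HE HJ2) => [u u2|]; last by case: (rg_set_reg v1).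
  by apply: (@sub_closed_ideal_gen _ _ (rel_gens m2 (rg_set F2))); left; exists u.
exists (gap i0 p s v - gap i2 p s (gv a2 v)).
  rewrite -gap_swap; apply: (gap_diff (pushout_sym HE) HJ1) => [u u1|].
    by apply: (@sub_closed_ideal_gen _ _ (rel_gens m1 (rg_set F1))); left; exists u.
  by case: (rg_set_reg v2).
rewrite subKr; apply: (@sub_closed_ideal_gen _ _ (rel_gens m2 (rg_set F2))).
by right; exists (gv a2 v) => //; split=> //=; rewrite -(po_commv HE).
Qed.

(** Uniqueness: an element of both kernels satisfies x^* x = 0. Existence: lifts of
    the two components differ by an element of the sum of the kernels, which can
    be absorbed on either side. *)
Lemma square_pullback : is_pullback pi1 pi2 rho1 rho2.
Proof.
split; first exact: square_commutes.
move=> D a b ah bh ab.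
have h1 := cm_hom Hpi1; have h2 := cm_hom Hpi2.
have inj x y : pi1 x = pi1 y -> pi2 x = pi2 y -> x = y.
  move=> e1 e2; apply/eqP; rewrite -subr_eq0; apply/eqP.
  have k1 : J1 (x - y) by apply/ker1; rewrite (star_homB _ _ h1) e1 subrr.
  have k2 : J2 (x - y) by apply/ker2; rewrite (star_homB _ _ h2) e2 subrr.
  exact: star_conjM (ideals_orthogonal HE (ideal_star HJ1 k1) k2).
have lift x : exists y, pi1 y = a x /\ pi2 y = b x.
  have [y1 y1E] := @canonical_surj _ _ _ m1 _ _ _ Hpi1 (a x).
  have [y2 y2E] := @canonical_surj _ _ _ m2 _ _ _ Hpi2 (b x).
  have /diagonal_kernel [k k1 k2] : rho1 (pi1 (y1 - y2)) = 0.
    rewrite (star_homB _ _ h1) (star_homB _ _ (cm_hom Hrho1)) y1E.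
    by rewrite ab square_commutes y2E subrr.
  exists (y1 - k); split.
    by rewrite (star_homB _ _ h1) (proj2 (ker1 k) k1) subr0.
  have -> : y1 - k = (y1 - y2 - k) + y2 by rewrite addrAC subrK.
  by rewrite (star_homD h2) (proj2 (ker2 _) k2) add0r.
pose d x := sval (cid (lift x)).
have d1 x : pi1 (d x) = a x by exact: (svalP (cid (lift x))).1.
have d2 x : pi2 (d x) = b x by exact: (svalP (cid (lift x))).2.
exists d; split.
  split=> //; split=> *; apply: inj.
  - by rewrite (star_homD h1) !d1 (star_homD ah).
  - by rewrite (star_homD h2) !d2 (star_homD bh).
  - by rewrite (star_homZ h1) !d1 (star_homZ ah).
  - by rewrite (star_homZ h2) !d2 (star_homZ bh).
  - by rewrite (star_homM h1) !d1 (star_homM ah).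
  - by rewrite (star_homM h2) !d2 (star_homM bh).
  - by rewrite (star_hom_star h1) !d1 (star_hom_star ah).
  - by rewrite (star_hom_star h2) !d2 (star_hom_star bh).
by move=> d' [_ d'1 d'2]; apply/funext => x; apply: inj; rewrite ?d1 ?d2.
Qed.

End Admissible.

Section Separation.
Variable v0 : vert F0.
Hypotheses (A0v : A0 v0) (A1v : ~ A1 v0) (A2v : ~ A2 v0).

(** The paths with source v0 give compatible representations of the two
    relative Toeplitz algebras in which the gap projection of F0 at v0 is the
    projection onto the path of length zero. *)
Lemma path_separation : exists (D : cstarAlgType R) (f1 : T1 -> D) (f2 : T2 -> D),
  [/\ star_hom f1, star_hom f2, forall x, f1 (pi1 x) = f2 (pi2 x),
      f1 (pi1 (gap i0 p s v0)) <> 0 &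
      forall v, ~ gvset i0 v -> f1 (pi1 (p v)) = 0] /\
  forall v, A0 v -> v <> v0 -> f1 (pi1 (gap i0 p s v)) = 0.
Proof.
pose D := op_algebra (fspace R (seq (edge F0))).
pose pp : vert F0 -> D := @path_p R F0 v0; pose ss : edge F0 -> D := @path_s R F0 v0.
have fam : @toeplitz_family R (no_ck_graph F0) D pp ss := @path_family R F0 v0.
have ck v : A0 v -> v <> v0 -> pp v = range_sum ss v.
  by move=> vA /eqP vv; apply: path_ck => //; exact: rg_set_reg vA.
have ck1 v : rg_set F1 (gv a1 v) -> pp v = range_sum ss v.
  move=> v1; apply: ck; first exact: (rm_set (r := a1)).
  by move=> vv; apply: A1v; rewrite /A1 /= -vv.
have ck2 v : rg_set F2 (gv a2 v) -> pp v = range_sum ss v.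
  move=> v2; apply: ck; first exact: (rm_set (r := a2)).
  by move=> vv; apply: A2v; rewrite /A2 /= -vv.
have [f1 e1] := zext_hom T1 fam ck1; have [f2 e2] := zext_hom T2 fam ck2.
have x1 := extends_comp Hpi1 e1; have x2 := extends_swap (extends_comp Hpi2 e2).
exists D, f1, f2; split; first split.
- exact: ez_hom e1.
- exact: ez_hom e2.
- exact: (extends_unique x1 x2).
- rewrite -[f1 _]/((f1 \o pi1) _) (ez_gap x1) // => /eqP; rewrite subr_eq0 => /eqP.
  exact: path_gap (finA0 A0v).
- exact: (ez_p0 x1).
move=> v vA vv; rewrite -[f1 _]/((f1 \o pi1) _) (ez_gap x1) // ck //.
exact: subrr.
Qed.

(** The scalars map to TC^*(F1,A1) by the gap projection at v0 and to TC^*(F2,A2)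
    by zero. A lift y of this pair would have the same image as the gap under f1
    and the image 0 under f2, while both images agree. *)
Lemma not_pullback : ~ is_pullback pi1 pi2 rho1 rho2.
Proof.
move=> [_ pb]; have [D [f1 [f2 [[f1h f2h f12 f1g _] _]]]] := path_separation.
have gi := gap_idem i0 fT (finA0 A0v); have gs := gap_star i0 fT (finA0 A0v).
set g := gap i0 p s v0 in gi gs f1g.
have h1 := cm_hom Hpi1.
have g0 : rho1 (pi1 g) = 0.
  have ez := extends_comp Hpi1 (canonical_extends Hrho1).
  rewrite -[LHS]/((rho1 \o pi1) g) (ez_gap ez) // (tf_ck (tc_family T0) A0v).
  exact: subrr.
have gi1 : pi1 g ** pi1 g = pi1 g by rewrite -(star_homM h1) gi.
have gs1 : star (pi1 g) = pi1 g by rewrite -(star_hom_star h1) gs.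
have ah := projection_hom gi1 gs1.
have bh : star_hom ((fun=> 0) : complex_alg R -> T2).
  by split=> *; rewrite ?addr0 ?scaler0 ?cmul0l ?star0.
have [|d [[_ d1 d2] _]] := pb _ _ _ ah bh.
  move=> x; rewrite (star_homZ (cm_hom Hrho1)) g0 scaler0 star_hom0 //.
  exact: cm_hom Hrho2.
apply: f1g; have := d1 (spi (complex_seminorm R) 1).
rewrite complex_sreprK scale1r => <-.
by rewrite f12 d2 star_hom0.
Qed.

Lemma ideals_differ :
  rel_ideal T i0 A0 <> rel_ideal T i0 (A1 `|` A2).
Proof.
have [D [f1 [f2 [[f1h _ _ f1g f1p] f1v]]]] := path_separation.
have fh := star_hom_comp (cm_hom Hpi1) f1h.
move=> A012; apply: f1g.
have : rel_ideal T i0 A0 (gap i0 p s v0).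
  apply: (@sub_closed_ideal_gen _ _ (rel_gens m0 A0)); right; exists v0 => //.
  by split=> // /(pushout_set_mem HE)[].
rewrite A012; apply: (closed_ideal_gen_min (ker_closed_ideal fh)).
move=> _ [[v vF <-]|[v [vA vE] <-]] /=; first exact: f1p.
apply: f1v; last by move=> vv; move: vA; rewrite vv => -[].
by case: vA => vA; [exact: (rm_set (r := a1))|exact: (rm_set (r := a2))].
Qed.

End Separation.
End Square.

Theorem theorem6p9 (R : realType) (F0 F1 F2 E : relgraph)
    (a1 : relmor F0 F1) (a2 : relmor F0 F2)
    (i1 : gemb F1 E) (i2 : gemb F2 E) (HE : is_pushout a1 a2 i1 i2)
    (T : TCstar R E) (T1 : TCstar R F1) (T2 : TCstar R F2) (T0 : TCstar R F0)
    (pi1 : T -> T1) (pi2 : T -> T2) (rho1 : T1 -> T0) (rho2 : T2 -> T0)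
    (Hpi1 : canonical_map i1 pi1) (Hpi2 : canonical_map i2 pi2)
    (Hrho1 : canonical_map a1 rho1) (Hrho2 : canonical_map a2 rho2) :
  let i0 := gcomp i1 a1 in
  let A0 : set (vert F0) := rg_set F0 in
  (* the traces on F0 of A1, A2, sing(F1), sing(F2) and reg(E) *)
  let A1 : set (vert F0) := gv a1 @^-1` rg_set F1 in
  let A2 : set (vert F0) := gv a2 @^-1` rg_set F2 in
  let sing1 : set (vert F0) := gv a1 @^-1` sing F1 in
  let sing2 : set (vert F0) := gv a2 @^-1` sing F2 in
  let regE : set (vert F0) := gv i0 @^-1` reg E in
  let A12 : set (vert F0) := A1 `|` A2 in
  [<-> is_pullback pi1 pi2 rho1 rho2;
       A0 `<=` A1 `|` A2;
       A0 = A12;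
       rel_ideal T i0 A0 = rel_ideal T i0 A12;
       [/\ A0 `&` sing1 `<=` A2, A0 `&` sing2 `<=` A1
         & A0 `&` regE `<=` A1 `|` A2]].
Proof.
move=> i0 A0 A1 A2 sing1 sing2 regE A12.
(* The edges of E with a given range are those of F1 and those of F2. *)
have reg12 v : reg F1 (gv a1 v) -> reg F2 (gv a2 v) -> reg E (gv i0 v).
  move=> [f1 [e ev]] [f2 _]; split; last by exists (ge i1 e); rewrite /in_edges /= ge_rng ev.
  have : finite_set (ge i1 @` in_edges (gv a1 v) `|` ge i2 @` in_edges (gv a2 v)).
    by rewrite finite_setU; split; exact: finite_image.
  apply: sub_finite_set => f fv; case: (pushout_edge_cases HE f) => -[e' _ e'E].
    left; exists e' => //; apply: (@gv_inj _ _ i1).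
    by rewrite -ge_rng e'E fv.
  right; exists e' => //; apply: (@gv_inj _ _ i2).
  by rewrite -ge_rng e'E fv /= (po_commv HE).
tfae.
- move=> pb v A0v; apply: contrapT => /not_orP[v1 v2].
  exact: (not_pullback HE Hpi1 Hpi2 Hrho1 Hrho2 A0v v1 v2) pb.
- move=> adm; apply/seteqP; split=> // v [v1|v2].
    exact: (rm_set (r := a1)).
  exact: (rm_set (r := a2)).
- by move=> ->.
- move=> I012; have adm : A0 `<=` A12.
    move=> v A0v; apply: contrapT => /not_orP[v1 v2].
    exact: (ideals_differ HE Hpi1 Hpi2 A0v v1 v2) I012.
  split=> v [A0v vs]; last exact: adm.
    by case: (adm v A0v) => // /rg_set_reg.
  by case: (adm v A0v) => // /rg_set_reg.
- move=> [s1 s2 rE]; apply: (square_pullback HE Hpi1 Hpi2 Hrho1 Hrho2) => v A0v.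
  have [r1|] := pselect (reg F1 (gv a1 v)); last by move=> r1; right; exact: s1.
  have [r2|] := pselect (reg F2 (gv a2 v)); last by move=> r2; left; exact: s2.
  by apply: rE; split=> //; exact: reg12.
Qed.
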